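(* Let $p\geq1$ with $p<\kappa$. Assume that $X_0$ and $\tilde X_0$ have the same law. Let $Y$ and $\tilde Y$ be solutions of $$Y_t=Y_0-\int_0^t\lambda(X_u)Y_u\,du+\int_0^t\sigma(X_u)\,dB_u,\qquad \tilde Y_t=\tilde Y_0-\int_0^t\lambda(\tilde X_u)\tilde Y_u\,du+\int_0^t\sigma(\tilde X_u)\,d\tilde B_u,$$ associated to $(X_t)$ and $(\tilde X_t)$ respectively, and assume that $Y_0$ and $\tilde Y_0$ have finite moments of order $p$. Then there exists a constant $C(p)$ such that for all $t\ge0$, $$W_p\big(\mathcal{L}(Y_t),\mathcal{L}(\tilde Y_t)\big)^p\leq C(p)\,e^{-\eta_p t}\,W_p\big(\mathcal{L}(Y_0),\mathcal{L}(\tilde Y_0)\big)^p .$$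
   Context: $X$ and $\tilde X$ are continuous-time Markov processes on the finite set $E=\{1,\dots,d\}$, $d\geq2$, with the same infinitesimal generator $A=(A(x,\tilde x))_{x,\tilde x\in E}$, whose embedded chain (transition matrix $P(x,\tilde x)=-A(x,\tilde x)/A(x,x)$ for $x\neq\tilde x$) is irreducible recurrent. $\lambda:E\to\mathbb{R}$ and $\sigma:E\to(0,\infty)$ are functions; $B$ and $\tilde B$ are standard real Brownian motions; $B$, $Y_0$, $X$ are independent, and $\tilde B$, $\tilde Y_0$, $\tilde X$ are independent. $\mathcal{L}(\cdot)$ denotes the law of a random variable. For $p\ge0$, $A_p=A-p\Lambda$, where $\Lambda$ is the diagonal matrix with diagonal $(\lambda(1),\dots,\lambda(d))$, $\eta_p=-\max_{\gamma\in\mathrm{Spec}(A_p)}\mathrm{Re}\,\gamma$, and $\kappa=\sup\{p\ge0:\eta_p>0\}$. For $p\geq1$ and probability measures $\rho,\tilde\rho$ on $\mathbb{R}$ with finite $p$-th moment, $W_p(\rho,\tilde\rho)=\big(\inf_\pi\int|y-\tilde y|^p\,\pi(dy,d\tilde y)\big)^{1/p}$, the infimum being over probability measures $\pi$ on $\mathbb{R}^2$ with marginals $\rho$ and $\tilde\rho$. The constant $C(p)$ depends only on $p$ and on the model data $(A,\lambda,\sigma)$. *)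

(* Defs.v *)
From mathcomp Require Import all_boot all_order all_algebra.
From mathcomp Require Import all_classical all_reals all_analysis.
From mathcomp Require Import complex.

Set Implicit Arguments.
Unset Strict Implicit.
Unset Printing Implicit Defensive.

Import Order.TTheory GRing.Theory Num.Theory.
Import numFieldNormedType.Exports.

Local Open Scope classical_set_scope.
Local Open Scope ring_scope.

(* Processes are indexed by R and only their values at times t >= 0 are ever
   constrained.  The state space {1, ..., d} is 'I_d with its discrete
   sigma-algebra [set: set 'I_d]. *)

Section generator.
Context {R : realType} {d : nat}.
Implicit Types (A M : 'M[R]_d) (lambda : 'I_d -> R) (p : R).

Definition generator_matrix A : Prop :=
  (forall x y, x != y -> 0 <= A x y) /\ (forall x, \sum_y A x y = 0).

Definition embedded_chain A : 'M[R]_d :=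
  \matrix_(x, y) if x == y then 0 else - A x y / A x x.

Definition irreducible_chain M : Prop :=
  forall x y, exists n : nat, 0 < (M ^+ n) x y.

(* Probability that the chain M started at x visits y, at a time >= 1, for the
   first time at time n.+1. *)
Fixpoint first_visit M (n : nat) (x y : 'I_d) : R :=
  if n is m.+1 then \sum_(z | z != y) M x z * first_visit M m z y
  else M x y.

Definition recurrent_chain M : Prop :=
  forall x, series (fun n => first_visit M n x x) @ \oo --> (1 : R).

Definition shifted_generator A lambda p : 'M[R]_d := A - p *: diag_mx (\row_x lambda x).

Definition spectrum M : set R[i] :=
  [set z | eigenvalue (map_mx (real_complex R) M) z].

(* The spectrum is finite, and nonempty for d > 0, so this sup is a max. *)
Definition eta A lambda p : R :=
  - sup [set complex.Re z | z in spectrum (shifted_generator A lambda p)].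

Definition kappa A lambda : \bar R :=
  ereal_sup [set p%:E | p in [set p : R | 0 <= p /\ 0 < eta A lambda p]].

Definition transition_semigroup (Q : R -> 'M[R]_d) : Prop :=
  [/\ forall t : R, 0 <= t -> forall x y, 0 <= Q t x y,
      forall t : R, 0 <= t -> forall x, \sum_y Q t x y = 1,
      Q 0 = 1%:M &
      forall s t : R, 0 <= s -> 0 <= t -> Q (s + t) = Q s *m Q t].

Definition infinitesimal_generator (Q : R -> 'M[R]_d) A : Prop :=
  forall x y, (fun t => (Q t x y - (x == y)%:R) / t) @ 0^'+ --> A x y.

Definition cadlag (c : R -> 'I_d) : Prop :=
  (forall t : R, 0 <= t -> \forall u \near t^'+, c u = c t) /\
  (forall t : R, 0 < t -> exists x, \forall u \near t^'-, c u = x).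

End generator.

Section processes.
Context {R : realType} {disp : measure_display} {T : measurableType disp}.
Variable P : probability T R.

(* sigma-algebra generated by the Z i, i in D, S having sigma-algebra G *)
Definition sigma_of {I S : Type} (D : set I) (G : set_system S)
    (Z : I -> T -> S) : set_system T :=
  <<s \bigcup_(i in D) preimage_set_system setT (Z i) G >>.

Definition independent2 (F G : set_system T) : Prop :=
  forall E1 E2, F E1 -> G E2 -> P (E1 `&` E2) = (P E1 * P E2)%E.

(* For sigma-algebras the triple product rule is mutual independence, since
   each of the events may be taken to be the whole space. *)
Definition independent3 (F G H : set_system T) : Prop :=
  forall E1 E2 E3, F E1 -> G E2 -> H E3 ->
    P (E1 `&` E2 `&` E3) = (P E1 * P E2 * P E3)%E.

Definition markov_process (d : nat) (A : 'M[R]_d) (X : R -> T -> 'I_d) : Prop :=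
  [/\ forall t : R, 0 <= t -> forall x, measurable [set w | X t w = x],
      {ae P, forall w, cadlag (X ^~ w)} &
      exists Q : R -> 'M[R]_d,
        [/\ transition_semigroup Q, infinitesimal_generator Q A &
            (* P(X_(s+t) = y | X_u, u <= s) = Q_t(X_s, y) *)
            forall s t : R, 0 <= s -> 0 <= t -> forall x y E,
              sigma_of `[0, s] [set: set 'I_d] X E ->
              P (E `&` [set w | X s w = x] `&` [set w | X (s + t) w = y]) =
              (P (E `&` [set w | X s w = x]) * (Q t x y)%:E)%E]].

Definition brownian_motion (B : R -> {RV P >-> R}) : Prop :=
  [/\ {ae P, forall w, B 0 w = 0},
      {ae P, forall w, {within `[0, +oo[, continuous (fun t => B t w)}},
      forall s t : R, 0 <= s -> s < t ->
        independent2 (sigma_of `[0, s] measurable B)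
          (preimage_set_system setT (fun w => B t w - B s w) measurable) &
      (* the second parameter of normal_prob is the standard deviation *)
      forall s t : R, 0 <= s -> s < t -> forall U : set R, measurable U ->
        P [set w | U (B t w - B s w)] = normal_prob 0 (Num.sqrt (t - s)) U].

(* sum over i < n of xi_i * 1_]tau_i, tau_(i+1)], each xi_i being bounded and
   measurable for F (tau_i) *)
Record elementary_process (F : R -> set_system T) := ElementaryProcess {
  ep_size : nat ;
  ep_time : nat -> R ;
  ep_coef : nat -> T -> R ;
  _ : 0 <= ep_time 0%N ;
  _ : forall i, ep_time i <= ep_time i.+1 ;
  _ : forall i, exists M, forall w, `|ep_coef i w| <= M ;
  _ : forall i, preimage_set_system setT (ep_coef i) measurable
                  `<=` F (ep_time i) }.

Definition ep_val F (h : elementary_process F) (u : R) (w : T) : R :=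
  \sum_(i < ep_size h)
    ep_coef h i w * \1_(`]ep_time h i, ep_time h i.+1]%classic) u.

Definition ep_integral F (h : elementary_process F) (B : R -> {RV P >-> R})
    (t : R) (w : T) : R :=
  \sum_(i < ep_size h) ep_coef h i w *
    (B (Num.min (ep_time h i.+1) t) w - B (Num.min (ep_time h i) t) w).

(* I is (a version of) the Ito integral of H against B over [0, t]: the limit
   in L^2(P) of the integrals of F-elementary processes converging to H in
   L^2(P x [0, t]). *)
Definition is_ito_integral (F : R -> set_system T) (B : R -> {RV P >-> R})
    (H : R -> T -> R) (t : R) (I : {RV P >-> R}) : Prop :=
  exists h : nat -> elementary_process F,
    (\int[P]_w \int[lebesgue_measure]_(u in `[0%R, t])
       ((ep_val (h n) u w - H u w) ^+ 2)%:E)%E @[n --> \oo] --> 0%E /\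
    (\int[P]_w ((ep_integral (h n) B t w - I w) ^+ 2)%:E)%E
       @[n --> \oo] --> 0%E.

Definition driving_filtration (d : nat) (X : R -> T -> 'I_d)
    (B : R -> {RV P >-> R}) (Y0 : T -> R) (t : R) : set_system T :=
  <<s preimage_set_system setT Y0 measurable
      `|` sigma_of `[0, t] [set: set 'I_d] X
      `|` sigma_of `[0, t] measurable B >>.

(* Y_t = Y_0 - int_0^t lambda(X_u) Y_u du + int_0^t sigma(X_u) dB_u.  Both sides
   being continuous in t, asking for an almost sure equality at each t is the
   same as asking for it almost surely at all t. *)
Definition sde_solution (d : nat) (lambda sigma : 'I_d -> R)
    (X : R -> T -> 'I_d) (B Y : R -> {RV P >-> R}) : Prop :=
  {ae P, forall w, {within `[0, +oo[, continuous (fun t => Y t w)}} /\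
  forall t : R, 0 <= t -> exists I : {RV P >-> R},
    is_ito_integral (driving_filtration X B (Y 0)) B
      (fun u w => sigma (X u w)) t I /\
    {ae P, forall w, Y t w =
       Y 0 w - (\int[lebesgue_measure]_(u in `[0, t]) (lambda (X u w) * Y u w))
       + I w}.

Definition switched_model (d : nat) (A : 'M[R]_d) (lambda sigma : 'I_d -> R)
    (X : R -> T -> 'I_d) (B Y : R -> {RV P >-> R}) : Prop :=
  [/\ markov_process A X,
      brownian_motion B,
      independent3 (sigma_of `[0, +oo[ measurable B)
        (preimage_set_system setT (Y 0) measurable)
        (sigma_of `[0, +oo[ [set: set 'I_d] X) &
      sde_solution lambda sigma X B Y].

End processes.

Definition law {R : realType} {disp : measure_display}
    {T : measurableType disp} {P : probability T R} (Z : {RV P >-> R}) :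
  probability R R := distribution P Z.

Section wasserstein.
Context {R : realType}.

Definition finite_moment (p : R) (rho : probability R R) : Prop :=
  (\int[rho]_y (`|y| `^ p)%:E < +oo)%E.

Definition coupling (rho rho' : probability R R)
    (pi : probability (R * R)%type R) : Prop :=
  (forall U : set R, measurable U -> pi (fst @^-1` U) = rho U) /\
  (forall U : set R, measurable U -> pi (snd @^-1` U) = rho' U).

(* [0, +oo]-valued, so that it makes sense for all probability measures *)
Definition Wasserstein (p : R) (rho rho' : probability R R) : \bar R :=
  poweR
    (ereal_inf [set (\int[pi]_z (`|z.1 - z.2| `^ p)%:E)%E
               | pi in [set pi | coupling rho rho' pi]])
    p^-1.

End wasserstein.

(* Main.v *)
From HB Require Import structures.
Require Import Defs.
From mathcomp Require Import all_boot all_order all_algebra.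
From mathcomp Require Import all_classical all_reals all_analysis.
From mathcomp Require Import measurable_realfun.
From mathcomp Require Import complex lra ring.

(** The process is driven by a random affine map: [Y_t = M Y_0 + S] with
[M = exp (- int_0^t lambda (X_u) du)] and [(M, S)] a function of [(X, B)], hence
independent of [Y_0]. The law of [(M, S)] being the same in both models, the
laws of [Y_t] and [Y'_t] are the images of [law Y_0 x P] and [law Y'_0 x P]
under the same map [(y, w) |-> y M w + S w], so that a coupling of the initial
laws is transported to a coupling at time [t] whose cost is multiplied by
[E M^p].

To bound [E M^p], let [u > 0] be the Perron eigenvector of [A - p Lambda], with
eigenvalue [r <= - eta_p]: for a step [h], multiplying [E (M_k^p u (X_k))] by
[exp (h (r + epsilon))] bounds its value one step later, and Fatou's lemma
concludes.

Equality of the laws is read on discretizations. Solving the equation with a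
frozen damping on a grid of step [t / (n + 1)], the increments of the Ito
integral being in turn replaced by Riemann sums on a finer grid, one gets
functions of finitely many values of [X] and increments of [B], whose laws are
explicit; the fine limit is taken in L2 and the coarse one almost surely. *)

Import Order.TTheory GRing.Theory Num.Theory.
Import numFieldNormedType.Exports.

Local Open Scope classical_set_scope.
Local Open Scope ring_scope.

Set Implicit Arguments.
Unset Strict Implicit.
Unset Printing Implicit Defensive.

(** * Perron eigenvector *)

(** Obstacle: [is_ito_integral] provides some sequence of elementary processes, chosen freely and
    unrelated in the two models, from which no law can be read. Riemann sums on a fixed grid are a
    canonical substitute: an isometry for arbitrary, possibly overlapping, intervals controls their
    distance to whatever sequence is given.

    [S] is simply [Y_t - M Y_0]. A discrete Gronwall argument along each path, from the integral
    equation and the continuity of [Y], shows that it is the limit of the scheme started at 0.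

    The two models live on different spaces. [(M, S)] stays on the first one, and the law of [Y'_t]
    is expressed through it for every model with the same initial law of [X]; this applies to both
    models, the first included.

    The constant [C] bounds [max u / min u], the price of exchanging the Perron vector for 1, and so
    depends only on [A], [lambda] and [p]. The first order expansion of the semigroup yields the
    rates [s > r]; as [C] does not involve [s], letting [s] decrease to [r] at fixed [t] gives the
    rate [r] itself. *)

Lemma cvg_bigsum {R : realType} (U : Type) (F : set_system U) {FF : Filter F}
    (I : Type) (r : seq I) (f : I -> U -> R) (a : I -> R) :
  (forall i, f i @ F --> a i) ->
  (fun u => \sum_(i <- r) f i u) @ F --> \sum_(i <- r) a i.
Proof.
move=> fa; elim: r => [|i r IH].
  rewrite big_nil (_ : (fun u => _) = cst 0); first exact: cvg_cst.
  by apply/funext => u; rewrite big_nil.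
rewrite big_cons (_ : (fun u => _) = (fun u => f i u + \sum_(j <- r) f j u)).
  exact: cvgD (fa i) IH.
by apply/funext => u; rewrite big_cons.
Qed.

Lemma continuous_bigmin {R : realType} (T : topologicalType) (I : Type)
    (r : seq I) (f0 : T -> R) (f : I -> T -> R) (x : T) :
  {for x, continuous f0} -> (forall i, {for x, continuous (f i)}) ->
  {for x, continuous (fun z => \big[Num.min/f0 z]_(i <- r) f i z)}.
Proof.
move=> cf0 cf; elim: r => [|i r IH].
  rewrite (_ : (fun z => _) = f0)//.
  by apply/funext => z; rewrite big_nil.
rewrite (_ : (fun z => _) = f i \min (fun z => \big[Num.min/f0 z]_(i <- r) f i z)).
  exact: (@continuous_min _ _ (f i) _ x (cf i) IH).
by apply/funext => z; rewrite big_cons.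
Qed.

Lemma continuous_linear_coord {R : realType} m n (M : 'M[R]_(m.+1, n.+1)) j :
  continuous (fun x : 'rV[R]_m.+1 => (x *m M) 0 j).
Proof.
move=> x.
rewrite (_ : (fun x : 'rV[R]_m.+1 => (x *m M) 0 j) =
  (fun x : 'rV[R]_m.+1 => \sum_i x 0 i * M i j)); last first.
  by apply/funext => z; rewrite mxE.
apply: (@cvg_bigsum _ _ (nbhs x)) => i; apply: cvgMr_tmp.
exact: coord_continuous.
Qed.

Section perron.
Context {R : realType} {n : nat}.
Variables (N S : 'M[R]_n.+1).
Hypothesis S_gt0 : forall i j, 0 < S i j.
Hypothesis SN : S *m N = N *m S.

Let simplex : set 'rV[R]_n.+1 :=
  [set x | (forall i, 0 <= x 0 i <= 1) /\ \sum_i x 0 i = 1].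

Let simplex_compact : compact simplex.
Proof.
have -> : simplex = [set x : 'rV[R]_n.+1 | forall i, `[0, 1]%classic (x ord0 i)] `&`
    [set x | \sum_i x 0 i = 1].
  apply/seteqP; split => x /= [h1 h2]; split=> // i.
apply: compact_closedI.
  apply: (rV_compact (A := fun=> `[0, 1]%classic : set R)) => _.
  exact: segment_compact.
rewrite (_ : (fun x : 'rV[R]_n.+1 => _) =
    (fun x : 'rV[R]_n.+1 => \sum_i x 0 i) @^-1` [set 1])//.
apply: (proj1 (continuous_closedP _)); last exact: closed_eq.
by move=> x; apply: (@cvg_bigsum _ _ (nbhs x)) => i; exact: coord_continuous.
Qed.

Let pos_mul (x : 'rV[R]_n.+1) j : (forall i, 0 <= x 0 i) -> x != 0 ->
  0 < (x *m S) 0 j.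
Proof.
move=> x0 xn0; rewrite mxE lt_neqAle sumr_ge0 ?andbT; last first.
  by move=> i _; rewrite mulr_ge0// ltW.
apply: contra xn0; rewrite eq_sym psumr_eq0; last first.
  by move=> i _; rewrite mulr_ge0// ltW.
move=> /allP h; apply/eqP/rowP => i; rewrite mxE.
have := h i (mem_index_enum i); rewrite mulf_eq0 (gt_eqF (S_gt0 _ _)) orbF.
by move/eqP.
Qed.

Let simplex_n0 x : simplex x -> x != 0.
Proof.
move=> -[_ x1]; apply/eqP => x0; move: x1; rewrite x0 big1 => [/eqP|i _].
  by rewrite eq_sym oner_eq0.
by rewrite mxE.
Qed.

Let subscaleE (a b : 'rV[R]_n.+1) s i :
  (a - s *: b) 0 i = a 0 i - s * b 0 i.
Proof. by rewrite !mxE. Qed.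

Let ratio (x : 'rV[R]_n.+1) i := (x *m (S *m N)) 0 i / (x *m S) 0 i.
Let g x := \big[Num.min/ratio x ord0]_(i < n.+1) ratio x i.

(* Collatz-Wielandt: [x |-> x S] maps the simplex to positive vectors, on which
   the minimal ratio is continuous; at a maximizer [y] of that ratio, a nonzero
   defect [y N - s y >= 0] would become positive after multiplication by [S],
   giving a larger ratio. *)
Lemma perron : exists (s : R) (v : 'rV[R]_n.+1),
  (forall i, 0 < v 0 i) /\ v *m N = s *: v.
Proof.
pose one : 'rV[R]_n.+1 := \row_i (i == ord0)%:R.
have simplex0 : simplex !=set0.
  exists one; split => [i|]; first by rewrite mxE; case: eqP; rewrite !lexx ler01.
  rewrite (bigD1 ord0)//= big1 ?addr0 ?mxE ?eqxx// => i i0.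
  by rewrite mxE (negbTE i0).
have ratio_cont i x : simplex x -> {for x, continuous (ratio ^~ i)}.
  move=> sx; apply: continuousM; first exact: continuous_linear_coord.
  apply: continuousV; last exact: continuous_linear_coord.
  rewrite gt_eqF// pos_mul//; last exact: simplex_n0.
  by move=> j; case: sx => /(_ j)/andP[].
have [|x sx xmax] := compact_EVT_max simplex0 simplex_compact (f := g).
  apply: continuous_in_subspaceT => x /set_mem sx.
  by apply: (@continuous_bigmin R _ _ _ (ratio ^~ ord0) (fun i => ratio ^~ i)) => [|i]; exact: ratio_cont.
rewrite inE in sx.
have x0 i : 0 <= x 0 i by case: sx => /(_ i)/andP[].
set y := x *m S; set s := g x.
have y0 i : 0 < y 0 i by apply: pos_mul => //; exact: simplex_n0.
exists s, y; split=> //.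
pose w := y *m N - s *: y.
have w0 i : 0 <= w 0 i.
  have : s <= ratio x i by exact: bigmin_le_cond.
  by rewrite subscaleE subr_ge0 ler_pdivlMr// mulmxA.
have [w_eq0|w_n0] := eqVneq w 0; first by apply/eqP; rewrite -subr_eq0 -/w w_eq0.
have wS i : 0 < (w *m S) 0 i by exact: pos_mul.
pose c := \sum_i y 0 i.
have c0 : 0 < c.
  rewrite /c (bigD1 ord0)//= ltr_pwDl// sumr_ge0// => i _; exact: ltW.
pose z := c^-1 *: y.
have sz : simplex z.
  split => [i|]; last by under eq_bigr do rewrite mxE; rewrite -mulr_sumr mulVf ?gt_eqF.
  rewrite mxE mulr_ge0 ?invr_ge0 ?(ltW c0) ?(ltW (y0 i))//= mulrC ler_pdivrMr// mul1r.
  by rewrite /c (bigD1 i)//= lerDl sumr_ge0// => j _; exact: ltW.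
have := xmax z; rewrite inE => /(_ sz); rewrite leNgt => /negP; case.
have h i : s < ratio z i.
  rewrite /ratio ltr_pdivlMr; last first.
    by rewrite -scalemxAl mxE mulr_gt0 ?invr_gt0// pos_mul// ?gt_eqF//;
      [move=> j; exact: ltW|apply: contraTneq (y0 ord0) => ->; rewrite mxE ltxx].
  rewrite SN -!scalemxAl ![(_ *: _ : 'rV_ _) _ _]mxE mulrCA ltr_pM2l ?invr_gt0//.
  by have := wS i; rewrite /w mulmxBl -scalemxAl mulmxA subscaleE subr_gt0.
by apply: lt_bigmin.
Qed.

End perron.

Lemma mulmxn_ge0 {R : realType} n (M : 'M[R]_n.+1) k :
  (forall x y, 0 <= M x y) -> forall x y, 0 <= (M ^+ k) x y.
Proof.
move=> M0; elim: k => [|k IH] x y; first by rewrite expr0 mxE ler0n.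
by rewrite exprS mxE sumr_ge0// => z _; rewrite mulr_ge0.
Qed.

(** Carries positivity of a power from the embedded chain to the shifted generator, whose
    off-diagonal entries dominate those of the chain up to a factor. *)
Lemma le_mxpow {R : realType} n (M N : 'M[R]_n.+1) c k :
  (forall x y, 0 <= M x y) -> (forall x y, M x y <= c * N x y) ->
  forall x y, (M ^+ k) x y <= c ^+ k * (N ^+ k) x y.
Proof.
move=> M0 MN; elim: k => [|k IH] x y; first by rewrite !expr0 mul1r.
rewrite !exprS !mxE mulr_sumr ler_sum// => z _.
rewrite mulrACA; apply: ler_pM => //; exact: mulmxn_ge0.
Qed.

(** Over [R[i]] the characteristic polynomial splits, and the sum of the absolute real parts of its
    roots bounds each of them. This makes the [sup] in [eta] an actual supremum. *)
Lemma spectrum_Re_ubound {R : realType} n (M : 'M[R]_n) :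
  has_ubound [set complex.Re z | z in spectrum M].
Proof.
set p := char_poly (map_mx (real_complex R) M).
have [rs p_rs] := closed_field_poly_normal p.
exists (\sum_(x <- rs) `|complex.Re x|) => _ [z zM <-].
have : root p z by rewrite -eigenvalue_root_char.
rewrite p_rs rootZ ?lead_coef_eq0 ?monic_neq0 ?char_poly_monic//.
rewrite root_prod_XsubC => z_rs; rewrite (big_rem z)//=.
by rewrite (le_trans (ler_norm _))// lerDl sumr_ge0.
Qed.

(** [eigenvalue] is about row vectors and [u] is a column: a vanishing determinant is insensitive to
    transposition and provides a row eigenvector. *)
Lemma sup_spectrum_ge {R : realType} n (M : 'M[R]_n) (r : R) (u : 'cV[R]_n) :
  u != 0 -> M *m u = r *: u -> r <= sup [set complex.Re z | z in spectrum M].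
Proof.
move=> u0 Mu; apply: ub_le_sup; first exact: spectrum_Re_ubound.
exists (real_complex R r) => //; rewrite /spectrum /= eigenvalue_map.
have : \det (M - r%:M)^T == 0.
  apply/det0P; exists u^T; first by rewrite trmx_eq0.
  by rewrite -trmx_mul mulmxBl Mu mul_scalar_mx subrr trmx0.
rewrite det_tr => /det0P[v v0 vM]; apply/eigenvalueP; exists v => //.
by apply/eqP; rewrite -subr_eq0 -mul_mx_scalar -mulmxBr vM.
Qed.

Section perron_generator.
Context {R : realType} {d : nat}.
Variables (A : 'M[R]_d) (lambda : 'I_d -> R) (p : R).
Hypothesis d2 : (2 <= d)%N.
Hypothesis A_gen : generator_matrix A.
Hypothesis A_irr : irreducible_chain (embedded_chain A).

(** The shifted generator is nonnegative off the diagonal and charges every transition of the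
    embedded chain; adding [c] on the diagonal makes it a nonnegative irreducible matrix [N] with
    the same eigenvectors. The inequality says that [r] is among the real parts whose supremum is
    [- eta]. *)
Lemma perron_generator : exists (r : R) (u : 'I_d -> R),
  [/\ forall x, 0 < u x,
      forall x, \sum_y A x y * u y - p * lambda x * u x = r * u x &
      r <= - eta A lambda p].
Proof.
move: A_gen A_irr d2; rewrite /eta opprK.
case: d A lambda => [|n] B l // [B0 Bsum] B_irr _.
set M := embedded_chain B.
set Bp := shifted_generator B l p.
pose c := \sum_x `|Bp x x|.
pose N := Bp + c%:M.
have BpE x y : Bp x y = B x y - (p * l x) *+ (x == y).
  by rewrite /Bp /shifted_generator !mxE mulrnAr.
have Bxx x : B x x <= 0.
  have := Bsum x; rewrite (bigD1 x)//= => /eqP; rewrite addr_eq0 => /eqP ->.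
  by rewrite oppr_le0 sumr_ge0// => y yx; rewrite B0// eq_sym.
have N0 x y : 0 <= N x y.
  rewrite /N [(Bp + _) x y]mxE [c%:M x y]mxE.
  have [->|xy] := eqVneq x y; last by rewrite BpE (negbTE xy) subr0 addr0 B0.
  rewrite mulr1n /c (bigD1 y)//= addrA addr_ge0 ?sumr_ge0//.
  by rewrite -lerBlDl sub0r -normrN ler_norm.
have M0 x y : 0 <= M x y.
  rewrite mxE; case: eqP => // /eqP xy.
  by rewrite mulNr -mulrN -invrN mulr_ge0 ?B0// invr_ge0 oppr_ge0.
(* A common upper bound of the mean holding times [- 1 / B x x], which gives [M <= k N]
   entrywise. *)
pose k := \sum_x `|(B x x)^-1|.
have MN x y : M x y <= k * N x y.
  rewrite [M x y]mxE; have [->|xy] := eqVneq x y.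
    by rewrite mulr_ge0// sumr_ge0.
  rewrite /N [(Bp + _) x y]mxE [c%:M x y]mxE BpE (negbTE xy) subr0 addr0.
  rewrite mulNr -mulrN mulrC ler_wpM2r ?B0//.
  rewrite (le_trans (ler_norm _))// normrN /k (bigD1 x)//= lerDl.
  by rewrite sumr_ge0.
have pos x y : exists m, 0 < (N ^+ m) x y.
  have [m Mm] := B_irr x y; exists m.
  have := lt_le_trans Mm (le_mxpow m M0 MN x y).
  rewrite pmulr_rgt0// lt_def exprn_ge0 ?sumr_ge0// andbT.
  apply/eqP => h; move: (lt_le_trans Mm (le_mxpow m M0 MN x y)).
  by rewrite h mul0r ltxx.
pose m (xy : 'I_n.+1 * 'I_n.+1) := projT1 (cid (pos xy.1 xy.2)).
have mP x y : 0 < (N ^+ m (x, y)) x y by rewrite /m; case: cid.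
(* For each pair some power of [N] is positive there. The sum of these powers is positive
   everywhere, even if the chain is periodic, and commutes with [N]. *)
pose S := \sum_(xy : 'I_n.+1 * 'I_n.+1) N ^+ m xy.
have S0 x y : 0 < S x y.
  rewrite /S summxE (bigD1 (x, y))//= ltr_pwDl// sumr_ge0// => i _.
  exact: mulmxn_ge0.
have NS : N *m S = S *m N.
  rewrite /S mulmx_sumr mulmx_suml; apply: eq_bigr => i _.
  have : GRing.comm N (N ^+ m i) by apply: commrX; exact: commr_refl.
  by [].
(* [perron] produces a row eigenvector and a column one is wanted, so both matrices are
   transposed. *)
have ST0 i j : 0 < S^T i j by rewrite mxE.
have NST : S^T *m N^T = N^T *m S^T by rewrite -!trmx_mul NS.
have [s [v [v0 vN]]] := @perron R n N^T S^T (fun i j => ltac:(by rewrite mxE))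
  (ltac:(by rewrite -!trmx_mul NS)).
have Nv : N *m v^T = s *: v^T.
  by rewrite -[N]trmxK -trmx_mul vN linearZ.
have Bv : Bp *m v^T = (s - c) *: v^T.
  by rewrite scalerBl -Nv -mul_scalar_mx -mulmxBl /N addrK.
exists (s - c), (fun x => v 0 x); split=> //.
  move=> x; transitivity ((Bp *m v^T) x 0); last by rewrite Bv !mxE.
  rewrite mxE [RHS](eq_bigr (fun y => B x y * v 0 y -
      (p * l x * v 0 x) *+ (x == y))); last first.
    by move=> y _; rewrite [v^T _ _]mxE BpE mulrBl mulrnAl; case: eqP => [->|].
  rewrite sumrB; congr (_ - _).
  rewrite [RHS](bigD1 x)//= eqxx big1 ?addr0// => y yx.
  by rewrite eq_sym (negbTE yx).
apply: sup_spectrum_ge Bv; apply: contraTneq (v0 ord0) => /(congr1 trmx).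
by rewrite trmxK trmx0 => ->; rewrite mxE ltxx.
Qed.

End perron_generator.

(** * Independence and images of measures *)

Lemma prob_unique {d} {T : measurableType d} {R : realType}
    (m1 m2 : {measure set T -> \bar R}) (G : set_system T) :
  G `<=` measurable -> setI_closed G -> G setT -> (m1 setT < +oo)%E ->
  (forall A, G A -> m1 A = m2 A) -> forall A, <<s G >> A -> m1 A = m2 A.
Proof.
move=> Gm GI GT m1T m12.
apply: (@g_sigma_algebra_measure_unique _ _ _ G Gm (fun=> setT)) => //.
by apply/seteqP; split => // x _; exists 0%N.
Qed.

(** In [A], both sides are finite measures, the restriction of [P] to [H] and [P] scaled by [P H],
    so agreement on a pi-system is enough. *)
Lemma prob_pi_indep {d} {T : measurableType d} {R : realType}
    (P : probability T R) (G : set_system T) (H : set T) :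
  G `<=` measurable -> setI_closed G -> G setT -> measurable H ->
  (forall A, G A -> P (A `&` H) = (P A * P H)%E) ->
  forall A, <<s G >> A -> P (A `&` H) = (P A * P H)%E.
Proof.
move=> Gm GI GT mH GH A GA.
have PH : (fine (P H))%:E = P H by rewrite fineK// fin_num_measure.
have PH0 : 0 <= fine (P H) by rewrite fine_ge0.
have -> : P (A `&` H) = mrestr P mH A by [].
rewrite (@prob_unique _ T R _ (mscale (NngNum PH0) P) G Gm GI GT) => [|||//].
- by rewrite /= /mscale/= PH muleC.
- rewrite /= /mrestr setTI; exact: (le_lt_trans (probability_le1 _ _) (ltry _)).
- by move=> B GB; rewrite /= /mscale /mrestr/= PH GH// muleC.
Qed.

(** The factor [c] allows [m] to be the restriction of a probability to an event independent of [u]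
    and [v], as in [integral_indep_event]. *)
Lemma integral_joint_law {d d1 d2} {T : measurableType d}
    {T1 : measurableType d1} {T2 : measurableType d2} {R : realType}
    (m : {measure set T -> \bar R}) (mu : probability T1 R)
    (nu : probability T2 R) (c : {nonneg R})
    (u : T -> T1) (v : T -> T2) (F : T1 * T2 -> \bar R) :
  measurable_fun setT u -> measurable_fun setT v ->
  (forall A B, measurable A -> measurable B ->
    m (u @^-1` A `&` v @^-1` B) = (c%:num%:E * (mu A * nu B))%E) ->
  measurable_fun setT F -> (forall z, 0 <= F z)%E ->
  (\int[m]_w F (u w, v w) = c%:num%:E * \int[mu]_x \int[nu]_y F (x, y))%E.
Proof.
move=> mu_ mv muv mF F0.
have mphi : measurable_fun setT (fun w => (u w, v w)) by exact: measurable_fun_pair.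
pose phi : {mfun T >-> (T1 * T2)%type} :=
  HB.pack (fun w => (u w, v w)) (isMeasurableFun.Build _ _ _ _ _ mphi).
have -> : (\int[m]_w F (u w, v w) = \int[pushforward m phi]_z F z)%E.
  by rewrite (ge0_integral_pushforward mphi)// ?preimage_setT// => z _; exact: F0.
rewrite -fubini_tonelli1//.
have -> : (c%:num%:E * \int[(mu \x nu)]_z F z = \int[mscale c (mu \x nu)]_z F z)%E.
  by rewrite ge0_integral_mscale.
apply: eq_measure_integral => A mA _.
apply: (@prob_unique _ _ _ (pushforward m phi) (mscale c (mu \x nu)%E)
  [set A `*` B | A in measurable & B in measurable]).
- by move=> _ [B mB [C mC <-]]; exact: measurableX.
- move=> _ _ [B1 mB1 [C1 mC1 <-]] [B2 mB2 [C2 mC2 <-]].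
  exists (B1 `&` B2); first exact: measurableI.
  by exists (C1 `&` C2); [exact: measurableI|rewrite setXI].
- by exists setT => //; exists setT => //; rewrite setXTT.
- rewrite /= /pushforward preimage_setT.
  have := muv setT setT measurableT measurableT.
  rewrite !preimage_setT setTI => ->.
  by rewrite !probability_setT mule1 ltry.
- move=> _ [B mB [C mC <-]]; rewrite /= /mscale /= product_measure1E//.
  exact: muv.
- by rewrite -measurable_prod_measurableType.
Qed.

Lemma Rintegral_indep {d} {T : measurableType d} {R : realType}
    (P : probability T R) (f g : T -> R) :
  measurable_fun setT f -> measurable_fun setT g ->
  independent2 P (preimage_set_system setT f measurable)
                 (preimage_set_system setT g measurable) ->
  P.-integrable setT (EFin \o f) -> P.-integrable setT (EFin \o g) ->
  P.-integrable setT (EFin \o (f \* g)) ->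
  \int[P]_w (f w * g w) = (\int[P]_w f w) * (\int[P]_w g w).
Proof.
move=> mf mg fg If Ig Ifg.
pose phi w := (f w, g w).
have mphi : measurable_fun setT phi by exact: measurable_fun_pair.
pose X : {RV P >-> R} := HB.pack f (isMeasurableFun.Build _ _ _ _ _ mf).
pose Y : {RV P >-> R} := HB.pack g (isMeasurableFun.Build _ _ _ _ _ mg).
pose F (z : R * R) := (z.1 * z.2)%:E.
have mF : measurable_fun setT F by exact/measurable_EFinP/measurable_funM.
have prodE A : measurable A ->
    (distribution P X \x distribution P Y)%E A = pushforward P phi A.
  move=> mA; apply: product_measure_unique => // B C mB mC.
  rewrite /pushforward /= -fg//.
  - by exists B => //; rewrite setTI.
  - by exists C => //; rewrite setTI.
have IF : (pushforward P phi).-integrable setT F.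
  by apply: integrable_pushforward => //; rewrite preimage_setT.
have IF' : (distribution P X \x distribution P Y)%E.-integrable setT F.
  apply/integrableP; split => //.
  move/integrableP : IF => [_].
  by rewrite (eq_measure_integral (distribution P X \x distribution P Y)%E)// => A mA _; exact/esym/prodE.
have -> : \int[P]_w (f w * g w) = fine (\int[pushforward P phi]_z F z)%E.
  by rewrite integral_pushforward// preimage_setT.
rewrite (eq_measure_integral (distribution P X \x distribution P Y)%E); last first.
  by move=> A mA _; exact/esym/prodE.
rewrite -integral12_prod_meas1// /fubini_F /F /=.
have IY : (distribution P Y).-integrable setT EFin.
  by apply: integrable_pushforward => //; rewrite ?preimage_setT//; exact: measurable_EFin.
have IX : (distribution P X).-integrable setT EFin.
  by apply: integrable_pushforward => //; rewrite ?preimage_setT//; exact: measurable_EFin.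
have EY : (\int[distribution P Y]_y y%:E = \int[P]_w (g w)%:E)%E.
  by rewrite integral_pushforward ?preimage_setT//; exact: measurable_EFin.
have EX : (\int[distribution P X]_y y%:E = \int[P]_w (f w)%:E)%E.
  by rewrite integral_pushforward ?preimage_setT//; exact: measurable_EFin.
under eq_integral do under eq_integral do rewrite EFinM.
under eq_integral do rewrite integralZl//.
rewrite EY -(fineK (integrable_fin_num _ Ig))// integralZr// EX.
by rewrite fineM//; exact: integrable_fin_num.
Qed.

(** * Integration against a density *)

Section density.
Context {d} {T : measurableType d} {R : realType}.
Variables (mu nu : {measure set T -> \bar R}) (f : T -> R).
Import HBNNSimple.
Hypothesis mf : measurable_fun setT f.
Hypothesis f0 : forall x, 0 <= f x.
Hypothesis nuE : forall A, measurable A -> nu A = (\int[mu]_(x in A) (f x)%:E)%E.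

Lemma density_nnsfun (h : {nnsfun T >-> R}) :
  (\int[nu]_x (h x)%:E = \int[mu]_x (h x * f x)%:E)%E.
Proof.
under [LHS]eq_integral do rewrite fimfunE -fsumEFin//.
rewrite [LHS]ge0_integral_fsum//; last 2 first.
  - by move=> r; exact/measurable_EFinP/measurableT_comp.
  - by move=> n x _; rewrite EFinM nnfun_muleindic_ge0.
under [RHS]eq_integral.
  move=> x xD; rewrite fimfunE mulrC EFinM -fsumEFin// ge0_mule_fsumr; last first.
    by move=> r; rewrite EFinM nnfun_muleindic_ge0.
  over.
rewrite [RHS]ge0_integral_fsum//; last 2 first.
  - move=> r; apply: emeasurable_funM; apply/measurable_EFinP => //.
    by apply: measurable_funM => //; exact: measurable_indic.
  - move=> r x _; apply: mule_ge0; first by rewrite lee_fin.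
    by rewrite EFinM nnfun_muleindic_ge0.
apply: eq_fsbigr => r _.
rewrite integralZl_indic_nnsfun//= integral_indic// setIT nuE//.
have [r0|r0] := ltP r 0.
  by rewrite preimage_nnfun0// integral_set0 mule0 integral0_eq// => x _;
    rewrite indic0 mulr0 mule0.
rewrite integral_mkcond -ge0_integralZl//.
- apply: eq_integral => x _; rewrite /patch indicE.
  by case: ifPn => _; rewrite ?mulr1 ?mulr0 ?(mule0 r%:E) ?mule0// muleC.
- apply/(measurable_restrictT _ _).1; first exact: (measurable_sfunP h).
  by apply: measurable_funTS; exact/measurable_EFinP.
- by move=> x _; rewrite erestrict_ge0// => y _; rewrite lee_fin.
Qed.

Lemma density_ge0 (g : T -> \bar R) : measurable_fun setT g ->
  (forall x, 0 <= g x)%E ->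
  (\int[nu]_x g x = \int[mu]_x (g x * (f x)%:E))%E.
Proof.
move=> mg g0; pose h := nnsfun_approx measurableT mg.
transitivity (limn (fun n => \int[nu]_x (h n x)%:E))%E.
  rewrite -monotone_convergence//.
  - apply: eq_integral => x _; apply/esym/cvg_lim => //.
    exact: cvg_nnsfun_approx.
  - by move=> n; exact/measurable_EFinP.
  - by move=> n x _; rewrite lee_fin.
  - by move=> x _ a b ab; rewrite lee_fin; exact/lefP/nd_nnsfun_approx.
transitivity (limn (fun n => \int[mu]_x (h n x * f x)%:E))%E.
  by congr (limn _); apply/funext => n; exact: density_nnsfun.
rewrite -monotone_convergence//.
- apply: eq_integral => x _; apply/cvg_lim => //.
  under eq_fun do rewrite EFinM.
  by apply: cvgeZr => //; exact: cvg_nnsfun_approx.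
- move=> n; apply/measurable_EFinP; exact: measurable_funM.
- by move=> n x _; rewrite lee_fin mulr_ge0.
- move=> x _ a b ab; rewrite lee_fin ler_wpM2r//.
  by have /lefP := nd_nnsfun_approx measurableT mg ab; apply.
Qed.

End density.

(** * Gaussian moments *)

Section normal_moments.
Context {R : realType}.
Local Notation mu := (@lebesgue_measure R).

Lemma ge0_integralN (f : R -> \bar R) : measurable_fun setT f ->
  (forall x, 0 <= f x)%E -> (\int[mu]_x f (- (x : R))%R = \int[mu]_x f x)%E.
Proof.
move=> mf f0.
have mN : measurable_fun setT (-%R : R -> R) by [].
have := @ge0_integral_pushforward _ _ (measurableTypeR R) (measurableTypeR R)
  R _ mN mu setT f measurableT mf (fun x _ => f0 x).
rewrite preimage_setT => <-.
by apply: eq_measure_integral => A mA _; exact: lebesgue_measureN.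
Qed.

Lemma ge0_integral_scale (s : R) (g : R -> R) : 0 < s -> continuous g ->
  (forall x, 0 <= g x) ->
  (\int[mu]_x (g x)%:E = \int[mu]_x (g (s * x) * s)%:E)%E.
Proof.
move=> s0 cg g0.
have dF : derive1 ( *%R s : R -> R) = cst s.
  by apply/funext => x; rewrite derive1E deriveM// derive_id derive_cst scaler0 addr0 /= [LHS]mulr1.
rewrite (@increasing_ge0_integration_by_substitutionT _ ( *%R s) g).
- by apply: eq_integral => x _; rewrite dF.
- by move=> x y; rewrite ltr_pM2l.
- by rewrite dF; exact: cst_continuous.
- by rewrite dF; exact: is_cvg_cst.
- by rewrite dF; exact: is_cvg_cst.
- by move=> x; exact: derivableM.
- by apply: gt0_cvgMrNy.
- by apply: gt0_cvgMry.
- exact: cg.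
- exact: g0.
Qed.

Lemma normal_pdf0E (s x : R) : s != 0 ->
  normal_pdf 0 s x = normal_peak s * expR (- x ^+ 2 / (s ^+ 2 *+ 2)).
Proof. by move=> s0; rewrite normal_pdfE// /normal_fun subr0. Qed.

Lemma integral_normal (s : R) (g : R -> \bar R) : measurable_fun setT g ->
  (forall x, 0 <= g x)%E ->
  (\int[normal_prob 0 s]_x g x = \int[mu]_x (g x * (normal_pdf 0 s x)%:E))%E.
Proof.
move=> mg g0; rewrite (@density_ge0 _ _ _ mu (normal_prob 0 s) (normal_pdf 0 s))//.
- exact: measurable_normal_pdf.
- by move=> x; exact: normal_pdf_ge0.
Qed.

(** The integrand is dominated by a multiple of the normal density of standard deviation 2. *)
Lemma normal_second_moment_lty :
  (\int[normal_prob 0 1]_x (x ^+ 2)%:E < +oo :> \bar R)%E.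
Proof.
rewrite integral_normal; last 2 first.
- by apply/measurable_EFinP; exact: exprn_measurable.
- by move=> x; rewrite lee_fin sqr_ge0.
have n2 : (2 : R) != 0 by [].
(* The factor 4 comes from [x^2 <= 4 exp (3 x^2 / 8)], where [3/8 = 1/2 - 1/8] is the difference of
   the two Gaussian exponents; the quotient adjusts the peaks. *)
pose K : R := 4 * normal_peak 1 / normal_peak 2.
have K0 : 0 <= K.
  by rewrite /K !mulr_ge0 ?invr_ge0 ?normal_peak_ge0.
apply: (@le_lt_trans _ _ (\int[mu]_x (K%:E * (normal_pdf 0 2 x)%:E)))%E.
  apply: ge0_le_integral => //.
  - by move=> x _; rewrite -EFinM lee_fin mulr_ge0 ?sqr_ge0 ?normal_pdf_ge0.
  - apply/measurable_EFinP/measurable_funM; first exact: exprn_measurable.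
    exact: measurable_normal_pdf.
  - apply/measurable_EFinP/measurable_funM => //.
    exact: measurable_normal_pdf.
  - move=> x _; rewrite -!EFinM lee_fin !normal_pdf0E ?oner_neq0//.
    have -> : K * (normal_peak 2 * expR (- x ^+ 2 / (2 ^+ 2 *+ 2))) =
        normal_peak 1 * (4 * expR (- x ^+ 2 / (2 ^+ 2 *+ 2))).
      by rewrite /K; field; rewrite gt_eqF// normal_peak_gt0.
    rewrite mulrCA ler_wpM2l ?normal_peak_ge0//.
    rewrite expr1n -ler_pdivrMr ?expR_gt0// -expRN -mulrA -expRD.
    have -> : - x ^+ 2 / (1 *+ 2) - - x ^+ 2 / (2 ^+ 2 *+ 2) =
       - (x ^+ 2 * (3 / 8)) :> R by field.
    rewrite expRN -ler_pdivlMr ?invr_gt0 ?expR_gt0// invrK.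
    have := expR_ge1Dx (x ^+ 2 * (3 / 8)).
    have := sqr_ge0 x; lra.
rewrite ge0_integralZl//.
- by rewrite integral_normal_pdf mule1 ltry.
- by apply/measurable_EFinP; exact: measurable_normal_pdf.
- by move=> x _; rewrite lee_fin normal_pdf_ge0.
Qed.

(** Kept as an abstract constant: it is the factor of the Ito isometry below. *)
Definition normal_second_moment : R :=
  fine (\int[normal_prob 0 1]_x (x ^+ 2)%:E)%E.

Lemma normal_second_moment_ge0 : 0 <= normal_second_moment.
Proof. by apply/fine_ge0/integral_ge0 => x _; rewrite lee_fin sqr_ge0. Qed.

Lemma integral_normal_sqr (s : R) : 0 < s ->
  (\int[normal_prob 0 s]_x (x ^+ 2)%:E = (s ^+ 2 * normal_second_moment)%:E)%E.
Proof.
move=> s0.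
have m2 : measurable_fun setT (fun x : R => (x ^+ 2)%:E).
  by apply/measurable_EFinP; exact: exprn_measurable.
have p2 (x : R) : (0 <= (x ^+ 2)%:E)%E by rewrite lee_fin sqr_ge0.
rewrite EFinM /normal_second_moment fineK; last first.
  by rewrite ge0_fin_numE ?normal_second_moment_lty// integral_ge0.
rewrite !integral_normal//.
under eq_integral do rewrite -EFinM.
rewrite (ge0_integral_scale s0); last 2 first.
- move=> x; apply: cvgM; first exact: exprn_continuous.
  by apply: continuous_normal_pdf; rewrite gt_eqF.
- by move=> x; rewrite mulr_ge0 ?sqr_ge0 ?normal_pdf_ge0.
rewrite -ge0_integralZl//; last 2 first.
- apply: emeasurable_funM; first exact: m2.
  by apply/measurable_EFinP; exact: measurable_normal_pdf.
- by move=> x _; rewrite mule_ge0// lee_fin normal_pdf_ge0.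
apply: eq_integral => x _; rewrite -!EFinM; congr EFin.
rewrite exprMn -!mulrA; congr (_ * (_ * _)).
rewrite !normal_pdf0E ?oner_neq0 ?gt_eqF// mulrAC; congr (_ * _); congr (_ * _); congr (_ * _).
  have -> : normal_peak s = (s * Num.sqrt (1 ^+ 2 * pi *+ 2))^-1.
    rewrite /normal_peak expr1n mul1r -mulrnAr sqrtrM ?sqr_ge0//.
    by rewrite sqrtr_sqr gtr0_norm.
  by rewrite invfM mulrAC mulVf ?mul1r// gt_eqF.
by rewrite expr1n; congr expR; field; rewrite gt_eqF.
Qed.

(** By symmetry the positive and negative parts have the same integral, finite because
    [x <= 1 + x^2]. *)
Lemma integral_normal_id (s : R) : 0 < s ->
  (\int[normal_prob 0 s]_x x%:E = 0)%E.
Proof.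
move=> s0.
have m2 : measurable_fun setT (fun x : R => x%:E) by exact/measurable_EFinP.
rewrite integralE.
have -> : (\int[normal_prob 0 s]_x (fun x : R => x%:E)^\- x =
   \int[normal_prob 0 s]_x (fun x : R => x%:E)^\+ x)%E.
  rewrite !integral_normal//; last 2 first.
  - exact: measurable_funepos.
  - exact: measurable_funeneg.
  rewrite -[RHS]ge0_integralN; last 2 first.
  - apply: emeasurable_funM; first exact: measurable_funepos.
    by apply/measurable_EFinP; exact: measurable_normal_pdf.
  - by move=> x; rewrite mule_ge0// lee_fin normal_pdf_ge0.
  apply: eq_integral => x _; congr (_ * _)%E.
    by rewrite funenegE funeposE EFinN.
  by rewrite !normal_pdf0E ?gt_eqF// sqrrN.
rewrite subee// ge0_fin_numE ?integral_ge0//.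
apply: (@le_lt_trans _ _ (\int[normal_prob 0 s]_x (1 + (x ^+ 2)%:E)))%E.
  apply: ge0_le_integral => //.
  - exact: measurable_funepos.
  - apply: emeasurable_funD => //.
    by apply/measurable_EFinP; exact: exprn_measurable.
  - move=> x _; rewrite funeposE ge_max lee_fin; apply/andP; split.
      have h : 0 <= (x - 1) ^+ 2 + x ^+ 2 by rewrite addr_ge0 ?sqr_ge0.
      by move: h; rewrite sqrrB; lra.
    by rewrite -EFinD lee_fin addr_ge0// sqr_ge0.
rewrite ge0_integralD//; last 2 first.
- by move=> x _; rewrite lee_fin sqr_ge0.
- by apply/measurable_EFinP; exact: exprn_measurable.
have -> : (\int[normal_prob 0 s]_x cst 1 x = 1)%E.
  by rewrite integral_cst// mul1e; exact: probability_setT.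
by rewrite integral_normal_sqr// -EFinD ltry.
Qed.

End normal_moments.

Section normal_variable.
Context {d} {T : measurableType d} {R : realType} (P : probability T R).
Variables (D : T -> R) (s : R).
Hypothesis mD : measurable_fun setT D.
Hypothesis s0 : 0 < s.
Hypothesis D_normal : forall U : set R, measurable U ->
  P [set w | U (D w)] = normal_prob 0 s U.

Let transfer (g : R -> \bar R) : measurable_fun setT g -> (forall x, 0 <= g x)%E ->
  (\int[P]_w g (D w) = \int[normal_prob 0 s]_x g x)%E.
Proof.
move=> mg g0.
have := @ge0_integral_pushforward _ _ _ (measurableTypeR R) R D mD P setT g
  measurableT mg (fun x _ => g0 x).
rewrite preimage_setT => <-.
by apply: eq_measure_integral => A mA _; exact: D_normal.
Qed.

Lemma normal_variable_sqr :
  (\int[P]_w (D w ^+ 2)%:E = (s ^+ 2 * normal_second_moment)%:E)%E.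
Proof.
rewrite (transfer (g := fun x => (x ^+ 2)%:E)) ?integral_normal_sqr//.
  by apply/measurable_EFinP; exact: exprn_measurable.
by move=> x; rewrite lee_fin sqr_ge0.
Qed.

Lemma normal_variable_mean : (\int[P]_w (D w)%:E = 0)%E.
Proof.
rewrite -(integral_normal_id s0) integralE [RHS]integralE; congr (_ - _)%E.
  rewrite -(transfer (g := (fun x => x%:E)^\+%E))//.
    by apply: eq_integral => x _; rewrite !funeposE.
  by apply: measurable_funepos; exact/measurable_EFinP.
rewrite -(transfer (g := (fun x => x%:E)^\-%E))//.
  by apply: eq_integral => x _; rewrite !funenegE.
by apply: measurable_funeneg; exact/measurable_EFinP.
Qed.

End normal_variable.

(** * Driving filtration and Ito isometry *)

Section sigma_of_theory.
Context {R : realType} {d : measure_display} {T : measurableType d}.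

Lemma sigma_of_sub {I S : Type} (D D' : set I) (G : set_system S)
    (Z : I -> T -> S) :
  D `<=` D' -> sigma_of D G Z `<=` sigma_of D' G Z.
Proof. by move=> DD'; apply: sub_sigma_algebra2; exact: bigcup_subset. Qed.

Lemma sigma_of_setI {I S : Type} (D : set I) (G : set_system S)
    (Z : I -> T -> S) : setI_closed (sigma_of D G Z).
Proof.
move=> A B; exact: (@measurableI _ (g_sigma_algebraType
  (\bigcup_(i in D) preimage_set_system setT (Z i) G))).
Qed.

Lemma sigma_of_setT {I S : Type} (D : set I) (G : set_system S)
    (Z : I -> T -> S) : sigma_of D G Z setT.
Proof.
exact: (@measurableT _ (g_sigma_algebraType
  (\bigcup_(i in D) preimage_set_system setT (Z i) G))).
Qed.

Lemma sigma_of_mem {I S : Type} (D : set I) (G : set_system S)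
    (Z : I -> T -> S) i U : D i -> G U -> sigma_of D G Z (Z i @^-1` U).
Proof.
by move=> Di GU; apply: sub_sigma_algebra; exists i => //; exists U => //; rewrite setTI.
Qed.

Lemma sigma_of_fun {I : Type} (D : set I) (Z : I -> T -> R) i :
  D i -> @measurable_fun _ _ (g_sigma_algebraType
    (\bigcup_(i in D) preimage_set_system setT (Z i) measurable)) R setT (Z i).
Proof. by move=> Di _ U mU; rewrite setTI; exact: sigma_of_mem. Qed.

Lemma preimage_setI {d'} {T' : measurableType d'} (f : T -> T') :
  setI_closed (preimage_set_system setT f measurable).
Proof.
move=> _ _ [A mA <-] [B mB <-]; exists (A `&` B); first exact: measurableI.
by rewrite !setTI preimage_setI.
Qed.

Lemma preimage_setTT {d'} {T' : measurableType d'} (f : T -> T') :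
  preimage_set_system setT f measurable setT.
Proof. by exists setT => //; rewrite preimage_setT setTI. Qed.

End sigma_of_theory.

Section driving.
Context {R : realType} {disp : measure_display} {T : measurableType disp}.
Context {d : nat} (P : probability T R).
Variables (X : R -> T -> 'I_d) (B : R -> {RV P >-> R}) (Y0 : {RV P >-> R}).
Hypothesis mX : forall t : R, 0 <= t -> forall x, measurable [set w | X t w = x].
Hypothesis BM : brownian_motion B.
Hypothesis indep : independent3 P (sigma_of `[0, +oo[ measurable B)
  (preimage_set_system setT Y0 measurable)
  (sigma_of `[0, +oo[ [set: set 'I_d] X).

Definition driving_gen (t : R) : set_system T :=
  preimage_set_system setT Y0 measurable
      `|` sigma_of `[0, t] [set: set 'I_d] X
      `|` sigma_of `[0, t] measurable B.

Definition adapted (t : R) (f : T -> R) : Prop :=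
  @measurable_fun _ _ (g_sigma_algebraType (driving_gen t)) R setT f.

Lemma measurable_state (t : R) (U : set 'I_d) : 0 <= t -> measurable (X t @^-1` U).
Proof.
move=> t0; have -> : X t @^-1` U = \big[setU/set0]_(x <- enum 'I_d | x \in U)
    [set w | X t w = x].
  apply/seteqP; split => w /=.
    move=> Uw; rewrite -bigcup_seq_cond; exists (X t w) => //=.
    by rewrite mem_enum mem_set.
  by rewrite -bigcup_seq_cond => -[x /= /andP[_ /set_mem Ux] ->].
by apply: bigsetU_measurable => x _; exact: mX.
Qed.

Lemma sigma_of_X_measurable (D : set R) : D `<=` [set t | 0 <= t] ->
  sigma_of D [set: set 'I_d] X `<=` measurable.
Proof.
move=> D0; apply: smallest_sub; first exact: sigma_algebra_measurable.
by move=> _ [t Dt [U _ <-]]; rewrite setTI; apply: measurable_state; exact: D0.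
Qed.

Lemma sigma_of_B_measurable (D : set R) :
  sigma_of D measurable B `<=` measurable.
Proof.
apply: smallest_sub; first exact: sigma_algebra_measurable.
by move=> _ [t Dt [U mU <-]]; exact: measurable_funP.
Qed.

Let itv0 (t : R) : [set` `[0, t]] `<=` [set t : R | 0 <= t].
Proof. by move=> u /=; rewrite in_itv/= => /andP[]. Qed.

Lemma driving_measurable t : driving_filtration X B Y0 t `<=` measurable.
Proof.
apply: smallest_sub; first exact: sigma_algebra_measurable.
move=> A [[|]|].
- by move=> [U mU <-]; exact: measurable_funP.
- by apply: sigma_of_X_measurable; exact: itv0.
- exact: sigma_of_B_measurable.
Qed.

Lemma adapted_measurable t f : adapted t f -> measurable_fun setT f.
Proof. by move=> af _ U mU; apply: driving_measurable; exact: af. Qed.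

Lemma adaptedP t f : preimage_set_system setT f measurable `<=`
  driving_filtration X B Y0 t -> adapted t f.
Proof. by move=> h _ U mU; apply: h; exists U. Qed.

Lemma driving_gen_sub (s t : R) : s <= t -> driving_gen s `<=` driving_gen t.
Proof.
move=> st; have h : [set` `[0, s]] `<=` [set` `[0, t]].
  by move=> u /=; rewrite !in_itv/= => /andP[->] /le_trans; exact.
by apply: setUSS; [apply: setUSS => //|]; exact: sigma_of_sub.
Qed.

Lemma adapted_le (s t : R) f : s <= t -> adapted s f -> adapted t f.
Proof.
move=> st af _ U mU; have := af measurableT U mU.
exact: (sub_sigma_algebra2 (driving_gen_sub st)).
Qed.

Lemma adapted_B (s t : R) : 0 <= s -> s <= t -> adapted t (B s).
Proof.
move=> s0 st _ U mU; apply: sub_sigma_algebra; right; rewrite setTI.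
by apply: sigma_of_mem => //=; rewrite in_itv/= s0.
Qed.

Lemma adapted_X (s t : R) (g : 'I_d -> R) : 0 <= s -> s <= t ->
  adapted t (fun w => g (X s w)).
Proof.
move=> s0 st _ U mU; apply: sub_sigma_algebra; left; right; rewrite setTI.
rewrite (_ : _ @^-1` U = X s @^-1` (g @^-1` U))//.
by apply: sigma_of_mem => //=; rewrite in_itv/= s0.
Qed.

Lemma adapted_increment (a b t : R) : 0 <= a -> 0 <= b -> a <= t -> b <= t ->
  adapted t (fun w => B b w - B a w).
Proof. by move=> *; apply: measurable_funB; exact: adapted_B. Qed.

(** A generating pi-system consists of the intersections of a Brownian event [D] up to time [s], an
    event of [Y0] and an event of [X]. There, [D] and the increment together form an event of the
    whole Brownian motion: the triple product rule isolates it, and independence of the increments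
    splits it. *)
Lemma driving_indep (s t : R) : 0 <= s -> s < t ->
  independent2 P (driving_filtration X B Y0 s)
    (preimage_set_system setT (fun w => B t w - B s w) measurable).
Proof.
move=> s0 st E1 E2 FE1 [U mU E2U].
have mE2 : measurable E2.
  by rewrite -E2U; apply: measurable_funB.
pose G : set_system T := [set E | exists A C D,
  [/\ preimage_set_system setT Y0 measurable A,
      sigma_of `[0, s] [set: set 'I_d] X C,
      sigma_of `[0, s] measurable B D & E = D `&` A `&` C]].
have sub0 : [set` `[0, s]] `<=` ([set` `[0, +oo[] : set R).
  by move=> u /=; rewrite !in_itv/= => /andP[->].
have FG : <<s driving_gen s>> `<=` <<s G >>.
  apply: sub_sigma_algebra2 => A [[|]|] hA.
  - exists A, setT, setT; split => //; try exact: sigma_of_setT.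
    by rewrite setTI setIT.
  - exists setT, A, setT; split => //; try exact: sigma_of_setT.
      exact: preimage_setTT.
    by rewrite !setTI.
  - exists setT, setT, A; split => //; try exact: sigma_of_setT.
      exact: preimage_setTT.
    by rewrite !setIT.
have mY0 A : preimage_set_system setT Y0 measurable A -> measurable A.
  by move=> [V mV <-]; exact: measurable_funP.
apply: (@prob_pi_indep _ _ _ P G) => //.
- move=> _ [A [C [D [/mY0 mA hC hD ->]]]]; apply: measurableI; last first.
    by apply: sigma_of_X_measurable hC; exact: itv0.
  by apply: measurableI => //; exact: sigma_of_B_measurable hD.
- move=> _ _ [A [C [D [hA hC hD ->]]]] [A' [C' [D' [hA' hC' hD' ->]]]].
  exists (A `&` A'), (C `&` C'), (D `&` D'); split.
  + exact: preimage_setI.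
  + exact: sigma_of_setI.
  + exact: sigma_of_setI.
  + by rewrite setIACA [X in X `&` _]setIACA.
- exists setT, setT, setT; split; try exact: sigma_of_setT.
    exact: preimage_setTT.
  by rewrite !setTI.
- move=> _ [A [C [D [hA hC hD ->]]]].
  have hC' := sigma_of_sub sub0 hC.
  have hD' := sigma_of_sub sub0 hD.
  have hE2 : sigma_of `[0, +oo[ measurable B E2.
    rewrite -E2U; apply: (@measurable_funB _ (g_sigma_algebraType
      (\bigcup_(i in [set` `[0%R, +oo[]) preimage_set_system setT (B i) measurable)) R
      setT (B t) (B s)) => //; apply: sigma_of_fun => /=; rewrite in_itv/= andbT//.
    by rewrite (le_trans s0)// ltW.
  have [_ _ Bind _] := BM.
  rewrite (_ : D `&` A `&` C `&` E2 = (D `&` E2) `&` A `&` C); last first.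
    by rewrite setIAC [D `&` A `&` E2]setIAC.
  rewrite indep//; last exact: sigma_of_setI.
  rewrite indep// (Bind s t s0 st D E2 hD); last by exists U.
  by rewrite -!muleA [in LHS](muleC (P E2)) -!muleA.
- exact: FG.
Qed.

End driving.

Lemma Rintegral_bigsum {d} {T : measurableType d} {R : realType}
    (mu : {measure set T -> \bar R}) (D : set T) I (r : seq I) (f : I -> T -> R) :
  measurable D -> (forall i, mu.-integrable D (EFin \o f i)) ->
  \int[mu]_(w in D) (\sum_(i <- r) f i w) = \sum_(i <- r) \int[mu]_(w in D) f i w.
Proof.
move=> mD fi; rewrite /Rintegral.
under eq_integral do rewrite -sumEFin.
rewrite integral_sum// -sum_fine//.
by move=> i _; apply: integrable_fin_num => //; exact: fi.
Qed.

(** * Square-integrable variables *)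

Section square_integrable.
Context {R : realType} {d : measure_display} {T : measurableType d}.
Variable P : probability T R.
Implicit Types f g c : T -> R.

Lemma integrable_bounded f M : measurable_fun setT f ->
  (forall w, `|f w| <= M) -> P.-integrable setT (EFin \o f).
Proof.
move=> mf fM; apply: measurable_bounded_integrable => //.
  by rewrite (le_lt_trans (probability_le1 _ _))// ltry.
by exists M; split; [exact: num_real|move=> x Mx w _ /=; exact: le_trans (ltW Mx)].
Qed.

Definition sqint f : Prop :=
  measurable_fun setT f /\ P.-integrable setT (EFin \o (fun w => f w ^+ 2)).

Lemma integrable_le f g : measurable_fun setT f ->
  P.-integrable setT (EFin \o g) -> (forall w, `|f w| <= g w) ->
  P.-integrable setT (EFin \o f).
Proof.
move=> mf ig fg; apply: le_integrable ig => //; first exact/measurable_EFinP.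
by move=> w _ /=; rewrite lee_fin (le_trans (fg w))// ler_norm.
Qed.

Lemma sqint_mul f g : sqint f -> sqint g ->
  P.-integrable setT (EFin \o (fun w => f w * g w)).
Proof.
move=> [mf f2] [mg g2]; apply: (@integrable_le _ (fun w => f w ^+ 2 + g w ^+ 2)).
- exact: measurable_funM.
- have := integrableD measurableT f2 g2.
  by apply: eq_integrable => // w _.
- move=> w; rewrite ler_norml; apply/andP; split.
    have := sqr_ge0 (f w + g w); rewrite sqrrD -subr_ge0 => h.
    have := sqr_ge0 (f w); have := sqr_ge0 (g w); lra.
  have := sqr_ge0 (f w - g w); rewrite sqrrB.
  have := sqr_ge0 (f w); have := sqr_ge0 (g w); lra.
Qed.

Lemma sqint_bmul c f M : measurable_fun setT c -> (forall w, `|c w| <= M) ->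
  sqint f -> sqint (fun w => c w * f w).
Proof.
move=> mc cM [mf f2]; split; first exact: measurable_funM.
apply: (@integrable_le _ (fun w => M ^+ 2 * f w ^+ 2)).
- by apply: measurable_funX; exact: measurable_funM.
- have := integrableZl measurableT (M ^+ 2) f2.
  by apply: eq_integrable => // w _.
- move=> w; rewrite ger0_norm ?sqr_ge0// exprMn ler_wpM2r ?sqr_ge0//.
  by rewrite -real_normK ?num_real// lerXn2r// ?nnegrE// (le_trans _ (cM w)).
Qed.

Lemma sqint_add f g : sqint f -> sqint g -> sqint (fun w => f w + g w).
Proof.
move=> [mf f2] [mg g2]; split; first exact: measurable_funD.
apply: (@integrable_le _ (fun w => 2 * f w ^+ 2 + 2 * g w ^+ 2)).
- by apply: measurable_funX; exact: measurable_funD.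
- have := integrableD measurableT (integrableZl measurableT 2 f2)
    (integrableZl measurableT 2 g2).
  by apply: eq_integrable => // w _.
- move=> w; rewrite ger0_norm ?sqr_ge0//.
  by have := sqr_ge0 (f w - g w); rewrite sqrrB sqrrD; lra.
Qed.

Lemma sqint_bounded f M : measurable_fun setT f ->
  (forall w, `|f w| <= M) -> sqint f.
Proof.
move=> mf fM; split => //; apply: (@integrable_bounded _ (M ^+ 2)).
  exact: measurable_funX.
move=> w; rewrite normrX lerXn2r// ?nnegrE//.
by rewrite (le_trans _ (fM w)).
Qed.

Lemma sqint_cst (k : R) : sqint (cst k).
Proof. exact: (@sqint_bounded _ `|k|). Qed.

Lemma sqint_sum I (r : seq I) (f : I -> T -> R) : (forall i, sqint (f i)) ->
  sqint (fun w => \sum_(i <- r) f i w).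
Proof.
move=> sf; elim: r => [|i r IH].
  rewrite (_ : (fun w => _) = cst 0); first exact: sqint_cst.
  by apply/funext => w; rewrite big_nil.
rewrite (_ : (fun w => _) = (fun w => f i w + \sum_(j <- r) f j w)).
  exact: sqint_add.
by apply/funext => w; rewrite big_cons.
Qed.

Lemma sqint_integrable f : sqint f -> P.-integrable setT (EFin \o f).
Proof.
move=> sf; have := sqint_mul sf (sqint_cst 1).
by apply: eq_integrable => // w _ /=; rewrite mulr1.
Qed.

Lemma Rintegral_sum I (r : seq I) (f : I -> T -> R) :
  (forall i, P.-integrable setT (EFin \o f i)) ->
  \int[P]_w (\sum_(i <- r) f i w) = \sum_(i <- r) \int[P]_w f i w.
Proof. by move=> fi; exact: Rintegral_bigsum. Qed.

End square_integrable.

(** * Isometry for finite families of intervals *)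

Section isometry.
Context {R : realType} {disp : measure_display} {T : measurableType disp}.
Context {d : nat} (P : probability T R).
Variables (X : R -> T -> 'I_d) (B : R -> {RV P >-> R}) (Y0 : {RV P >-> R}).
Hypothesis mX : forall t : R, 0 <= t -> forall x, measurable [set w | X t w = x].
Hypothesis BM : brownian_motion B.
Hypothesis indep : independent3 P (sigma_of `[0, +oo[ measurable B)
  (preimage_set_system setT Y0 measurable)
  (sigma_of `[0, +oo[ [set: set 'I_d] X).
Local Notation adapted := (adapted X B Y0).
Local Notation c1 := (@normal_second_moment R).

Definition increment (s t : R) (w : T) : R := B t w - B s w.

Lemma increment_normal (s t : R) : 0 <= s -> s < t -> forall U : set R, measurable U ->
  P [set w | U (increment s t w)] = normal_prob 0 (Num.sqrt (t - s)) U.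
Proof. by move=> s0 st U mU; have [_ _ _] := BM; apply. Qed.

Lemma measurable_increment (s t : R) : measurable_fun setT (increment s t).
Proof. exact: measurable_funB. Qed.

Lemma increment_sqr (s t : R) : 0 <= s -> s <= t ->
  (\int[P]_w (increment s t w ^+ 2)%:E = (c1 * (t - s))%:E)%E.
Proof.
move=> s0; rewrite le_eqVlt => /predU1P[<-|st].
  rewrite subrr mulr0 integral0_eq// => w _.
  by rewrite /increment subrr expr0n.
have ts : 0 < t - s by rewrite subr_gt0.
have sq0 : 0 < Num.sqrt (t - s) by rewrite sqrtr_gt0.
rewrite (normal_variable_sqr (measurable_increment s t) sq0 (increment_normal s0 st)).
by rewrite sqr_sqrtr ?ltW// mulrC.
Qed.

Lemma sqint_increment (s t : R) : 0 <= s -> s <= t -> sqint P (increment s t).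
Proof.
move=> s0 st; split; first exact: measurable_increment.
apply/integrableP; split.
  by apply/measurable_EFinP; apply: measurable_funX; exact: measurable_increment.
under eq_integral do rewrite /= ger0_norm ?sqr_ge0//.
by rewrite increment_sqr// ltry.
Qed.

Lemma increment_mean (s t : R) : 0 <= s -> s <= t ->
  \int[P]_w increment s t w = 0.
Proof.
move=> s0; rewrite le_eqVlt => /predU1P[<-|st].
  rewrite (@eq_Rintegral _ _ _ P setT (cst 0)) ?Rintegral_cst ?mul0r// => w _.
  by rewrite /increment subrr.
have sq0 : 0 < Num.sqrt (t - s) by rewrite sqrtr_gt0 subr_gt0.
by rewrite /Rintegral (normal_variable_mean (measurable_increment s t) sq0
  (increment_normal s0 st)).
Qed.

Lemma adapted_indep (s t : R) Z (g : R -> R) : 0 <= s -> s < t -> adapted s Z ->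
  measurable_fun setT g ->
  independent2 P (preimage_set_system setT Z measurable)
    (preimage_set_system setT (g \o increment s t) measurable).
Proof.
move=> s0 st aZ mg E1 E2 [U mU <-] [V mV <-].
apply: (driving_indep mX BM indep s0 st); first exact: aZ.
exists (g @^-1` V) => //; rewrite -[X in measurable X]setTI; exact: mg.
Qed.

Lemma increment_orthogonal (s t : R) Z : 0 <= s -> s <= t ->
  adapted s Z -> sqint P Z -> \int[P]_w (Z w * increment s t w) = 0.
Proof.
move=> s0 st aZ sZ; have st' := st; move: st; rewrite le_eqVlt => /predU1P[<-|st].
  rewrite (@eq_Rintegral _ _ _ P setT (cst 0)) ?Rintegral_cst ?mul0r// => w _.
  by rewrite /increment subrr mulr0.
rewrite Rintegral_indep ?increment_mean ?mulr0//.
- by case: sZ.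
- exact: measurable_increment.
- exact: (adapted_indep (g := idfun) s0 st aZ (@measurable_id _ _ setT)).
- exact: sqint_integrable.
- by apply: sqint_integrable; exact: sqint_increment.
- by apply: sqint_mul => //; exact: sqint_increment.
Qed.

Lemma increment_sqr_indep (s t : R) c M : 0 <= s -> s <= t ->
  adapted s c -> (forall w, `|c w| <= M) ->
  \int[P]_w (c w * increment s t w ^+ 2) = c1 * (t - s) * \int[P]_w c w.
Proof.
move=> s0 st ac cM; have st' := st; move: st; rewrite le_eqVlt => /predU1P[<-|st].
  rewrite subrr mulr0 mul0r.
  rewrite (@eq_Rintegral _ _ _ P setT (cst 0)) ?Rintegral_cst ?mul0r// => w _.
  by rewrite /increment subrr expr0n mulr0.
have mc := adapted_measurable mX ac.
have [_ i2] := sqint_increment s0 st'.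
rewrite (Rintegral_indep (g := fun w => increment s t w ^+ 2))//.
- by rewrite mulrC; congr (_ * _); rewrite /Rintegral increment_sqr.
- by apply: measurable_funX; exact: measurable_increment.
- by apply: (adapted_indep (g := fun x => x ^+ 2) s0 st ac); exact: exprn_measurable.
- exact: integrable_bounded cM.
- have := sqint_mul (sqint_bmul mc cM (sqint_increment s0 st'))
    (sqint_increment s0 st').
  by apply: eq_integrable => // w _ /=; rewrite expr2 mulrA.
Qed.

(** Length of the intersection of []s, t]] and []s', t']]: up to the factor [c1], the covariance of
    the two increments. *)
Definition overlap (s t s' t' : R) := Num.max 0 (Num.min t t' - Num.max s s').

Lemma overlapC (s t s' t' : R) : overlap s t s' t' = overlap s' t' s t.
Proof. by rewrite /overlap [Num.min t' t]minC [Num.max s' s]maxC. Qed.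

Lemma increment_split (s t u : R) w : increment s u w = increment s t w + increment t u w.
Proof. by rewrite /increment; ring. Qed.

Lemma sqint_adapted_bmul (s t u : R) c M : 0 <= s -> s <= t -> adapted u c ->
  (forall w, `|c w| <= M) -> sqint P (fun w => c w * increment s t w).
Proof.
move=> s0 st ac cM; apply: (sqint_bmul (adapted_measurable mX ac) cM).
exact: sqint_increment.
Qed.

(** The longer increment is cut at [m]; its part after [m] is orthogonal to everything known at time
    [m]. *)
Let isometry_nested (s m t : R) c M : 0 <= s -> s <= m -> m <= t ->
  adapted s c -> (forall w, `|c w| <= M) ->
  \int[P]_w (c w * increment s m w * increment s t w) =
  c1 * (m - s) * \int[P]_w c w.
Proof.
move=> s0 sm mt ac cM; rewrite -(increment_sqr_indep s0 sm ac cM).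
have m0 : 0 <= m by exact: le_trans sm.
have scm := sqint_adapted_bmul s0 sm ac cM.
transitivity (\int[P]_w ((c w * increment s m w) * increment s m w +
    (c w * increment s m w) * increment m t w)).
  by apply: eq_Rintegral => w _; rewrite (increment_split s m t) mulrDr.
rewrite RintegralD//; last 2 first.
- by apply: sqint_mul => //; exact: sqint_increment.
- by apply: sqint_mul => //; exact: sqint_increment.
rewrite [X in _ + X]increment_orthogonal//.
  by rewrite addr0; apply: eq_Rintegral => w _; rewrite expr2 mulrA.
apply: measurable_funM; first exact: adapted_le ac.
exact: adapted_increment.
Qed.

(** Either the first interval ends before the second begins, and the second increment is orthogonal
    to the rest; or the first one is cut at [s'], its early part contributes nothing, and two
    increments with the same origin [s'] remain. *)
Let isometry_ordered (s t s' t' : R) a b M N : 0 <= s -> s <= t -> s <= s' -> s' <= t' ->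
  adapted s a -> adapted s' b ->
  (forall w, `|a w| <= M) -> (forall w, `|b w| <= N) ->
  \int[P]_w (a w * increment s t w * (b w * increment s' t' w)) =
  c1 * overlap s t s' t' * \int[P]_w (a w * b w).
Proof.
move=> s0 st ss' s't' aa ab aM bN.
have s'0 : 0 <= s' by exact: le_trans ss'.
have aa' : adapted s' a by exact: adapted_le aa.
have aab : adapted s' (fun w => a w * b w) by exact: measurable_funM.
have abMN w : `|a w * b w| <= M * N by rewrite normrM ler_pM.
have [ts'|s't] := leP t s'.
  have -> : overlap s t s' t' = 0.
    apply/max_idPl; rewrite subr_le0 (max_idPr ss') ge_min ts'//.
  rewrite mulr0 mul0r -[RHS](@increment_orthogonal s' t'
    (fun w => (a w * b w) * increment s t w))//.
  - by apply: eq_Rintegral => w _; ring.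
  - apply: measurable_funM => //; apply: adapted_increment => //.
    exact: le_trans st.
  - exact: (sqint_adapted_bmul _ _ aab abMN).
have m0 : s' <= Num.min t t' by rewrite le_min (ltW s't).
have -> : overlap s t s' t' = Num.min t t' - s'.
  by rewrite /overlap (max_idPr ss'); apply/max_idPr; rewrite subr_ge0.
transitivity (\int[P]_w ((a w * b w * increment s s' w) * increment s' t' w +
   (a w * b w) * increment s' t w * increment s' t' w)).
  by apply: eq_Rintegral => w _; rewrite (increment_split s s' t); ring.
have s't_ := ltW s't.
rewrite RintegralD//; last 2 first.
- by apply: sqint_mul; [exact: (sqint_adapted_bmul _ _ aab abMN)|exact: sqint_increment].
- by apply: sqint_mul; [exact: (sqint_adapted_bmul _ _ aab abMN)|exact: sqint_increment].
rewrite increment_orthogonal//; last 2 first.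
- by apply: measurable_funM => //; exact: adapted_increment.
- exact: (sqint_adapted_bmul _ _ aab abMN).
rewrite add0r; have [tt'|/ltW t't] := leP t t'.
  by rewrite (isometry_nested _ _ _ aab abMN).
rewrite -(isometry_nested _ s't' t't aab abMN)//.
by apply: eq_Rintegral => w _; rewrite mulrAC.
Qed.

(** Adaptedness is asked on nondegenerate intervals only: cutting an elementary process at a final
    time leaves empty intervals, whose coefficient may not be known at the cut. *)
Lemma isometry_pair (s t s' t' : R) a b M N :
  0 <= s -> s <= t -> 0 <= s' -> s' <= t' ->
  (s < t -> adapted s a) -> (s' < t' -> adapted s' b) ->
  (forall w, `|a w| <= M) -> (forall w, `|b w| <= N) ->
  \int[P]_w (a w * increment s t w * (b w * increment s' t' w)) =
  c1 * overlap s t s' t' * \int[P]_w (a w * b w).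
Proof.
move=> s0 st s'0 s't' aa ab aM bN.
have zero u v f g : u = v -> \int[P]_w (f w * (g w * increment u v w)) = 0.
  move=> ->; rewrite (@eq_Rintegral _ _ _ P setT (cst 0)) ?Rintegral_cst ?mul0r// => w _.
  by rewrite /increment subrr !mulr0.
have ov0 u v u' : overlap u u u' v = 0.
  apply/max_idPl; rewrite subr_le0 ge_min; apply/orP; left.
  by rewrite le_max lexx.
have [st_eq|st_neq] := eqVneq s t.
  rewrite -st_eq ov0 mulr0 mul0r -[RHS](zero s s (fun w => b w * increment s' t' w) a erefl).
  by apply: eq_Rintegral => w _; rewrite mulrC.
have [s't'_eq|s't'_neq] := eqVneq s' t'.
  by rewrite -s't'_eq overlapC ov0 mulr0 mul0r zero.
have {}aa : adapted s a by apply: aa; rewrite lt_neqAle st_neq.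
have {}ab : adapted s' b by apply: ab; rewrite lt_neqAle s't'_neq.
have [ss'|/ltW s's] := leP s s'; first exact: (isometry_ordered (M := M) (N := N)).
rewrite overlapC.
transitivity (\int[P]_w (b w * increment s' t' w * (a w * increment s t w))).
  by apply: eq_Rintegral => w _; rewrite mulrC.
rewrite (isometry_ordered (M := N) (N := M))//; congr (_ * _).
by apply: eq_Rintegral => w _; rewrite mulrC.
Qed.

(** The intervals may overlap in any manner, so that the difference of two step processes on
    unrelated grids is covered without a common refinement. The double sum is the pathwise energy
    computed in [simple_energy]. *)
Lemma isometry (I : finType) (a : I -> T -> R) (s e : I -> R) (M : I -> R) :
  (forall i, 0 <= s i) -> (forall i, s i <= e i) ->
  (forall i, s i < e i -> adapted (s i) (a i)) ->
  (forall i, measurable_fun setT (a i)) ->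
  (forall i w, `|a i w| <= M i) ->
  (\int[P]_w ((\sum_i a i w * increment (s i) (e i) w) ^+ 2)%:E =
   (c1 * \int[P]_w (\sum_i \sum_j a i w * a j w *
     overlap (s i) (e i) (s j) (e j)))%:E)%E.
Proof.
move=> s0 se aa ma aM.
have sqt i : sqint P (fun w => a i w * increment (s i) (e i) w).
  by apply: (sqint_bmul (ma i) (aM i)); exact: sqint_increment.
have iaa i j : P.-integrable setT (EFin \o (fun w => a i w * a j w)).
  by apply: sqint_mul; apply: sqint_bounded.
have iaao i j : P.-integrable setT (EFin \o (fun w => a i w * a j w *
     overlap (s i) (e i) (s j) (e j))).
  have := integrableZr measurableT (overlap (s i) (e i) (s j) (e j)) (iaa i j).
  by apply: eq_integrable.
rewrite -[LHS]fineK; last first.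
  by apply: integrable_fin_num => //; exact: (sqint_sum (index_enum I) sqt).2.
congr EFin; rewrite -/(Rintegral _ _ _).
transitivity (\int[P]_w (\sum_i \sum_j a i w * increment (s i) (e i) w *
    (a j w * increment (s j) (e j) w))).
  by apply: eq_Rintegral => w _; rewrite expr2 big_distrlr.
have isum (g : I -> I -> T -> R) i :
    (forall j, P.-integrable setT (EFin \o g i j)) ->
    P.-integrable setT (EFin \o (fun w => \sum_j g i j w)).
  move=> gi; have := @integrable_sum _ _ _ P setT measurableT I (index_enum I) xpredT
    (fun j => EFin \o g i j) (fun j _ => gi j).
  by apply: eq_integrable => // w _; rewrite /= sumEFin.
rewrite Rintegral_sum; last first.
  move=> i; apply: (isum (fun i j w => a i w * increment (s i) (e i) w *
    (a j w * increment (s j) (e j) w))) => j; exact: sqint_mul.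
rewrite Rintegral_sum; last first.
  move=> i; exact: (isum (fun i j w => a i w * a j w *
     overlap (s i) (e i) (s j) (e j))).
rewrite mulr_sumr; apply: eq_bigr => i _.
rewrite Rintegral_sum; last by move=> j; exact: sqint_mul.
rewrite Rintegral_sum// mulr_sumr; apply: eq_bigr => j _.
by rewrite (isometry_pair (M := M i) (N := M j))//; [rewrite RintegralZr// mulrA -mulrA; ring|exact: aa|exact: aa].
Qed.

End isometry.

(** * Cadlag paths and the pathwise scheme *)

Section cadlag_paths.
Context {R : realType}.
Local Notation mu := (@lebesgue_measure R).

Lemma near_right_ball (t : R) (Q : R -> Prop) : (\forall u \near t^'+, Q u) ->
  exists2 e : R, 0 < e & forall u, t < u -> u < t + e -> Q u.
Proof.
move=> /nbhs_ballP[e /= e0 he]; exists e => // u tu ut; apply: he => //=.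
by rewrite /ball/= distrC gtr0_norm ?subr_gt0// ltrBlDl.
Qed.

Lemma near_left_ball (t : R) (Q : R -> Prop) : (\forall u \near t^'-, Q u) ->
  exists2 e : R, 0 < e & forall u, t - e < u -> u < t -> Q u.
Proof.
move=> /nbhs_ballP[e /= e0 he]; exists e => // u tu ut; apply: he => //=.
by rewrite /ball/= gtr0_norm ?subr_gt0// ltrBlDl -ltrBlDr.
Qed.

Variables (S : Type).
Implicit Types c : R -> S.

Definition locally_constant c (u : R) := \forall v \near u, c v = c u.

Lemma locally_constant_on c a b u : a < u -> u < b ->
  (forall v w, a < v -> v < b -> a < w -> w < b -> c v = c w) ->
  locally_constant c u.
Proof.
move=> au ub h; near=> v; apply: h => //; near: v.
- exact: lt_nbhsr.
- exact: lt_nbhsl.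
Unshelve. all: end_near. Qed.

End cadlag_paths.

Section cadlag_jumps.
Context {R : realType} {d : nat}.
Local Notation mu := (@lebesgue_measure R).
Implicit Types c : R -> 'I_d.

Definition jumps c (t : R) : set R := [set u | 0 < u < t /\ ~ locally_constant c u].

(** Every point of [[0, t]] has a neighbourhood in which it is the only possible jump: the path is
    constant just after it and, having a left limit in a discrete space, just before it. Compactness
    concludes. *)
Lemma cadlag_finite_jumps c t : cadlag c -> finite_set (jumps c t).
Proof.
move=> [cr cl].
have iso (u : R) : 0 <= u -> \forall v \near u, jumps c t v -> v = u.
  move=> u0.
  have [e e0 he] := near_right_ball (cr u u0).
  have [e' e'0 he'] : exists2 e' : R, 0 < e' & forall v, 0 < v -> u - e' < v ->
      v < u -> locally_constant c v.
    (* At time 0 no positive time lies to the left, and any radius will do. *)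
    have [u_gt0|] := ltP 0 u; last first.
      by move=> u_le0; exists 1 => // v v0 _ vu; have := lt_le_trans (lt_trans v0 vu) u_le0; rewrite ltxx.
    have [x /near_left_ball[e' e'0 he']] := cl u u_gt0.
    exists e' => // v v0 uv vu; apply: (@locally_constant_on _ _ _ (u - e') u) => //.
    by move=> v1 v2 *; rewrite !he'.
  near=> v => -[/andP[v0 _] vj]; apply/eqP; apply: contrapT => /negP vu; apply: vj.
  move: vu; rewrite neq_lt => /orP[vu|uv].
    apply: he' => //; near: v; apply: lt_nbhsr; by rewrite ltrBlDr ltrDl.
  apply: (@locally_constant_on _ _ _ u (u + e)) => //.
    by near: v; apply: lt_nbhsl; rewrite ltrDl.
  by move=> v1 v2 *; rewrite !he.
have : compact `[0, t]%classic by exact: segment_compact.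
rewrite compact_cover => /(_ R `[0, t]%classic
  (fun u => interior [set v | jumps c t v -> v = u])).
case.
- by move=> u _; exact: open_interior.
- move=> u u0t; exists u => //; rewrite /interior/=; apply: iso.
  by move: u0t; rewrite /= in_itv/= => /andP[].
move=> D _ hD; apply: sub_finite_set (finite_fset D) => v vj. have v0t : `[0, t]%classic v.
  by case: vj => /andP[v0 vt] _; rewrite /= in_itv/= (ltW v0) (ltW vt).
have [u uD] := hD v v0t.
by move=> /interior_subset/(_ vj) ->.
Unshelve. all: end_near. Qed.

End cadlag_jumps.

Section interval_convergence.
Context {R : realType}.
Local Notation mu := (@lebesgue_measure R).

Lemma finite_measurable_fun (J : set R) (g : R -> R) : finite_set J ->
  measurable_fun J g.
Proof.
move=> fJ _ A mA.
have fin : finite_set (J `&` g @^-1` A) by apply: sub_finite_set fJ => x [].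
rewrite -(image_id (J `&` g @^-1` A)) -bigcup_imset1.
by apply: fin_bigcup_measurable => // x _; exact: measurable_set1.
Qed.

Lemma measurable_fun_jumps (J : set R) (g : R -> R) (t : R) : finite_set J ->
  (forall u, 0 < u < t -> ~ J u -> {for u, continuous g}) ->
  measurable_fun `[0, t] g.
Proof.
move=> fJ cg; pose U : set R := `]0, t[ `&` ~` J.
have cJ : closed J by apply: accessible_finite_set_closed.1 => //; exact: hausdorff_accessible.
have oU : open U by apply: openI; [exact: interval_open|exact: closed_openC].
have mU : measurable U by exact: open_measurable.
apply: (@measurable_funS _ _ _ _ (U `|` (J `|` [set 0; t]))).
- apply: measurableU => //; rewrite -(image_id (J `|` _)) -bigcup_imset1.
  apply: fin_bigcup_measurable; first by rewrite finite_setU; split => //; exact: finite_set2.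
  by move=> x _; exact: measurable_set1.
- move=> u; rewrite /= in_itv/= => /andP[].
  rewrite le_eqVlt => /predU1P[<- _|u0]; first by right; right; left.
  rewrite le_eqVlt => /predU1P[->|ut]; first by right; right; right.
  have [uJ|uJ] := pselect (J u); first by right; left.
  by left; split => //; rewrite /= in_itv/= u0.
have fJ' : finite_set (J `|` [set 0; t]) by rewrite finite_setU; split => //; exact: finite_set2.
apply/measurable_funU => //.
  rewrite -(image_id (J `|` _)) -bigcup_imset1.
  by apply: fin_bigcup_measurable => // x _; exact: measurable_set1.
split; last exact: finite_measurable_fun.
apply: open_continuous_measurable_fun => // u /set_mem[/=].
by rewrite in_itv/= => u0t uJ; exact: cg.
Qed.

Lemma interval_dct (J : set R) (t M : R) (f : R -> R) (g : nat -> R -> R) :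
  finite_set J -> measurable_fun `[0, t] f ->
  (forall n, measurable_fun `[0, t] (g n)) ->
  (forall u, 0 < u < t -> ~ J u -> g n u @[n --> \oo] --> f u) ->
  (forall n u, 0 <= u <= t -> `|g n u| <= M) ->
  [/\ mu.-integrable `[0, t] (EFin \o f),
      (\int[mu]_(u in `[0, t]) `|g n u - f u|) @[n --> \oo] --> (0 : R) &
      (\int[mu]_(u in `[0, t]) g n u) @[n --> \oo] --> \int[mu]_(u in `[0, t]) f u].
Proof.
move=> fJ mf mg gf gM.
have negJ : mu.-negligible (J `|` [set 0; t]).
  have fJ' : finite_set (J `|` [set 0; t]) by rewrite finite_setU; split => //; exact: finite_set2.
  exists (J `|` [set 0; t]); split => //.
    rewrite -(image_id (J `|` _)) -bigcup_imset1.
    by apply: fin_bigcup_measurable => // x _; exact: measurable_set1.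
  by apply: countable_lebesgue_measure0; exact: finite_set_countable.
have [] := @dominated_convergence _ _ R mu `[0, t]%classic (measurable_itv _)
  (fun n => EFin \o g n) (EFin \o f) (EFin \o cst M).
- by move=> n; apply/measurable_EFinP; exact: mg.
- by apply/measurable_EFinP; exact: mf.
- apply: negligibleS negJ => u /=; apply: contra_notP => uJ.
  rewrite in_itv/= => /andP[u0 ut]; apply: cvg_EFin; first exact: nearW.
  apply: gf; last by move=> Ju; apply: uJ; left.
  rewrite !lt_neqAle u0 ut !andbT; apply/andP; split.
    by apply: contra_notN uJ => /eqP <-; right; left.
  by apply: contra_notN uJ => /eqP ->; right; right.
- apply: (@integrableS _ _ _ mu `[0, t]%classic) => //.
  apply: measurable_bounded_integrable => //.
    by apply: compact_finite_measure; exact: segment_compact.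
  by exists `|M|; split; [exact: num_real|move=> x Mx w _ /=; exact: ltW].
- by apply: aeW => u n; rewrite /= in_itv/= => ut; rewrite lee_fin gM.
move=> If c1 c2; split => //.
- apply: fine_cvg; apply: cvg_trans c1; apply: near_eq_cvg; near=> n => /=.
  by [].
- apply: fine_cvg; rewrite fineK//; exact: integrable_fin_num.
Unshelve. all: end_near. Qed.

End interval_convergence.

Lemma integrable_scale {d} {T : measurableType d} {R : realType}
    (mu : {measure set T -> \bar R}) (D : set T) (r : R) (f : T -> R) :
  measurable D -> mu.-integrable D (EFin \o f) ->
  mu.-integrable D (EFin \o (fun x => r * f x)).
Proof.
by move=> mD If; have := integrableZl mD r If; apply: eq_integrable.
Qed.

Lemma integrable_sub {d} {T : measurableType d} {R : realType}
    (mu : {measure set T -> \bar R}) (D : set T) (f g : T -> R) :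
  measurable D -> mu.-integrable D (EFin \o f) ->
  mu.-integrable D (EFin \o g) ->
  mu.-integrable D (EFin \o (fun x => f x - g x)).
Proof.
by move=> mD If Ig; have := integrableB mD If Ig; apply: eq_integrable.
Qed.

(** * Uniform grids and step functions *)

Section grids.
Context {R : realType}.
Local Notation mu := (@lebesgue_measure R).
Implicit Types (t h u : R) (a : R -> R) (n k : nat).

Definition mesh t n : R := t / n.+1%:R.

(** Left values on intervals open at the left, as in [ep_val]; the value at time 0 is therefore
    0. *)
Definition grid_fun t n a u : R :=
  \sum_(k < n.+1) a (k%:R * mesh t n) *
    \1_(`]k%:R * mesh t n, k.+1%:R * mesh t n]%classic) u.

Lemma mesh_gt0 t n : 0 < t -> 0 < mesh t n.
Proof. by move=> t0; rewrite divr_gt0. Qed.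

Lemma meshE t n : n.+1%:R * mesh t n = t.
Proof. by rewrite mulrC divfK// pnatr_eq0. Qed.

Lemma grid_time_itv t n k : 0 < t -> (k <= n.+1)%N -> 0 <= k%:R * mesh t n <= t.
Proof.
move=> t0 kn; have h0 := mesh_gt0 n t0; rewrite mulr_ge0 ?(ltW h0)//=.
by rewrite -[X in _ <= X](meshE t n) ler_pM2r// ler_nat.
Qed.

Lemma cvg_mesh t : mesh t n @[n --> \oo] --> 0.
Proof.
rewrite -[X in _ --> X](mulr0 t); apply: cvgMl_tmp; exact: cvg_harmonic.
Qed.

Lemma grid_fun_eval t n u : 0 < t -> 0 < u <= t ->
  exists2 k, (k <= n)%N /\ k%:R * mesh t n < u <= k.+1%:R * mesh t n &
    forall a, grid_fun t n a u = a (k%:R * mesh t n).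
Proof.
move=> t0 /andP[u0 ut]; have h0 := mesh_gt0 n t0.
have ex : exists k, u <= k.+1%:R * mesh t n by exists n; rewrite meshE.
pose k := ex_minn ex.
have [uk kmin] : u <= k.+1%:R * mesh t n /\
    forall m, u <= m.+1%:R * mesh t n -> (k <= m)%N.
  by rewrite /k; case: ex_minnP.
have kn : (k <= n)%N by apply: kmin; rewrite meshE.
have ku : k%:R * mesh t n < u.
  case: (k) kmin => [|k'] kmin; first by rewrite mul0r.
  rewrite ltNge; apply/negP => /kmin; by rewrite ltnn.
exists k; first by rewrite ku.
move=> a; rewrite /grid_fun (bigD1 (Ordinal (kn : (k < n.+1)%N)))//= big1.
  by rewrite addr0 indicE mem_set ?mulr1//= in_itv/= ku.
move=> i ik; rewrite indicE memNset ?mulr0//= in_itv/= => /andP[iu ui].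
case/negP: ik; apply/eqP/val_inj => /=; apply/eqP; rewrite eqn_leq.
rewrite kmin// andbT -ltnS -(ltr_nat R) -(ltr_pM2r h0).
exact: lt_le_trans iu uk.
Qed.

Lemma grid_fun_le0 t n a u : 0 < t -> u <= 0 -> grid_fun t n a u = 0.
Proof.
move=> t0 u0; rewrite /grid_fun big1// => k _.
rewrite indicE memNset ?mulr0//= in_itv/= => /andP[ku _].
have := lt_le_trans ku u0; rewrite ltNge mulr_ge0// ltW//; exact: mesh_gt0.
Qed.

Lemma grid_fun_bound t n a M u : 0 < t -> 0 <= M ->
  (forall v, 0 <= v <= t -> `|a v| <= M) -> 0 <= u <= t -> `|grid_fun t n a u| <= M.
Proof.
move=> t0 M0 aM /andP[u0 ut]; move: u0; rewrite le_eqVlt => /predU1P[<-|u0].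
  by rewrite grid_fun_le0// normr0.
have [|k [kn /andP[ku uk]] ->] := @grid_fun_eval t n u t0; first by rewrite u0.
by apply: aM; apply: grid_time_itv => //; exact: leqW.
Qed.

Lemma measurable_grid_fun t n a (D : set R) : measurable_fun D (grid_fun t n a).
Proof.
apply: measurable_funTS; apply: measurable_sum => k.
apply: measurable_funM => //; exact: measurable_indic.
Qed.

(** The sampling times [s n] are the same for every [a], even one varying with [n]: limits of step
    functions become limits along a sequence of times tending to [u]. *)
Lemma grid_point t u : 0 < t -> 0 < u <= t ->
  exists2 s : nat -> R, s n @[n --> \oo] --> u &
    forall n a, grid_fun t n a u = a (s n) /\ 0 <= s n <= t.
Proof.
move=> t0 ut; have hk n := @grid_fun_eval t n u t0 ut.
pose k n := projT1 (cid2 (hk n)).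
have kP n : (k n <= n)%N /\ (k n)%:R * mesh t n < u <= (k n).+1%:R * mesh t n.
  by rewrite /k; case: cid2.
have kE n a : grid_fun t n a u = a ((k n)%:R * mesh t n) by rewrite /k; case: cid2.
exists (fun n => (k n)%:R * mesh t n); last first.
  move=> n a; split; first exact: kE.
  by have [kn _] := kP n; apply: grid_time_itv => //; exact: leqW.
apply: (@squeeze_cvgr _ _ _ _ (fun n => u - mesh t n) (cst u)).
- apply: nearW => n; have [_ /andP[ku uk]] := kP n; rewrite (ltW ku) andbT.
  by move: uk; rewrite -natr1 mulrDl mul1r -lerBlDr.
- by rewrite -[X in _ --> X]subr0; apply: cvgB; [exact: cvg_cst|exact: cvg_mesh].
- exact: cvg_cst.
Qed.

Lemma integral_grid_fun t n a q : 0 < t -> (q <= n.+1)%N ->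
  \int[mu]_(u in `[0, q%:R * mesh t n]) grid_fun t n a u =
  \sum_(k < q) mesh t n * a (k%:R * mesh t n).
Proof.
move=> t0 qn; have h0 := mesh_gt0 n t0.
pose h := mesh t n.
have mI k : measurable (`]k%:R * h, k.+1%:R * h]%classic : set R) by [].
have fin : (mu `[0%R, (q%:R * h)%R] < +oo)%E.
  by apply: compact_finite_measure; exact: segment_compact.
have i1 (k : nat) : mu.-integrable `[0, q%:R * h]
    (EFin \o \1_(`]k%:R * h, k.+1%:R * h]%classic : set R)).
  apply: measurable_bounded_integrable => //.
  exists 1; split; first exact: num_real.
  move=> x Mx u _ /=; rewrite (le_trans _ (ltW Mx))//.
  by rewrite indicE; case: (_ \in _); rewrite ?normr1 ?normr0.
have ii (k : nat) : mu.-integrable `[0, q%:R * h]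
    (EFin \o (fun u => a (k%:R * h) * \1_(`]k%:R * h, k.+1%:R * h]%classic) u)).
  exact: (integrable_scale _ _ (i1 k)).
rewrite Rintegral_bigsum//.
have one (k : nat) : \int[mu]_(u in `[0, q%:R * h])
    (a (k%:R * h) * \1_(`]k%:R * h, k.+1%:R * h]%classic) u) =
    if (k < q)%N then h * a (k%:R * h) else 0.
  rewrite RintegralZl//.
  rewrite /Rintegral integral_indic// setIC.
  case: ifPn => kq.
    rewrite (_ : _ `&` _ = `]k%:R * h, k.+1%:R * h]%classic).
      transitivity (a (k%:R * h) *
        fine (lebesgue_measure (`]k%:R * h, k.+1%:R * h]%classic : set R))) => //.
      rewrite lebesgue_measure_itv/= lte_fin ltr_pM2r// ltr_nat ltnSn.
      by rewrite -EFinB/= -mulrBl -natr1 addrAC subrr add0r mul1r mulrC.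
    apply: setIidr => u /=; rewrite !in_itv/= => /andP[ku uk].
    rewrite (le_trans (mulr_ge0 (ler0n _ k) (ltW h0)) (ltW ku))/=.
    by rewrite (le_trans uk)// ler_pM2r// ler_nat.
  rewrite (_ : _ `&` _ = set0) ?measure0 ?mulr0//.
  apply/seteqP; split => u //=; rewrite !in_itv/= => -[/andP[_ uq] /andP[ku _]].
  have := lt_le_trans ku uq; rewrite ltr_pM2r// ltr_nat => {}kq'.
  by rewrite kq' in kq.
rewrite (eq_bigr (fun k : 'I_n.+1 => if (k < q)%N then h * a (k%:R * h) else 0)); last first.
  by move=> k _; exact: one.
by rewrite -big_mkcond/= (big_ord_widen _ (fun k => h * a (k%:R * h)) qn).
Qed.

End grids.

(** * The scheme with frozen damping *)

Section scheme.
Context {R : realType}.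
Implicit Types (rho D : nat -> R).

(** The equation on a grid: [rho k] is the damping over step [k], and [D k] the noise received
    there. *)
Fixpoint scheme rho D (y : R) (q : nat) : R :=
  if q is k.+1 then rho k * scheme rho D y k + D k else y.

(** Discrete form of the random affine map: the product becomes [M], and the scheme started at 0
    becomes [S]. *)
Lemma schemeE rho D y q :
  scheme rho D y q = y * \prod_(k < q) rho k + scheme rho D 0 q.
Proof.
elim: q => [|q IH] /=; first by rewrite big_ord0 mulr1 addr0.
by rewrite IH big_ord_recr/=; ring.
Qed.

Lemma scheme_sum (I : Type) (r : seq I) rho (b : I -> R) (D : I -> nat -> R) q :
  scheme rho (fun k => \sum_(i <- r) b i * D i k) 0 q =
  \sum_(i <- r) b i * scheme rho (D i) 0 q.
Proof.
elim: q => [|q IH] /=; first by rewrite big1// => i _; rewrite mulr0.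
rewrite IH mulr_sumr -big_split/=; apply: eq_bigr => i _; ring.
Qed.

Lemma scheme_diff rho D D' q :
  scheme rho D 0 q - scheme rho D' 0 q = scheme rho (fun k => D k - D' k) 0 q.
Proof. by elim: q => [|q IH] /=; [rewrite subrr|rewrite -IH; ring]. Qed.

Lemma scheme_bound rho D K q : 1 <= K -> (forall k, `|rho k| <= K) ->
  `|scheme rho D 0 q| <= K ^+ q * \sum_(k < q) `|D k|.
Proof.
move=> K1 rK; have K0 : 0 <= K by rewrite (le_trans ler01).
elim: q => [|q IH] /=; first by rewrite normr0 big_ord0 mulr0.
rewrite (le_trans (ler_normD _ _))// big_ord_recr/= mulrDr lerD//.
  by rewrite normrM exprS -mulrA ler_pM.
by rewrite ler_peMl// exprn_ege1.
Qed.

End scheme.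

Section simple_energy.
Context {R : realType}.
Local Notation mu := (@lebesgue_measure R).

Lemma Rintegral_itv_overlap (t s e s' e' : R) :
  0 <= s -> s <= e -> e <= t -> 0 <= s' -> s' <= e' -> e' <= t ->
  \int[mu]_(u in `[0, t]) (\1_(`]s, e]%classic) u * \1_(`]s', e']%classic) u) =
  overlap s e s' e'.
Proof.
move=> s0 se et s'0 s'e' e't.
have -> : \int[mu]_(u in `[0, t]) (\1_(`]s, e]%classic) u * \1_(`]s', e']%classic) u) =
    \int[mu]_(u in `[0, t]) (\1_(`]s, e] `&` `]s', e']) u).
  by apply: eq_Rintegral => u _; rewrite indicI.
rewrite /Rintegral integral_indic//; last by apply: measurableI.
rewrite (_ : _ `&` _ `&` _ = [set` `]Num.max s s', Num.min e e']]); last first.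
  apply/seteqP; split => u /=; rewrite !in_itv/= gt_max le_min.
    by move=> [[/andP[-> ->] /andP[-> ->]] _].
  move=> /andP[/andP[su s'u] /andP[ue ue']]; rewrite su s'u ue ue'; split => //.
  by rewrite (le_trans s0 (ltW su)) (le_trans ue et).
transitivity (fine (lebesgue_measure
  (`]Num.max s s', Num.min e e']%classic : set R))) => //.
rewrite lebesgue_measure_itv/= lte_fin /overlap.
have [lt|ge] := ltP (Num.max s s') (Num.min e e').
  by rewrite -EFinB/=; apply/esym/max_idPr; rewrite subr_ge0 ltW.
by apply/esym/max_idPl; rewrite subr_le0.
Qed.

Lemma simple_energy (I : finType) (alpha s e : I -> R) (t : R) :
  (forall i, 0 <= s i) -> (forall i, s i <= e i) -> (forall i, e i <= t) ->
  \int[mu]_(u in `[0, t]) ((\sum_i alpha i * \1_(`]s i, e i]%classic) u) ^+ 2) =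
  \sum_i \sum_j alpha i * alpha j * overlap (s i) (e i) (s j) (e j).
Proof.
move=> s0 se et.
have fin : (mu `[0%R, t] < +oo)%E.
  by apply: compact_finite_measure; exact: segment_compact.
pose g i j u : R := alpha i * alpha j *
  (\1_(`]s i, e i]%classic) u * \1_(`]s j, e j]%classic) u).
have i1 i j : mu.-integrable `[0, t] (EFin \o (fun u : R =>
    (\1_(`]s i, e i]%classic) u * \1_(`]s j, e j]%classic) u : R))).
  apply: measurable_bounded_integrable => //.
    by apply: measurable_funM.
  exists 1; split; first exact: num_real.
  move=> x Mx u _ /=; rewrite (le_trans _ (ltW Mx))// !indicE.
  by case: (_ \in _); case: (_ \in _); rewrite ?mulr1 ?mulr0 ?normr1 ?normr0.
have ig i j : mu.-integrable `[0, t] (EFin \o g i j).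
  exact: (integrable_scale _ _ (i1 i j)).
have isum i : mu.-integrable `[0, t] (EFin \o (fun u => \sum_j g i j u)).
  have := @integrable_sum _ _ _ mu _ (measurable_itv `[0, t]) I (index_enum I) xpredT
    (fun j => EFin \o g i j) (fun j _ => ig i j).
  by apply: eq_integrable => // w _; rewrite /= sumEFin.
transitivity (\int[mu]_(u in `[0, t]) (\sum_i \sum_j g i j u)).
  apply: eq_Rintegral => u _; rewrite expr2 big_distrlr/=.
  by apply: eq_bigr => i _; apply: eq_bigr => j _; rewrite mulrACA.
rewrite Rintegral_bigsum//; apply: eq_bigr => i _.
rewrite Rintegral_bigsum//; apply: eq_bigr => j _.
by rewrite RintegralZl// Rintegral_itv_overlap.
Qed.

End simple_energy.

(** * Convergence along one cadlag path *)

Section pathwise.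
Context {R : realType} {d : nat}.
Local Notation mu := (@lebesgue_measure R).
Variables (c : R -> 'I_d) (t : R).
Hypothesis t0 : 0 < t.
Hypothesis cad : cadlag c.
Implicit Types F : 'I_d -> R.

Lemma state_bound F : exists2 M : R, 0 <= M & forall x, `|F x| <= M.
Proof.
exists (\sum_x `|F x|); first exact: sumr_ge0.
by move=> x; rewrite (bigD1 x)//= lerDl sumr_ge0.
Qed.

Lemma not_jump (u : R) : 0 < u < t -> ~ jumps c t u -> locally_constant c u.
Proof. by move=> ut uj; apply: contrapT => h; exact: uj. Qed.

Lemma grid_fun_cvg (a : nat -> R -> R) (b : R -> R) (u : R) : 0 < u < t ->
  (forall s : nat -> R, s n @[n --> \oo] --> u -> (forall n, 0 <= s n <= t) ->
     a n (s n) @[n --> \oo] --> b u) ->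
  grid_fun t n (a n) u @[n --> \oo] --> b u.
Proof.
move=> /andP[u0 ut] ab.
have [|s su sE] := @grid_point R t u t0; first by rewrite u0 ltW.
under eq_fun do rewrite (sE _ _).1.
by apply: ab => // n; exact: (sE n (a n)).2.
Qed.

Lemma state_cvg (u : R) (s : nat -> R) : locally_constant c u ->
  s n @[n --> \oo] --> u -> \forall n \near \oo, c (s n) = c u.
Proof. by move=> lu su; exact: su lu. Qed.

Lemma measurable_state_fun F (Y : R -> R) :
  (forall u, 0 < u -> {for u, continuous Y}) ->
  measurable_fun `[0, t] (fun u => F (c u) * Y u).
Proof.
move=> cY; apply: (measurable_fun_jumps (J := jumps c t)) => //.
  exact: cadlag_finite_jumps.
move=> u ut uj; have lu := not_jump ut uj.
apply: cvgM; last by apply: cY; case/andP: ut.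
by apply: near_cst_continuous; apply: filterS lu => v /= ->.
Qed.

Lemma measurable_state_comp F : measurable_fun `[0, t] (fun u => F (c u)).
Proof.
have cc (u : R) : 0 < u -> {for u, continuous (cst (1 : R))}.
  by move=> _; exact: cst_continuous.
have := measurable_state_fun F cc.
by apply: eq_measurable_fun => u _; rewrite /= mulr1.
Qed.

Lemma riemann_sum_cvg F :
  \sum_(k < n.+1) mesh t n * F (c (k%:R * mesh t n)) @[n --> \oo] -->
  \int[mu]_(u in `[0, t]) F (c u).
Proof.
have [M M0 FM] := state_bound F.
have [] := @interval_dct R (jumps c t) t M (fun u => F (c u))
  (fun n => grid_fun t n (F \o c)).
- exact: cadlag_finite_jumps.
- exact: measurable_state_comp.
- by move=> n; exact: measurable_grid_fun.
- move=> u ut uj; apply: (grid_fun_cvg (a := fun=> F \o c) (b := F \o c)) => // s su _.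
  apply: cvg_near_cst; have := state_cvg (not_jump ut uj) su.
  by apply: filterS => n /= ->.
- by move=> n u ut; apply: grid_fun_bound => // v _; exact: FM.
move=> _ _; apply: cvg_trans; apply: near_eq_cvg; near=> n.
by have := integral_grid_fun (F \o c) t0 (leqnn n.+1); rewrite meshE => ->.
Unshelve. all: end_near. Qed.

Lemma grid_square_cvg (I : finType) (alpha s e : I -> R) F :
  let h u : R := \sum_i alpha i * \1_(`]s i, e i]%classic) u in
  mu.-integrable `[0, t] (EFin \o (fun u => (h u - F (c u)) ^+ 2)) /\
  \int[mu]_(u in `[0, t]) ((h u - grid_fun t n (F \o c) u) ^+ 2) @[n --> \oo] -->
  \int[mu]_(u in `[0, t]) ((h u - F (c u)) ^+ 2).
Proof.
move=> h; have [M M0 FM] := state_bound F.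
pose K := \sum_i `|alpha i|.
have hK u : `|h u| <= K.
  rewrite (le_trans (ler_norm_sum _ _ _))// ler_sum// => i _.
  rewrite normrM ler_piMr// indicE.
  by case: (_ \in _); rewrite ?normr1 ?normr0.
have mh : measurable_fun `[0, t] h.
  apply: measurable_sum => i; apply: measurable_funM => //.
have K0 : 0 <= K by exact: sumr_ge0.
have [] := @interval_dct R (jumps c t) t ((K + M) ^+ 2)
  (fun u => (h u - F (c u)) ^+ 2)
  (fun n u => (h u - grid_fun t n (F \o c) u) ^+ 2).
- exact: cadlag_finite_jumps.
- apply: measurable_funX; apply: measurable_funB => //.
  exact: measurable_state_comp.
- move=> n; apply: measurable_funX; apply: measurable_funB => //.
  exact: measurable_grid_fun.
- move=> u ut uj.
  have hc : h u - grid_fun t n (F \o c) u @[n --> \oo] --> h u - F (c u).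
    apply: cvgB; first exact: cvg_cst.
    apply: (grid_fun_cvg (a := fun=> F \o c) (b := F \o c)) => // v su _.
    apply: cvg_near_cst; have := state_cvg (not_jump ut uj) su.
    by apply: filterS => n /= ->.
  by rewrite expr2; under eq_fun do rewrite expr2; apply: cvgM; exact: hc.
- move=> n u ut; rewrite normrX lerXn2r ?nnegrE ?addr_ge0//.
  rewrite (le_trans (ler_normB _ _))// lerD//.
  by apply: grid_fun_bound => // v _; exact: FM.
by [].
Qed.


(** Both bounds come from [1 + z <= exp z], at [z = h x] and [z = - h x]; the smallness of [h] keeps
    [1 + h x] positive. *)
Lemma damping_bounds (h x : R) : 0 < h -> h * `|x| < 1 ->
  x / (1 + h * x) <= (1 - expR (- (h * x))) / h <= x.
Proof.
move=> h0 hx; have hx1 : 0 < 1 + h * x.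
  have : - (h * `|x|) <= h * x.
    by rewrite -mulrN ler_pM2l// lerNl (le_trans (ler_norm _))// normrN.
  by lra.
rewrite ler_pdivlMr// ler_pdivrMr//; apply/andP; split.
  have e1 := expR_ge1Dx (h * x).
  rewrite mulrAC ler_pdivrMr// mulrBl mul1r expRN lerBrDr.
  have : (expR (h * x))^-1 * (1 + h * x) <= 1.
    by rewrite mulrC ler_pdivrMr ?expR_gt0// mul1r.
  by rewrite [x * h]mulrC; lra.
by have := expR_ge1Dx (- (h * x)); rewrite [x * h]mulrC; lra.
Qed.

Lemma damping_cvg (x : R) :
  (1 - expR (- (mesh t n * x))) / mesh t n @[n --> \oo] --> x.
Proof.
have hx : mesh t n * x @[n --> \oo] --> 0.
  by rewrite -(mul0r x); apply: cvgMr_tmp; exact: cvg_mesh.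
have hx' : mesh t n * `|x| @[n --> \oo] --> 0.
  by rewrite -(mul0r `|x|); apply: cvgMr_tmp; exact: cvg_mesh.
apply: (@squeeze_cvgr _ _ _ _ (fun n => x / (1 + mesh t n * x)) (cst x)).
- near=> n; apply: damping_bounds; first exact: mesh_gt0.
  near: n; exact: (cvgr_lt _ hx').
- rewrite -[X in _ --> X]divr1; apply: cvgM; first exact: cvg_cst.
  apply: cvgV; first exact: oner_neq0.
  by rewrite -[X in _ --> X]addr0; apply: cvgD => //; exact: cvg_cst.
- exact: cvg_cst.
Unshelve. all: end_near. Qed.

Lemma Rintegral_increment_le (f : R -> R) (a b : R) : 0 <= a -> a <= b -> b <= t ->
  mu.-integrable `[0, t] (EFin \o f) ->
  `|\int[mu]_(u in `[0, b]) f u - \int[mu]_(u in `[0, a]) f u| <=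
  \int[mu]_(u in `[0, b]) `|f u| - \int[mu]_(u in `[0, a]) `|f u|.
Proof.
move=> a0 ab bt If.
have sub : `[0, b] `<=` `[0, t].
  by move=> u /=; rewrite !in_itv/= => /andP[-> /le_trans]; apply.
have sub' : `]a, b] `<=` `[0, t].
  move=> u /=; rewrite !in_itv/= => /andP[au ub].
  by rewrite (le_trans a0 (ltW au)) (le_trans ub).
have If' : mu.-integrable `[0, b] (EFin \o f) by exact: integrableS If.
rewrite !Rintegral_itvB ?bnd_simp//; last exact: integrable_norm.
by apply: le_normr_Rintegral => //; exact: integrableS If.
Qed.

Variables (lambda : 'I_d -> R) (Y I : R -> R).
Hypothesis cY : {within `[0, +oo[, continuous Y}.

Let cY_gt0 u : 0 < u -> {for u, continuous Y}.
Proof.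
move=> u0; have [+ _] := (continuous_within_itvcyP 0 Y).1 cY.
by apply; rewrite in_itv/= u0.
Qed.

Let Y_bound : exists2 M : R, 0 <= M & forall u, 0 <= u <= t -> `|Y u| <= M.
Proof.
have cY' : {within `[0, t], continuous Y}.
  by apply: continuous_subspaceW cY => u /=; rewrite !in_itv/= => /andP[->].
have [v _ vmax] := EVT_max (ltW t0) cY'.
have [w _ wmin] := EVT_min (ltW t0) cY'.
exists (`|Y v| + `|Y w|); first exact: addr_ge0.
move=> u; rewrite -[0 <= u <= t]/(u \in `[0, t]) => ut.
rewrite ler_norml; apply/andP; split.
  rewrite (le_trans _ (wmin u ut))// opprD.
  have := ler_norm (- Y w); rewrite normrN; have := normr_ge0 (Y v); lra.
rewrite (le_trans (vmax u ut))//.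
have := ler_norm (Y v); have := normr_ge0 (Y w); lra.
Qed.

(** With this rate in place of [lambda], multiplication by [exp (- h lambda)] is exactly one
    explicit Euler step, so that the error of the scheme is a perturbation of the drift. *)
Let damping n x : R := (1 - expR (- (mesh t n * lambda x))) / mesh t n.

Lemma damped_drift_cvg :
  mu.-integrable `[0, t] (EFin \o (fun u => lambda (c u) * Y u)) /\
  (\int[mu]_(u in `[0, t])
     `|grid_fun t n (fun v => damping n (c v) * Y v) u - lambda (c u) * Y u|)
     @[n --> \oo] --> (0 : R).
Proof.
have [M M0 YM] := Y_bound.
(* For each state the convergent sequence is bounded, and there are finitely many states. *)
have [K K0 dK] : exists2 K : R, 0 <= K & forall n x, `|damping n x| <= K.
  have hx x : exists K : R, forall n, `|damping n x| <= K.
    have cx : cvgn (fun n => damping n x).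
      by apply/cvg_ex; exists (lambda x); exact: damping_cvg.
    have [K [_ hK]] := cvg_seq_bounded cx.
    by exists (K + 1) => n; apply: (hK (K + 1)) => //; rewrite ltrDl.
  pose k x := projT1 (cid (hx x)).
  have kP n x : `|damping n x| <= k x by rewrite /k; case: cid.
  exists (\sum_x `|k x|); first exact: sumr_ge0.
  move=> n x; rewrite (le_trans (kP n x))// (le_trans (ler_norm _))//.
  by rewrite (bigD1 x)//= lerDl sumr_ge0.
have [] := @interval_dct R (jumps c t) t (K * M) (fun u => lambda (c u) * Y u)
  (fun n => grid_fun t n (fun v => damping n (c v) * Y v)).
- exact: cadlag_finite_jumps.
- by apply: measurable_state_fun => u u0; exact: cY_gt0.
- by move=> n; exact: measurable_grid_fun.
- move=> u ut uj.
  apply: (grid_fun_cvg (a := fun n v => damping n (c v) * Y v)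
    (b := fun u => lambda (c u) * Y u)) => // s su _.
  apply: cvgM; last by apply: cvg_comp su _; apply: cY_gt0; case/andP: ut.
  have := @damping_cvg (lambda (c u)); apply: cvg_trans; apply: near_eq_cvg.
  have := state_cvg (not_jump ut uj) su.
  by apply: filterS => n /= ->.
- move=> n u ut; apply: grid_fun_bound => //; first exact: mulr_ge0.
  by move=> v vt; rewrite normrM ler_pM// YM.
by [].
Qed.

Hypothesis Yeq : forall n k, (k <= n.+1)%N ->
  Y (k%:R * mesh t n) = Y 0 -
    (\int[mu]_(u in `[0, k%:R * mesh t n]) (lambda (c u) * Y u)) +
    I (k%:R * mesh t n).

(** [Y] solves the scheme up to the drift error [g n], whose integral over [[0, t]] tends to 0, and
    the errors made on the way are amplified by at most [exp (t L)]. The noise [I] enters through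
    its grid values alone, so its regularity in time plays no part in the estimate. *)
Lemma scheme_cvg :
  scheme (fun k => expR (- (mesh t n * lambda (c (k%:R * mesh t n)))))
    (fun k => I (k.+1%:R * mesh t n) - I (k%:R * mesh t n)) (Y 0) n.+1
    @[n --> \oo] --> Y t.
Proof.
have [If dr] := damped_drift_cvg.
have [L L0 lL] := state_bound lambda.
pose rho n k := expR (- (mesh t n * lambda (c (k%:R * mesh t n)))).
pose D n k := I (k.+1%:R * mesh t n) - I (k%:R * mesh t n).
pose a n v := damping n (c v) * Y v.
pose g n u := grid_fun t n (a n) u - lambda (c u) * Y u.
have Ig n : mu.-integrable `[0, t] (EFin \o grid_fun t n (a n)).
  apply: measurable_bounded_integrable => //.
  - by apply: compact_finite_measure; exact: segment_compact.
  - exact: measurable_grid_fun.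
  - exists (\sum_(k < n.+1) `|a n (k%:R * mesh t n)|); split; first exact: num_real.
    move=> x Mx u _ /=; rewrite (le_trans _ (ltW Mx))//.
    rewrite (le_trans (ler_norm_sum _ _ _))// ler_sum// => k _.
    rewrite normrM ler_piMr// indicE.
    by case: (_ \in _); rewrite ?normr1 ?normr0.
have Igf n : mu.-integrable `[0, t] (EFin \o g n).
  exact: (integrable_sub _ (Ig n) If).
pose E n q := \int[mu]_(u in `[0, q%:R * mesh t n]) `|g n u|.
(* Discrete Gronwall: the error after [q] steps is at most the drift error accumulated so far,
   amplified by [exp (h L)] at each step. *)
have main n q : (q <= n.+1)%N ->
    `|Y (q%:R * mesh t n) - scheme (rho n) (D n) (Y 0) q| <=
    expR (mesh t n * L) ^+ q * E n q.
  have h0 := mesh_gt0 n t0.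
  have K1 : 1 <= expR (mesh t n * L) by rewrite -expR0 ler_expR mulr_ge0// ltW.
  elim: q => [|q IH] qn.
    by rewrite /= mul0r subrr normr0 mulr_ge0 ?exprn_ge0 ?expR_ge0// Rintegral_ge0.
  have qn' := ltnW qn.
  have /andP[q0 qt] := grid_time_itv t0 qn'.
  have /andP[q0' qt'] := grid_time_itv t0 qn.
  have qq' : q%:R * mesh t n <= q.+1%:R * mesh t n by rewrite ler_pM2r// ler_nat.
  have subI k : (k <= n.+1)%N -> `[0, k%:R * mesh t n] `<=` `[0, t].
    move=> /(grid_time_itv t0)/andP[_ kt] u /=; rewrite !in_itv/=.
    by move=> /andP[-> /le_trans]; apply.
  have gE k : (k <= n.+1)%N -> \int[mu]_(u in `[0, k%:R * mesh t n]) g n u =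
      \sum_(j < k) mesh t n * a n (j%:R * mesh t n) -
      \int[mu]_(u in `[0, k%:R * mesh t n]) (lambda (c u) * Y u).
    move=> kn; rewrite RintegralB//; last 2 first.
    - by apply: integrableS (Ig n) => //; exact: subI.
    - by apply: integrableS If => //; exact: subI.
    by rewrite integral_grid_fun.
  have inc := Rintegral_increment_le q0 qq' qt' (Igf n).
  rewrite gE// gE// big_ord_recr/= in inc.
  have aq : mesh t n * a n (q%:R * mesh t n) = (1 - rho n q) * Y (q%:R * mesh t n).
    rewrite /a /damping /rho; field.
    by rewrite gt_eqF.
  (* The noise increment cancels between the equation and the scheme; what remains is the damped
     previous error plus the integral of [g n] over the step. *)
  have -> : Y (q.+1%:R * mesh t n) - scheme (rho n) (D n) (Y 0) q.+1 =
      rho n q * (Y (q%:R * mesh t n) - scheme (rho n) (D n) (Y 0) q) +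
      (\sum_(j < q) mesh t n * a n (j%:R * mesh t n) +
        mesh t n * a n (q%:R * mesh t n) -
       \int[mu]_(u in `[0, q.+1%:R * mesh t n]) (lambda (c u) * Y u) -
       (\sum_(j < q) mesh t n * a n (j%:R * mesh t n) -
        \int[mu]_(u in `[0, q%:R * mesh t n]) (lambda (c u) * Y u))).
    rewrite /= {2}/D (Yeq qn) aq.
    have := Yeq qn'; set y := Y (q%:R * _); set i := I (q%:R * _) => yE.
    rewrite (_ : i = y - Y 0 +
      \int[mu]_(u in `[0, q%:R * mesh t n]) (lambda (c u) * Y u)).
      by rewrite yE; ring.
    by rewrite yE; ring.
  rewrite (le_trans (ler_normD _ _))// normrM.
  have rK : `|rho n q| <= expR (mesh t n * L).
    rewrite ger0_norm ?expR_ge0// ler_expR -mulrN ler_pM2l//.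
    by rewrite (le_trans (ler_norm _))// normrN.
  have EE : E n q <= E n q.+1 by rewrite -subr_ge0 (le_trans _ inc).
  have E0 : 0 <= E n q.+1 - E n q by rewrite subr_ge0.
  rewrite (le_trans (lerD (ler_pM _ _ rK (IH qn')) inc))//.
  rewrite -/(E n q) -/(E n q.+1) mulrA -exprS -[E n q.+1 in leRHS](subrK (E n q)).
  rewrite mulrDr addrC lerD// ler_peMl//.
  exact: exprn_ege1.
apply/cvgrPdist_le => e e0.
have eL : 0 < e / expR (t * L) by rewrite divr_gt0// expR_gt0.
near=> n; have := main n n.+1 (leqnn _); rewrite meshE => /le_trans; apply.
rewrite -expRM_natl mulrA meshE -ler_pdivlMl ?expR_gt0// mulrC.
rewrite /E meshE; near: n.
exact: (cvgr_le _ dr).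
Unshelve. all: end_near. Qed.

End pathwise.

(** * Riemann sums for the Ito integral *)

Section ereal_limits.
Context {R : realType}.
Local Open Scope ereal_scope.

Lemma ge0_cvge0 (u : nat -> \bar R) : (forall n, 0 <= u n) ->
  (forall e : R, (0 < e)%R -> \forall n \near \oo, u n <= e%:E) ->
  u n @[n --> \oo] --> 0.
Proof.
move=> u0 ue; apply/fine_cvgP; split.
  have := ue 1%R ltr01; apply: filterS => n un.
  by rewrite ge0_fin_numE// (le_lt_trans un)// ltry.
apply/cvgrPdist_le => e e0; have := ue e e0; apply: filterS => n un.
rewrite /= sub0r normrN ger0_norm ?fine_ge0// -lee_fin fineK//.
by rewrite ge0_fin_numE// (le_lt_trans un)// ltry.
Qed.

Lemma cvge0_le (u : nat -> \bar R) (e : R) : (0 < e)%R ->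
  u n @[n --> \oo] --> 0 -> \forall n \near \oo, u n <= e%:E.
Proof.
move=> e0 /fine_cvgP[finu cu].
have cu' : \forall n \near \oo, (fine (u n) <= e)%R by exact: (cvgr_le _ cu).
move: finu cu'; apply: filterS2 => n un ule.
by rewrite -(fineK un) lee_fin.
Qed.

(** The integral of a nonnegative function is a supremum over simple functions below it, hence
    monotone for all functions. The inner integral in [is_ito_integral] may fail to be measurable in
    [w] off the cadlag paths. *)
Lemma ge0_le_integral_nonmeasurable {d} {T : measurableType d}
    (mu : {measure set T -> \bar R}) (f g : T -> \bar R) :
  (forall x, 0 <= f x) -> (forall x, f x <= g x) ->
  \int[mu]_x f x <= \int[mu]_x g x.
Proof.
move=> f0 fg.
have g0 x : 0 <= g x by exact: le_trans (fg x).
rewrite !ge0_integralTE//; apply: le_ereal_sup => _ [h hf <-]; exists h => // x; exact: le_trans (fg x).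
Qed.

End ereal_limits.

Lemma sqrB_le {R : realType} (x y : R) : (y - x) ^+ 2 <= 2 * x ^+ 2 + 2 * y ^+ 2.
Proof. by have := sqr_ge0 (x + y); rewrite sqrrD sqrrB; lra. Qed.

Section ito_grid.
Context {R : realType} {disp : measure_display} {T : measurableType disp}.
Context {d : nat} (P : probability T R).
Variables (X : R -> T -> 'I_d) (B : R -> {RV P >-> R}) (Y0 : {RV P >-> R}).
Hypothesis mX : forall t : R, 0 <= t -> forall x, measurable [set w | X t w = x].
Hypothesis cadX : {ae P, forall w, cadlag (X ^~ w)}.
Hypothesis BM : brownian_motion B.
Hypothesis indep : independent3 P (sigma_of `[0, +oo[ measurable B)
  (preimage_set_system setT Y0 measurable)
  (sigma_of `[0, +oo[ [set: set 'I_d] X).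
Local Notation adapted := (adapted X B Y0).
Local Notation c1 := (@normal_second_moment R).
Local Notation mu := (@lebesgue_measure R).
Variables (t : R) (F : 'I_d -> R).
Hypothesis t0 : 0 < t.

Definition grid_integral n w : R :=
  \sum_(k < n.+1) F (X (k%:R * mesh t n) w) *
    increment B (k%:R * mesh t n) (k.+1%:R * mesh t n) w.

Lemma measurable_comp_state (s : R) (G : 'I_d -> R) : 0 <= s ->
  measurable_fun setT (fun w => G (X s w)).
Proof.
move=> s0 _ U mU; rewrite setTI.
exact: (measurable_state mX (G @^-1` U) s0).
Qed.

Lemma grid_time_ge0 n k : 0 <= k%:R * mesh t n.
Proof. by rewrite mulr_ge0// ltW// mesh_gt0. Qed.

Lemma grid_time_le n k : k%:R * mesh t n <= k.+1%:R * mesh t n.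
Proof. by rewrite ler_pM2r ?mesh_gt0// ler_nat. Qed.

(** * One elementary process against the Riemann sums *)

Section one_process.
Variables (m : nat) (tau : nat -> R) (xi : nat -> T -> R).
Hypothesis tau0 : 0 <= tau 0%N.
Hypothesis tauS : forall i, tau i <= tau i.+1.
Hypothesis xiM : forall i, exists M, forall w, `|xi i w| <= M.
Hypothesis xiF : forall i, preimage_set_system setT (xi i) measurable
  `<=` driving_filtration X B Y0 (tau i).

(** Cutting the times at [t] yields both the increments in [ep_integral] at time [t] and the
    restriction of the process to [[0, t]]. *)
Let S i := Num.min (tau i) t.

Definition simple_integral w : R :=
  \sum_(i < m) xi i w * increment B (S i) (S i.+1) w.

Definition simple_path u w : R :=
  \sum_(i < m) xi i w * \1_(`]S i, S i.+1]%classic) u.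

Definition square_gap n w : R :=
  \int[mu]_(u in `[0, t]) ((simple_path u w - grid_fun t n (F \o X ^~ w) u) ^+ 2).

Let tau_ge0 i : 0 <= tau i.
Proof. by elim: i => // i IH; exact: le_trans (tauS i). Qed.

Let S0 i : 0 <= S i. Proof. by rewrite le_min tau_ge0 ltW. Qed.

Let SS i : S i <= S i.+1.
Proof. by rewrite /S le_min !ge_min lexx orbT andbT tauS. Qed.

Let St i : S i <= t. Proof. by rewrite ge_min lexx orbT. Qed.

(** If [tau i] exceeds [t], both cut times equal [t] and the interval is empty; otherwise the cut
    time is [tau i] itself. *)
Let xi_adapted i : S i < S i.+1 -> adapted (S i) (xi i).
Proof.
move=> lt; have -> : S i = tau i.
  apply/min_idPl; rewrite leNgt; apply/negP => tt.
  move: lt; rewrite /S (min_idPr (ltW tt)) ltNge ge_min lexx orbT//.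
exact: adaptedP (@xiF i).
Qed.

Let measurable_xi i : measurable_fun setT (xi i).
Proof. exact: (adapted_measurable mX (adaptedP (@xiF i))). Qed.

Section one_mesh.
Variable n : nat.
(** The terms of the elementary integral and those of the Riemann sum, the latter with a minus sign,
    form one family, to which [isometry] and [simple_energy] apply. *)
Let I : finType := ('I_m + 'I_n.+1)%type.
Let al (i : I) w : R := match i with
  | inl i => xi i w | inr k => - F (X (k%:R * mesh t n) w) end.
Let sl (i : I) : R := match i with inl i => S i | inr k => k%:R * mesh t n end.
Let el (i : I) : R := match i with inl i => S i.+1 | inr k => k.+1%:R * mesh t n end.

Let sl0 i : 0 <= sl i.
Proof. by case: i => [i|k] /=; [exact: S0|exact: grid_time_ge0]. Qed.

Let sel i : sl i <= el i.
Proof. by case: i => [i|k] /=; [exact: SS|exact: grid_time_le]. Qed.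

Let elt i : el i <= t.
Proof.
case: i => [i|k] /=; first exact: St.
by have /andP[] := grid_time_itv t0 (ltn_ord k).
Qed.

Let mal i : measurable_fun setT (al i).
Proof.
case: i => [i|k] /=; first exact: measurable_xi.
by apply: measurableT_comp => //; apply: measurable_comp_state; exact: grid_time_ge0.
Qed.

Let alM i : exists M, forall w, `|al i w| <= M.
Proof.
case: i => [i|k] /=; first exact: xiM.
have [M _ FM] := state_bound F.
by exists M => w; rewrite normrN.
Qed.

Let al_adapted i : sl i < el i -> adapted (sl i) (al i).
Proof.
case: i => [i|k] /=; first exact: xi_adapted.
move=> _; exact: (@adapted_X R disp T d P X B Y0 _ _ (fun x => - F x)
  (grid_time_ge0 n k) (lexx _)).
Qed.

Lemma square_gapE w : square_gap n w =
  \sum_i \sum_j al i w * al j w * overlap (sl i) (el i) (sl j) (el j).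
Proof.
rewrite -(@simple_energy _ I (al ^~ w) sl el t)//.
apply: eq_Rintegral => u _; congr (_ ^+ 2).
rewrite big_sumType/= /grid_fun -sumrN; congr (_ + _).
by apply: eq_bigr => k _; rewrite mulNr.
Qed.

Lemma measurable_square_gap : measurable_fun setT (square_gap n).
Proof.
rewrite (_ : square_gap n = fun w => \sum_i \sum_j al i w * al j w *
  overlap (sl i) (el i) (sl j) (el j)); last by apply/funext => w; exact: square_gapE.
apply: measurable_sum => i; apply: measurable_sum => j.
by apply: measurable_funM => //; exact: measurable_funM.
Qed.

Lemma square_gap_isometry :
  (\int[P]_w ((simple_integral w - grid_integral n w) ^+ 2)%:E =
   (c1 * \int[P]_w square_gap n w)%:E)%E.
Proof.
pose M i := projT1 (cid (alM i)).
have MP i w : `|al i w| <= M i by rewrite /M; case: cid.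
have := isometry mX BM indep sl0 sel al_adapted mal MP.
rewrite (@eq_Rintegral _ _ _ P setT (square_gap n)); last by move=> w _; rewrite square_gapE.
move=> <-; apply: eq_integral => w _; congr ((_ ^+ 2)%:E).
rewrite big_sumType/= /grid_integral -sumrN; congr (_ + _).
by apply: eq_bigr => k _; rewrite mulNr.
Qed.

End one_mesh.

Lemma measurable_simple_integral : measurable_fun setT simple_integral.
Proof.
apply: measurable_sum => i; apply: measurable_funM => //.
exact: measurable_increment.
Qed.

Lemma measurable_grid_integral n : measurable_fun setT (grid_integral n).
Proof.
apply: measurable_sum => k; apply: measurable_funM.
  by apply: measurable_comp_state; exact: grid_time_ge0.
exact: measurable_increment.
Qed.

Lemma square_gap_bound : exists2 K : R, 0 <= K & forall n w, 0 <= square_gap n w <= K.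
Proof.
have [M M0 FM] := state_bound F.
pose N i := projT1 (cid (xiM i)).
have NP i w : `|xi i w| <= N i by rewrite /N; case: cid.
pose L := \sum_(i < m) `|N i|.
have L0 : 0 <= L by exact: sumr_ge0.
have LP u w : `|simple_path u w| <= L.
  rewrite (le_trans (ler_norm_sum _ _ _))// ler_sum// => i _.
  rewrite normrM (le_trans (ler_pM _ _ (NP i w) (_ : _ <= 1)))//.
    by rewrite indicE; case: (_ \in _); rewrite ?normr1 ?normr0.
  by rewrite mulr1 ler_norm.
exists ((L + M) ^+ 2 * t); first by rewrite mulr_ge0 ?sqr_ge0// ltW.
move=> n w; apply/andP; split; first by apply: Rintegral_ge0 => u _; exact: sqr_ge0.
have bd u : 0 <= u <= t ->
    (simple_path u w - grid_fun t n (F \o X ^~ w) u) ^+ 2 <= (L + M) ^+ 2.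
  move=> ut; rewrite -real_normK ?num_real// lerXn2r ?nnegrE ?addr_ge0//.
  rewrite (le_trans (ler_normB _ _))// lerD//.
  by apply: grid_fun_bound => // v _; exact: FM.
have mt : \int[mu]_(u in `[0, t]) (L + M) ^+ 2 = (L + M) ^+ 2 * t.
  rewrite Rintegral_cst//; congr (_ * _).
  transitivity (fine (lebesgue_measure (`[0, t]%classic : set R))) => //.
  by rewrite lebesgue_measure_itv/= lte_fin t0 -EFinB/= subr0.
have fin : (mu `[0%R, t] < +oo)%E.
  by apply: compact_finite_measure; exact: segment_compact.
rewrite -mt; apply: le_Rintegral => //.
- apply: measurable_bounded_integrable => //.
    apply: measurable_funX; apply: measurable_funB; last exact: measurable_grid_fun.
    by apply: measurable_sum => i; apply: measurable_funM.
  exists ((L + M) ^+ 2); split; first exact: num_real.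
  move=> x Mx u /=; rewrite in_itv/= => ut.
  by rewrite ger0_norm ?sqr_ge0// (le_trans (bd u ut))// ltW.
- apply: measurable_bounded_integrable => //.
  exists ((L + M) ^+ 2); split; first exact: num_real.
  by move=> x Mx u _ /=; rewrite ger0_norm ?sqr_ge0// ltW.
Qed.

(* The limit of the gaps is the L2 distance on the paths where X is cadlag, and
   is set to 0 elsewhere, since the distance may not be measurable there. *)
Lemma square_gap_limit (g : T -> \bar R) :
  (forall w, 0 <= g w)%E ->
  (forall w, cadlag (X ^~ w) ->
    g w = (\int[mu]_(u in `[0%R, t]) ((simple_path u w - F (X u w)) ^+ 2)%:E)%E) ->
  exists2 l : R, (l%:E <= \int[P]_w g w)%E &
    \int[P]_w square_gap n w @[n --> \oo] --> l.
Proof.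
move=> g0 gE; have [N [mN PN Nsub]] := cadX.
have good w : ~ N w -> cadlag (X ^~ w).
  by move=> Nw; apply: contrapT => /Nsub.
have [K K0 gK] := square_gap_bound.
pose l w : R := if w \in N then 0 else
  \int[mu]_(u in `[0, t]) ((simple_path u w - F (X u w)) ^+ 2).
pose f n w : R := square_gap n w * \1_(~` N) w.
have mf n : measurable_fun setT (f n).
  apply: measurable_funM; first exact: measurable_square_gap.
  by apply: measurable_indic; exact: measurableC.
have fl w : f n w @[n --> \oo] --> l w.
  rewrite /f /l indicE; case: ifPn => [/set_mem wN|/negP wN].
    rewrite memNset; last by move=> /(_ wN).
    by under eq_fun do rewrite mulr0; exact: cvg_cst.
  have nwN : ~ N w by move=> h; apply: wN; exact: mem_set.
  rewrite mem_set//; under eq_fun do rewrite mulr1.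
  have [_] := @grid_square_cvg R d (X ^~ w) t t0 (good w nwN) 'I_m
    (fun i => xi i w) (fun i => S i) (fun i => S i.+1) F.
  by [].
have ml : measurable_fun setT l.
  by apply: (measurable_fun_cvg (h := f)) => // w _; exact: fl.
have l0 w : 0 <= l w.
  by rewrite /l; case: ifPn => // _; apply: Rintegral_ge0 => u _; exact: sqr_ge0.
have [] := @dominated_convergence _ _ R P setT measurableT
  (fun n => EFin \o f n) (EFin \o l) (EFin \o cst K).
- by move=> n; apply/measurable_EFinP; exact: mf.
- by apply/measurable_EFinP; exact: ml.
- apply: aeW => w _; apply: cvg_EFin; first exact: nearW.
  exact: fl.
- by apply: (@integrable_bounded _ _ _ P (cst K) `|K|).
- apply: aeW => w n _; rewrite /= lee_fin.
  have /andP[q0 qK] := gK n w.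
  rewrite normrM ger0_norm// indicE.
  by case: (_ \in _); rewrite ?normr1 ?normr0 ?mulr1 ?mulr0.
move=> il _ cl; exists (\int[P]_w l w).
  rewrite /Rintegral fineK; last exact: integrable_fin_num.
  apply: ge0_le_integral_nonmeasurable => w; first by rewrite lee_fin.
  rewrite /l; case: ifPn => [_|/negP wN]; first exact: g0.
  have nwN : ~ N w by move=> h; apply: wN; exact: mem_set.
  have [ii _] := @grid_square_cvg R d (X ^~ w) t t0 (good w nwN) 'I_m
    (fun i => xi i w) (fun i => S i) (fun i => S i.+1) F.
  rewrite (gE w (good w nwN)) /Rintegral fineK//.
  by apply: integrable_fin_num => //; exact: ii.
have -> : (fun n => \int[P]_w square_gap n w) = (fun n => \int[P]_w f n w).
  apply/funext => n; congr fine; apply: ae_eq_integral => //.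
  - by apply/measurable_EFinP; exact: measurable_square_gap.
  - by apply/measurable_EFinP; exact: mf.
  - exists N; split => // w /= h; apply: contrapT => Nw; apply: h => _.
    by rewrite /f indicE mem_set ?mulr1.
apply: fine_cvg; rewrite fineK//; exact: integrable_fin_num.
Qed.

End one_process.

(** One elementary process, good for both limits of the definition, serves as intermediary: its
    integral is close to [Iint], and by the isometry its distance to the Riemann sums is governed by
    the distance of the integrands in L2. *)
Lemma ito_grid_L2 (Iint : {RV P >-> R}) :
  is_ito_integral (driving_filtration X B Y0) B (fun u w => F (X u w)) t Iint ->
  (\int[P]_w ((Iint w - grid_integral n w) ^+ 2)%:E)%E @[n --> \oo] --> 0%E.
Proof.
move=> [h [h1 h2]]; apply: ge0_cvge0 => [n|e e0].
  by apply: integral_ge0 => w _; rewrite lee_fin sqr_ge0.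
have e4 : 0 < e / 4 by rewrite divr_gt0.
have c10 : 0 <= c1 := @normal_second_moment_ge0 R.
(* Each of the two squares may cost [e / 4], because of the factors 2 in [sqrB_le]; [e / 8] leaves
   room for the limit in [n], and [c1 + 1] absorbs the isometry factor while staying positive. *)
have e8 : 0 < e / 8 / (c1 + 1) by rewrite !divr_gt0// ltr_wpDl.
have [j [aj bj]] : exists j,
    (\int[P]_w \int[mu]_(u in `[0%R, t]) ((ep_val (h j) u w - F (X u w)) ^+ 2)%:E
       <= (e / 8 / (c1 + 1))%:E)%E /\
    (\int[P]_w ((ep_integral (h j) B t w - Iint w) ^+ 2)%:E <= (e / 4)%:E)%E.
  have A1 := cvge0_le e8 h1; have A2 := cvge0_le e4 h2.
  by near \oo => j; exists j; split; near: j.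
move: aj bj; case: (h j) => m tau xi tau0 tauS xiM xiF aj bj.
have [] := @square_gap_limit m tau xi tau0 tauS xiM xiF
  (fun w => \int[mu]_(u in `[0%R, t]) ((ep_val (ElementaryProcess m tau0 tauS xiM xiF) u w - F (X u w)) ^+ 2)%:E)%E.
- by move=> w; apply: integral_ge0 => u _; rewrite lee_fin sqr_ge0.
(* For [u] in [[0, t]], cutting the times at [t] leaves the indicators unchanged. *)
- move=> w _; apply: eq_integral => u; rewrite inE/= in_itv/= => /andP[u0 ut].
  congr (((_ - _) ^+ 2)%:E); apply: eq_bigr => i _; congr (_ * _).
  rewrite !indicE; congr ((nat_of_bool _)%:R).
  apply/idP/idP => /set_mem/= h'; apply/mem_set; move: h' => /=; rewrite !in_itv/=.
    by move=> /andP[tu ut']; rewrite gt_min tu/= le_min ut' ut.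
  by rewrite gt_min le_min => /andP[/orP[->|/lt_le_trans/(_ ut)]]; rewrite ?ltxx// => /andP[->].
move=> l la ll.
have lb : c1 * l < e / 8.
  have le : l <= e / 8 / (c1 + 1) by rewrite -lee_fin (le_trans la).
  have : l * (c1 + 1) <= e / 8 by rewrite -ler_pdivlMr// ltr_wpDl.
  have e8' : 0 < e / 8 by rewrite divr_gt0.
  have [l0|l0] := ltP 0 l; first by rewrite mulrDr mulr1 [l * c1]mulrC; lra.
  by move=> _; apply: le_lt_trans e8'; rewrite mulr_ge0_le0.
have near_gap : \forall n \near \oo, c1 * \int[P]_w square_gap m tau xi n w <= e / 4.
  have cc : c1 * \int[P]_w square_gap m tau xi n w @[n --> \oo] --> c1 * l.
    exact: cvgMl_tmp.
  apply: (cvgr_le _ cc); apply: (lt_trans lb).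
  by rewrite ltr_pM2l// ltf_pV2 ?posrE// ltr_nat.
move: near_gap; apply: filterS => n gapn.
have mI : measurable_fun setT (simple_integral m tau xi).
  exact: measurable_simple_integral xiF.
have mG : measurable_fun setT (grid_integral n) by exact: measurable_grid_integral.
have iso : (\int[P]_w ((simple_integral m tau xi w - grid_integral n w) ^+ 2)%:E =
   (c1 * \int[P]_w square_gap m tau xi n w)%:E)%E by exact: square_gap_isometry.
pose J w := simple_integral m tau xi w.
apply: (@le_trans _ _ (\int[P]_w ((2 * (J w - Iint w) ^+ 2)%:E +
    (2 * (J w - grid_integral n w) ^+ 2)%:E))%E).
  apply: ge0_le_integral => //.
  - by move=> w _; rewrite lee_fin sqr_ge0.
  - by apply/measurable_EFinP; apply: measurable_funX; exact: measurable_funB.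
  - by apply: emeasurable_funD; apply/measurable_EFinP; apply: measurable_funM => //;
      apply: measurable_funX; exact: measurable_funB.
  - move=> w _; rewrite -EFinD lee_fin.
    set x := J w - Iint w; set y := J w - grid_integral n w.
    have -> : Iint w - grid_integral n w = y - x by rewrite /x /y; ring.
    exact: sqrB_le.
rewrite ge0_integralD//; last 4 first.
- by move=> w _; rewrite lee_fin mulr_ge0 ?sqr_ge0.
- apply/measurable_EFinP; apply: measurable_funM => //.
  by apply: measurable_funX; exact: measurable_funB.
- by move=> w _; rewrite lee_fin mulr_ge0 ?sqr_ge0.
- apply/measurable_EFinP; apply: measurable_funM => //.
  by apply: measurable_funX; exact: measurable_funB.
have Z (f : T -> R) : measurable_fun setT f ->
    (\int[P]_w (2 * f w ^+ 2)%:E = 2%:E * \int[P]_w (f w ^+ 2)%:E)%E.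
  move=> mf; under eq_integral do rewrite EFinM.
  rewrite ge0_integralZl//.
  - by apply/measurable_EFinP; exact: measurable_funX.
  - by move=> w _; rewrite lee_fin sqr_ge0.
rewrite (Z (fun w => J w - Iint w)); last exact: measurable_funB.
rewrite (Z (fun w => J w - grid_integral n w)); last exact: measurable_funB.
rewrite iso.
have -> : e%:E = (2%:E * (e / 4)%:E + 2%:E * (e / 4)%:E)%E.
  by rewrite -!EFinM -EFinD; congr EFin; field.
apply: leeD; apply: lee_wpmul2l => //; by rewrite lee_fin.
Unshelve. all: end_near. Qed.


End ito_grid.

(** * Finite-dimensional laws *)

Lemma cvg_mesh_right {R : realType} (t : R) : 0 < t ->
  mesh t n @[n --> \oo] --> 0^'+.
Proof.
move=> t0 V [e /= e0 eV]; have [N _ NE] := cvgr_lt _ (cvg_mesh t) _ e0.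
exists N => // n /NE ne; apply: eV; last exact: mesh_gt0.
by rewrite /= sub0r normrN ger0_norm// ltW// mesh_gt0.
Qed.

(** * Uniqueness of the transition semigroup *)

Section semigroup_unique.
Context {R : realType} {d : nat}.
Implicit Types M N : 'M[R]_d.

Definition entry_dist M N : R := \sum_x \sum_y `|M x y - N x y|.

(** From [M N - M' N' = (M - M') N + M' (N - N')]: the rows of [N] sum to 1, and the entries of [M']
    are at most 1, which costs the factor [d] after summing over the rows. *)
Lemma entry_dist_mul M M' N N' :
  (forall x y, 0 <= M' x y) -> (forall x, \sum_y M' x y = 1) ->
  (forall x y, 0 <= N x y) -> (forall x, \sum_y N x y = 1) ->
  entry_dist (M *m N) (M' *m N') <= entry_dist M M' + d%:R * entry_dist N N'.
Proof.
move=> M0 M1 N0 N1.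
have -> : d%:R * entry_dist N N' = \sum_(x < d) entry_dist N N'.
  by rewrite sumr_const card_ord mulr_natl.
rewrite /entry_dist -big_split/=; apply: ler_sum => x _.
apply: (@le_trans _ _ (\sum_y (\sum_z `|M x z - M' x z| * N z y +
    \sum_z M' x z * `|N z y - N' z y|))).
  apply: ler_sum => y _; rewrite !mxE.
  have -> : \sum_j M x j * N j y - \sum_j M' x j * N' j y =
      \sum_j (M x j - M' x j) * N j y + \sum_j M' x j * (N j y - N' j y).
    rewrite -sumrB -big_split/=; apply: eq_bigr => z _; ring.
  rewrite (le_trans (ler_normD _ _))// lerD// (le_trans (ler_norm_sum _ _ _))//;
    apply: ler_sum => z _; rewrite normrM ler_pM//.
    by rewrite ger0_norm.
  by rewrite ger0_norm.
rewrite big_split/= lerD//.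
  rewrite exchange_big/=; apply: ler_sum => z _.
  by rewrite -mulr_sumr N1 mulr1.
rewrite exchange_big/=; apply: ler_sum => z _.
rewrite -mulr_sumr ler_piMl ?sumr_ge0// -(M1 x) (bigD1 z)//= lerDl.
by rewrite sumr_ge0.
Qed.

(** Cutting [[0, t]] into steps of length [h], the distance at time [t] is at most [t d / h] times
    the distance at time [h], and the latter is [o(h)] since both semigroups have derivative [A] at
    0. *)
Lemma semigroup_unique (Q Q' : R -> 'M[R]_d) A :
  transition_semigroup Q -> transition_semigroup Q' ->
  infinitesimal_generator Q A -> infinitesimal_generator Q' A ->
  forall t, 0 <= t -> Q t = Q' t.
Proof.
move=> [Q0 Q1 QI QS] [Q0' Q1' QI' QS'] gQ gQ' t.
rewrite le_eqVlt => /predU1P[<-|t0]; first by rewrite QI QI'.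
have step n k : entry_dist (Q (k%:R * mesh t n)) (Q' (k%:R * mesh t n)) <=
    k%:R * (d%:R * entry_dist (Q (mesh t n)) (Q' (mesh t n))).
  have h0 := mesh_gt0 n t0.
  elim: k => [|k IH].
    rewrite !mul0r QI QI' /entry_dist big1// => x _.
    by rewrite big1// => y _; rewrite subrr normr0.
  have kh0 : 0 <= k%:R * mesh t n by rewrite mulr_ge0// ltW.
  rewrite -natr1 !mulrDl !mul1r (QS _ _ kh0 (ltW h0)) (QS' _ _ kh0 (ltW h0)).
  rewrite (le_trans (entry_dist_mul _ _ _ _ _ _))//.
  - by move=> x y; rewrite Q0'.
  - by move=> x; rewrite Q1'.
  - by move=> x y; rewrite Q0// ltW.
  - by move=> x; rewrite Q1// ltW.
  by rewrite lerD.
have cvg0 : t * d%:R * \sum_x \sum_y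
    `|(Q (mesh t n) x y - (x == y)%:R) / mesh t n -
      (Q' (mesh t n) x y - (x == y)%:R) / mesh t n| @[n --> \oo] --> 0.
  rewrite -[X in _ --> X](mulr0 (t * d%:R)); apply: cvgMl_tmp.
  rewrite -[X in _ --> X](@big1 _ 0 +%R 'I_d (index_enum 'I_d) xpredT (fun=> 0))//.
  apply: cvg_bigsum => x.
  rewrite -[X in _ --> X](@big1 _ 0 +%R 'I_d (index_enum 'I_d) xpredT (fun=> 0))//.
  apply: cvg_bigsum => y.
  have hm := cvg_mesh_right t0.
  rewrite -[X in _ --> X](normr0 R) -[in X in _ --> X](subrr (A x y)).
  apply: cvg_norm; apply: cvgB.
    exact: cvg_comp hm (gQ x y).
  exact: cvg_comp hm (gQ' x y).
have dist0 : entry_dist (Q t) (Q' t) <= 0.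
  rewrite -(cvg_lim _ cvg0)//; apply: limr_ge.
    by apply/cvg_ex; exists 0.
  apply: nearW => n; have := step n n.+1; rewrite meshE => /le_trans; apply.
  have h0 := mesh_gt0 n t0.
  have -> : \sum_x \sum_y `|(Q (mesh t n) x y - (x == y)%:R) / mesh t n -
      (Q' (mesh t n) x y - (x == y)%:R) / mesh t n| =
      entry_dist (Q (mesh t n)) (Q' (mesh t n)) / mesh t n.
    rewrite /entry_dist mulr_suml; apply: eq_bigr => x _.
    rewrite mulr_suml; apply: eq_bigr => y _.
    rewrite -mulrBl normrM (gtr0_norm (_ : 0 < (mesh t n)^-1)) ?invr_gt0//.
    by congr (`|_| / _); ring.
  have tE := meshE t n; move: (entry_dist _ _) => D.
  rewrite -[X in _ <= X * _ * _]tE le_eqVlt; apply/orP; left; apply/eqP.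
  by field; rewrite gt_eqF.
apply/matrixP => x y; apply/eqP; rewrite -subr_eq0 -normr_le0.
rewrite (le_trans _ dist0)// /entry_dist (bigD1 x)//= (bigD1 y)//= -addrA lerDl.
by rewrite addr_ge0 ?sumr_ge0// => z _; exact: sumr_ge0.
Qed.

End semigroup_unique.

(** * Laws of sampled paths *)

Section path_law.
Context {R : realType} {disp : measure_display} {T : measurableType disp}.
Context {d : nat} (P : probability T R).
Variables (X : R -> T -> 'I_d) (h : R).
Hypothesis mX : forall t : R, 0 <= t -> forall x, measurable [set w | X t w = x].
Hypothesis h0 : 0 <= h.

Definition path_event (xi : nat -> 'I_d) (N : nat) : set T :=
  [set w | forall k, (k <= N)%N -> X (k%:R * h) w = xi k].

Let kh0 k : 0 <= k%:R * h. Proof. exact: mulr_ge0. Qed.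

Lemma path_event0 xi : path_event xi 0 = [set w | X 0 w = xi 0%N].
Proof.
apply/seteqP; split => w /=; first by move=> /(_ 0%N isT); rewrite mul0r.
by move=> w0 k; rewrite leqn0 => /eqP ->; rewrite mul0r.
Qed.

Lemma path_eventS xi N : path_event xi N.+1 =
  path_event xi N `&` [set w | X (N.+1%:R * h) w = xi N.+1].
Proof.
apply/seteqP; split => w /=.
  by move=> hw; split; [move=> k kN; apply: hw; exact: leqW|exact: hw].
move=> [hw wN] k; rewrite leq_eqVlt => /predU1P[->//|kN].
exact: hw.
Qed.

Lemma path_event_sigma xi N (D : set R) :
  (forall k, (k <= N)%N -> D (k%:R * h)) ->
  sigma_of D [set: set 'I_d] X (path_event xi N).
Proof.
elim: N => [|N IH] DN.
  rewrite path_event0; apply: (@sigma_of_mem _ _ _ _ D [set: set 'I_d] X 0 [set xi 0%N]) => //.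
  by have := DN 0%N isT; rewrite mul0r.
rewrite path_eventS; apply: sigma_of_setI.
  by apply: IH => k kN; apply: DN; exact: leqW.
by apply: (@sigma_of_mem _ _ _ _ D [set: set 'I_d] X _ [set xi N.+1]) => //; exact: DN.
Qed.

Lemma measurable_path_event xi N : measurable (path_event xi N).
Proof.
apply: (@sigma_of_X_measurable _ _ _ _ X mX [set t | 0 <= t]) => //.
by apply: path_event_sigma => k _; exact: kh0.
Qed.

Lemma path_law_step (Q : R -> 'M[R]_d) xi N y :
  (forall s t : R, 0 <= s -> 0 <= t -> forall x y E,
     sigma_of `[0, s] [set: set 'I_d] X E ->
     P (E `&` [set w | X s w = x] `&` [set w | X (s + t) w = y]) =
     (P (E `&` [set w | X s w = x]) * (Q t x y)%:E)%E) ->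
  P (path_event xi N `&` [set w | X (N.+1%:R * h) w = y]) =
  (P (path_event xi N) * (Q h (xi N) y)%:E)%E.
Proof.
move=> markov.
have := markov (N%:R * h) h (kh0 N) h0 (xi N) y (path_event xi N).
have -> : path_event xi N `&` [set w | X (N%:R * h) w = xi N] = path_event xi N.
  by apply/setIidPl => w; exact.
rewrite -natr1 mulrDl mul1r; apply.
apply: path_event_sigma => k kN; rewrite /= in_itv/= kh0/=.
by rewrite ler_wpM2r// ler_nat.
Qed.

End path_law.

Lemma eq_path_law {R : realType} {disp disp' : measure_display}
    {T : measurableType disp} {T' : measurableType disp'} {d : nat}
    (P : probability T R) (P' : probability T' R) (A : 'M[R]_d)
    (X : R -> T -> 'I_d) (X' : R -> T' -> 'I_d) (h : R) xi N :
  markov_process P A X -> markov_process P' A X' -> 0 <= h ->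
  (forall x, P [set w | X 0 w = x] = P' [set w | X' 0 w = x]) ->
  P (path_event X h xi N) = P' (path_event X' h xi N).
Proof.
move=> [mX _ [Q [sQ gQ mQ]]] [mX' _ [Q' [sQ' gQ' mQ']]] h0 X00.
elim: N => [|N IH]; first by rewrite !path_event0.
rewrite !path_eventS (path_law_step h0 xi N _ mQ) (path_law_step h0 xi N _ mQ').
by rewrite IH (semigroup_unique sQ sQ' gQ gQ').
Qed.

Lemma measurable_integral_snd {d1 d2} {T1 : measurableType d1}
    {T2 : measurableType d2} {R : realType} (m : probability T2 R)
    (F : T1 * T2 -> \bar R) :
  measurable_fun setT F -> (forall z, 0 <= F z)%E ->
  measurable_fun setT (fun x => \int[m]_y F (x, y))%E.
Proof. by move=> mF F0; exact: measurable_fun_fubini_tonelli_F. Qed.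

Lemma integral_prob_cst {d} {T : measurableType d} {R : realType}
    (P : probability T R) (c : \bar R) : (\int[P]__ c = c)%E.
Proof.
rewrite integral_cst// -[RHS]mule1; congr (_ * _)%E; exact: probability_setT.
Qed.

Section conditioned_integral.
Context {d} {T : measurableType d} {R : realType} (P : probability T R).

Lemma integral_mrestr (E : set T) (mE : measurable E) (g : T -> \bar R) :
  measurable_fun setT g -> (forall x, 0 <= g x)%E ->
  (\int[mrestr P mE]_w g w = \int[P]_w (g w * (\1_E w)%:E))%E.
Proof.
move=> mg g0.
rewrite (@density_ge0 _ _ _ P (mrestr P mE) (fun w => \1_E w) _ _ _ g mg g0)//.
  exact: measurable_indic.
by move=> A mA; rewrite integral_indic// setIC.
Qed.

Lemma integral_indep_event (E : set T) (U V : {RV P >-> R}) (F : R * R -> \bar R) :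
  measurable E -> measurable_fun setT F -> (forall z, 0 <= F z)%E ->
  (forall A B, measurable A -> measurable B ->
    P (U @^-1` A `&` V @^-1` B `&` E) = (P (U @^-1` A) * P (V @^-1` B) * P E)%E) ->
  (\int[P]_w (F (U w, V w) * (\1_E w)%:E) =
   P E * \int[law U]_y \int[P]_w F (y, V w))%E.
Proof.
move=> mE mF F0 UV.
have PE : (fine (P E))%:E = P E by rewrite fineK// fin_num_measure.
have PE0 : 0 <= fine (P E) by rewrite fine_ge0.
rewrite -(integral_mrestr mE) => [||w//]; last first.
  by apply: measurableT_comp => //; exact: measurable_fun_pair.
rewrite (@integral_joint_law _ _ _ _ _ _ _ (mrestr P mE) (law U) (law V) (NngNum PE0))//=.
  rewrite PE; congr (_ * _)%E; apply: eq_integral => y _.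
  rewrite ge0_integral_distribution//.
  by apply: measurableT_comp => //; exact: measurable_pair1.
move=> A B mA mB; rewrite /mrestr UV// PE /law /distribution /pushforward.
by rewrite muleC.
Qed.

End conditioned_integral.

(** * Laws of Brownian sums with deterministic coefficients *)

Section brownian_sum.
Context {R : realType}.

Definition brownian_sum {disp} {T : measurableType disp} {P : probability T R}
    (B : R -> {RV P >-> R}) (h : R) (c : nat -> R) (K : nat) (w : T) : R :=
  \sum_(k < K) c k * increment B (k%:R * h) (k.+1%:R * h) w.

Section one.
Context {disp} {T : measurableType disp} (P : probability T R).
Variables (B : R -> {RV P >-> R}) (h : R).

Lemma brownian_sum_sigma (D : set R) c K : (forall k, (k <= K)%N -> D (k%:R * h)) ->
  @measurable_fun _ _ (g_sigma_algebraType
    (\bigcup_(i in D) preimage_set_system setT (B i) measurable)) R setT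
    (brownian_sum B h c K).
Proof.
elim: K => [|K IH] DK.
  rewrite (_ : brownian_sum _ _ _ _ = cst 0)//.
  by apply/funext => w; rewrite /brownian_sum big_ord0.
rewrite (_ : brownian_sum _ _ _ _ = brownian_sum B h c K \+
    (cst (c K) \* increment B (K%:R * h) (K.+1%:R * h))); last first.
  by apply/funext => w; rewrite /brownian_sum big_ord_recr.
apply: measurable_funD; first by apply: IH => k kK; apply: DK; exact: leqW.
apply: measurable_funM => //; apply: measurable_funB;
  by apply: sigma_of_fun; exact: DK.
Qed.

Lemma measurable_brownian_sum c K : measurable_fun setT (brownian_sum B h c K).
Proof.
by apply: measurable_sum => k; apply: measurable_funM => //; exact: measurable_increment.
Qed.

Lemma brownian_sum_step c K (F : R -> \bar R) : brownian_motion B -> 0 < h ->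
  measurable_fun setT F -> (forall z, 0 <= F z)%E ->
  (\int[P]_w F (brownian_sum B h c K.+1 w) = \int[P]_w
    \int[normal_prob 0 (Num.sqrt h)]_x F (brownian_sum B h c K w + (c K * x)%R)%R)%E.
Proof.
move=> BM h0 mF F0; have [_ _ indep _] := BM.
have mS := measurable_brownian_sum c K.
pose S : {RV P >-> R} := HB.pack (brownian_sum B h c K) (isMeasurableFun.Build _ _ _ _ _ mS).
pose G (z : R * R) := F (z.1 + c K * z.2).
have mG : measurable_fun setT G.
  apply: measurableT_comp => //; apply: measurable_funD => //.
  exact: measurable_funM.
have hK : K%:R * h < K.+1%:R * h by rewrite ltr_pM2r// ltr_nat.
have K0 : 0 <= K%:R * h by rewrite mulr_ge0// ltW.
transitivity (\int[P]_w G (S w, increment B (K%:R * h) (K.+1%:R * h) w))%E.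
  by apply: eq_integral => w _; rewrite /G /S /brownian_sum/= big_ord_recr.
rewrite (@integral_joint_law _ _ _ _ _ _ _ P (law S)
  (normal_prob 0 (Num.sqrt h)) (NngNum ler01))//=.
- rewrite mul1e ge0_integral_distribution//.
    by apply: (@measurable_integral_snd _ _ _ _ _ (normal_prob 0 (Num.sqrt h)) G mG) => z; exact: F0.
  by move=> y; apply: integral_ge0 => x _; exact: F0.
- exact: measurable_increment.
- move=> U V mU mV; rewrite mul1e (indep _ _ K0 hK).
  + congr (_ * _)%E; have := increment_normal BM K0 hK mV.
    by rewrite -mulrBl -natr1 addrAC subrr add0r mul1r => <-.
  + rewrite -[_ @^-1` _]setTI; apply: (@brownian_sum_sigma `[0, K%:R * h]) => // k kK /=.
    rewrite in_itv/= mulr_ge0//= ?ler_wpM2r ?ler_nat//; exact: ltW.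
  + by exists V => //; rewrite setTI.
- by move=> z; exact: F0.
Qed.

End one.

(** Induction on [K] for all [F] at once: integrating out the last increment leaves another
    nonnegative measurable function of the shorter sum. *)
Lemma eq_brownian_sum_law {disp disp'} {T : measurableType disp}
    {T' : measurableType disp'} (P : probability T R) (P' : probability T' R)
    (B : R -> {RV P >-> R}) (B' : R -> {RV P' >-> R}) h c K :
  brownian_motion B -> brownian_motion B' -> 0 < h ->
  forall F : R -> \bar R, measurable_fun setT F -> (forall z, 0 <= F z)%E ->
  (\int[P]_w F (brownian_sum B h c K w) = \int[P']_w F (brownian_sum B' h c K w))%E.
Proof.
move=> BM BM' h0; elim: K => [|K IH] F mF F0.
  under eq_integral do rewrite /brownian_sum big_ord0.
  under [RHS]eq_integral do rewrite /brownian_sum big_ord0.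
  by rewrite !integral_prob_cst.
rewrite !brownian_sum_step//.
apply: (IH (fun z => \int[normal_prob 0 (Num.sqrt h)]_x F (z + (c K * x)%R)%R)%E).
  apply: (@measurable_integral_snd _ _ _ _ _ (normal_prob 0 (Num.sqrt h))
    (fun z : R * R => F (z.1 + c K * z.2))) => //.
  apply: measurableT_comp => //; apply: measurable_funD => //.
  exact: measurable_funM.
by move=> z; apply: integral_ge0 => x _.
Qed.

End brownian_sum.

(** * Conditioning on the sampled path *)

Section path_expectation.
Context {R : realType} {d : nat}.

(** Sampled paths form a finite type, so that conditioning on the path is a finite sum over
    events. *)
Definition finite_path {T : Type} (X : R -> T -> 'I_d) (h : R) (N : nat) (w : T) :
  {ffun 'I_N.+1 -> 'I_d} := [ffun k : 'I_N.+1 => X (k%:R * h) w].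

Definition extend_path N (xi : {ffun 'I_N.+1 -> 'I_d}) (k : nat) : 'I_d :=
  xi (inord k).

Lemma finite_path_event {disp} {T : measurableType disp} (X : R -> T -> 'I_d) h N xi :
  [set w | finite_path X h N w = xi] = path_event X h (extend_path xi) N.
Proof.
apply/seteqP; split => w /=.
  by move=> <- k kN; rewrite /extend_path ffunE inordK.
move=> wxi; apply/ffunP => k; rewrite ffunE wxi ?/extend_path ?inord_val//.
by rewrite -ltnS.
Qed.

Lemma extend_finite_path {T : Type} (X : R -> T -> 'I_d) h N w k : (k <= N)%N ->
  extend_path (finite_path X h N w) k = X (k%:R * h) w.
Proof. by move=> kN; rewrite /extend_path ffunE inordK. Qed.

Variables (N K : nat) (h : R).
Variables (a : {ffun 'I_N.+1 -> 'I_d} -> R) (c : {ffun 'I_N.+1 -> 'I_d} -> nat -> R).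

Section one.
Context {disp} {T : measurableType disp} (P : probability T R).
Variables (X : R -> T -> 'I_d) (B : R -> {RV P >-> R}).
Hypothesis mX : forall t : R, 0 <= t -> forall x, measurable [set w | X t w = x].
Hypothesis h0 : 0 < h.

Let path_sum w := brownian_sum B h (c (finite_path X h N w)) K w.

Lemma measurable_path_event_finite xi :
  measurable [set w | finite_path X h N w = xi].
Proof. by rewrite finite_path_event; apply: measurable_path_event => //; exact: ltW. Qed.

Lemma sum_path_indic (g : {ffun 'I_N.+1 -> 'I_d} -> \bar R) w :
  (g (finite_path X h N w) =
   \sum_xi g xi * (\1_[set w | finite_path X h N w = xi] w)%:E)%E.
Proof.
rewrite (bigD1 (finite_path X h N w))//= indicE mem_set// mule1 big1 ?adde0//.
move=> xi xiw; rewrite indicE memNset ?mule0//= => wxi.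
by rewrite wxi eqxx in xiw.
Qed.

(** On the event that the path is [xi] the coefficients are constants, and there [Y0], the Brownian
    sum and the event are independent. *)
Lemma path_expectation (Y0 : {RV P >-> R}) (F : R -> \bar R) :
  independent3 P (sigma_of `[0, +oo[ measurable B)
    (preimage_set_system setT Y0 measurable)
    (sigma_of `[0, +oo[ [set: set 'I_d] X) ->
  measurable_fun setT F -> (forall z, 0 <= F z)%E ->
  (\int[P]_w F (Y0 w * a (finite_path X h N w) + path_sum w)%R =
   \sum_xi P [set w | finite_path X h N w = xi] *
     \int[law Y0]_y \int[P]_w F (y * a xi + brownian_sum B h (c xi) K w)%R)%E.
Proof.
move=> indep mF F0.
have mG xi : measurable_fun setT
    (fun z : R * R => F (z.1 * a xi + z.2)).
  by apply: measurableT_comp => //; apply: measurable_funD => //; exact: measurable_funM.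
have mS xi := measurable_brownian_sum B h (c xi) K.
transitivity (\int[P]_w \sum_xi (F (Y0 w * a xi + brownian_sum B h (c xi) K w)%R *
    (\1_[set w | finite_path X h N w = xi] w)%:E))%E.
  apply: eq_integral => w _.
  exact: (sum_path_indic (fun xi => F (Y0 w * a xi + brownian_sum B h (c xi) K w))).
rewrite ge0_integral_sum//.
- apply: eq_bigr => xi _.
  pose S : {RV P >-> R} := HB.pack (brownian_sum B h (c xi) K)
    (isMeasurableFun.Build _ _ _ _ _ (mS xi)).
  apply: (@integral_indep_event _ _ _ P _ Y0 S (fun z => F (z.1 * a xi + z.2)))=> //.
    exact: measurable_path_event_finite.
  move=> U V mU mV; rewrite [Y0 @^-1` _ `&` _]setIC indep.
  + by rewrite [(P (S @^-1` _) * _)%E]muleC.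
  + rewrite -[_ @^-1` _]setTI; apply: (@brownian_sum_sigma _ _ _ _ _ _ `[0, +oo[) => // k _ /=.
    by rewrite in_itv/= andbT mulr_ge0// ltW.
  + by exists U => //; rewrite setTI.
  + rewrite finite_path_event; apply: path_event_sigma => k _ /=.
    by rewrite in_itv/= andbT mulr_ge0// ltW.
- move=> xi; apply: emeasurable_funM.
    apply: measurableT_comp => //; apply: measurable_funD => //.
    exact: measurable_funM.
  apply/measurable_EFinP; apply: measurable_indic; exact: measurable_path_event_finite.
- by move=> xi w _; rewrite mule_ge0// lee_fin.
Qed.

(** Allows [path_expectation] to be used with a deterministic initial value. *)
Lemma preimage_cst_indep (y : R) (Y0 : {RV P >-> R}) :
  independent3 P (sigma_of `[0, +oo[ measurable B)
    (preimage_set_system setT Y0 measurable)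
    (sigma_of `[0, +oo[ [set: set 'I_d] X) ->
  independent3 P (sigma_of `[0, +oo[ measurable B)
    (preimage_set_system setT (cst y : T -> R) measurable)
    (sigma_of `[0, +oo[ [set: set 'I_d] X).
Proof.
move=> indep E1 E2 E3 hE1 [U mU <-] hE3; rewrite preimage_cst setTI.
case: ifPn => _; last by rewrite setI0 set0I measure0 mule0 mul0e.
by apply: indep => //; exact: preimage_setTT.
Qed.

End one.

(** The right-hand side combines the initial law of the second model with the noise of the first:
    this is [affine_law] before the limits. *)
Lemma eq_path_expectation {disp disp'} {T : measurableType disp}
    {T' : measurableType disp'} (P : probability T R) (P' : probability T' R)
    (X : R -> T -> 'I_d) (X' : R -> T' -> 'I_d)
    (B : R -> {RV P >-> R}) (B' : R -> {RV P' >-> R})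
    (Y0 : {RV P >-> R}) (Y0' : {RV P' >-> R}) :
  (forall t : R, 0 <= t -> forall x, measurable [set w | X t w = x]) ->
  (forall t : R, 0 <= t -> forall x, measurable [set w | X' t w = x]) ->
  brownian_motion B -> brownian_motion B' -> 0 < h ->
  independent3 P (sigma_of `[0, +oo[ measurable B)
    (preimage_set_system setT Y0 measurable)
    (sigma_of `[0, +oo[ [set: set 'I_d] X) ->
  independent3 P' (sigma_of `[0, +oo[ measurable B')
    (preimage_set_system setT Y0' measurable)
    (sigma_of `[0, +oo[ [set: set 'I_d] X') ->
  (forall xi, P [set w | finite_path X h N w = xi] =
              P' [set w | finite_path X' h N w = xi]) ->
  forall F : R -> \bar R, measurable_fun setT F -> (forall z, 0 <= F z)%E ->
  (\int[P']_w F (Y0' w * a (finite_path X' h N w) +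
       brownian_sum B' h (c (finite_path X' h N w)) K w)%R =
   \int[law Y0']_y \int[P]_w F (y * a (finite_path X h N w) +
       brownian_sum B h (c (finite_path X h N w)) K w)%R)%E.
Proof.
move=> mX mX' BM BM' h0 indep indep' pathE F mF F0.
rewrite (path_expectation mX' h0 indep' mF F0).
have mG xi y : measurable_fun setT (fun z => F (y * a xi + z)).
  by apply: measurableT_comp => //; exact: measurable_funD.
have mH xi : measurable_fun setT (fun y : R =>
    \int[P]_w F (y * a xi + brownian_sum B h (c xi) K w)%R)%E.
  apply: (@measurable_integral_snd _ _ _ _ _ P
    (fun z : R * T => F (z.1 * a xi + brownian_sum B h (c xi) K z.2))) => //.
  apply: measurableT_comp => //; apply: measurable_funD.
    exact: measurable_funM.
  by apply: measurableT_comp => //; exact: measurable_brownian_sum.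
have H0 xi y : (0 <= \int[P]_w F (y * a xi + brownian_sum B h (c xi) K w)%R)%E.
  exact: integral_ge0.
transitivity (\sum_xi \int[law Y0']_y (P [set w | finite_path X h N w = xi] *
     \int[P]_w F (y * a xi + brownian_sum B h (c xi) K w)%R))%E.
  apply: eq_bigr => xi _; rewrite -pathE ge0_integralZl//.
  congr (_ * _)%E; apply: eq_integral => y _.
  exact/esym/(eq_brownian_sum_law _ _ BM BM' h0 (mG xi y)).
rewrite -ge0_integral_sum//.
- apply: eq_integral => y _.
  pose Z : {RV P >-> R} := HB.pack (cst y : T -> R)
    (isMeasurableFun.Build _ _ _ _ _ (measurable_cst y)).
  rewrite (path_expectation (Y0 := Z) mX h0 (preimage_cst_indep indep) mF F0).
  apply: eq_bigr => xi _; congr (_ * _)%E.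
  rewrite ge0_integral_distribution//=.
  by rewrite integral_prob_cst.
- by move=> xi; apply: emeasurable_funM.
- by move=> xi y _; rewrite mule_ge0.
Qed.

End path_expectation.

(** * Moments of the damping factor *)

Lemma limn_einf_le {R : realType} (u : nat -> \bar R) (c : \bar R) :
  (\forall n \near \oo, (u n <= c)%E) -> (limn_einf u <= c)%E.
Proof.
move=> [N _ Nu]; rewrite limn_einf_lim; apply: lime_le.
  exact: is_cvg_einfs.
apply: nearW => k; rewrite (@le_trans _ _ (u (maxn k N)))//.
  by apply: ereal_inf_lbound; exists (maxn k N) => //=; exact: leq_maxl.
by apply: Nu; exact: leq_maxr.
Qed.

(** The bound is asked for large [n] only, because the estimate on the tilted kernel holds for small
    steps. *)
Lemma fatou_ae {d} {T : measurableType d} {R : realType} (P : probability T R)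
    (f : nat -> T -> R) (g : T -> R) (c : \bar R) :
  (forall n, measurable_fun setT (f n)) -> measurable_fun setT g ->
  (forall n w, 0 <= f n w) -> (forall w, 0 <= g w) ->
  {ae P, forall w, f n w @[n --> \oo] --> g w} ->
  (\forall n \near \oo, (\int[P]_w (f n w)%:E <= c)%E) ->
  (\int[P]_w (g w)%:E <= c)%E.
Proof.
move=> mf mg f0 g0 fg fc.
have mfE n : measurable_fun setT (EFin \o f n) by exact/measurable_EFinP.
have minf : measurable_fun setT (fun w => limn_einf (fun n => (f n w)%:E)).
  rewrite (_ : (fun w => _) =
      (fun w => - limn_esup (fun n => - (f n w)%:E))%E)//.
  apply: measurableT_comp => //; apply: measurable_fun_limn_esup => n.
  by under eq_fun do rewrite -EFinN; exact/measurable_EFinP/measurableT_comp.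
rewrite (@ae_eq_integral _ _ _ P setT (fun w => limn_einf (fun n => (f n w)%:E)))//.
- apply: le_trans (limn_einf_le fc); apply: fatou => // n w _.
  by rewrite lee_fin.
- exact/measurable_EFinP.
apply: filterS fg => w fgw _.
have fgw' : (f n w)%:E @[n --> \oo] --> (g w)%:E by apply: cvg_EFin => //; exact: nearW.
by rewrite is_cvg_limn_einfE; [exact/esym/cvg_lim|apply/cvg_ex; exists (g w)%:E].
Qed.

Lemma integral_finite_valued {d} {T : measurableType d} {R : realType}
    (P : probability T R) (J : finType) (z : T -> J) (g : J -> R) :
  (forall j, measurable [set w | z w = j]) -> (forall j, 0 <= g j) ->
  (\int[P]_w (g (z w))%:E = \sum_j (g j)%:E * P [set w | z w = j])%E.
Proof.
move=> mz g0.
transitivity (\int[P]_w \sum_j ((g j)%:E * (\1_[set w | z w = j] w)%:E))%E.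
  apply: eq_integral => w _; rewrite (bigD1 (z w))//= indicE mem_set// mule1.
  rewrite big1 ?adde0// => j jw; rewrite indicE memNset ?mule0//= => wj.
  by rewrite wj eqxx in jw.
have mi j : measurable_fun setT (fun w => (\1_[set w | z w = j] w)%:E : \bar R).
  by apply/measurable_EFinP; exact: measurable_indic.
rewrite ge0_integral_sum//.
- apply: eq_bigr => j _; rewrite ge0_integralZl//.
  + by rewrite integral_indic// setIT.
  + by rewrite lee_fin.
- by move=> j; exact: measurable_funeM.
- by move=> j w _; rewrite mule_ge0// lee_fin.
Qed.

Section tilt.
Context {R : realType} {d : nat}.

(** Exponential of minus a Riemann sum of [lambda] along the path, kept as a product so that the
    Markov property peels off one factor at a time. *)
Definition tilt (lambda : 'I_d -> R) (h : R) (xi : nat -> 'I_d) (k : nat) : R :=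
  \prod_(i < k) expR (- (h * lambda (xi i))).

Lemma tilt_ge0 lambda h xi k : 0 <= tilt lambda h xi k.
Proof. by apply: prodr_ge0 => i _; exact: expR_ge0. Qed.

Lemma eq_tilt lambda h xi xi' k : (forall i, (i < k)%N -> xi i = xi' i) ->
  tilt lambda h xi k = tilt lambda h xi' k.
Proof. by move=> e; apply: eq_bigr => i _; rewrite e. Qed.

Section one.
Context {disp : measure_display} {T : measurableType disp} (P : probability T R).
Variables (X : R -> T -> 'I_d) (Q : R -> 'M[R]_d).
Hypothesis mX : forall t : R, 0 <= t -> forall x, measurable [set w | X t w = x].
Hypothesis markov : forall s t : R, 0 <= s -> 0 <= t -> forall x y E,
   sigma_of `[0, s] [set: set 'I_d] X E ->
   P (E `&` [set w | X s w = x] `&` [set w | X (s + t) w = y]) =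
   (P (E `&` [set w | X s w = x]) * (Q t x y)%:E)%E.
Variables (lambda u : 'I_d -> R) (h theta : R).
Hypothesis h0 : 0 < h.
Hypothesis u0 : forall x, 0 < u x.
Hypothesis Qtheta : forall x,
  expR (- (h * lambda x)) * \sum_y Q h x y * u y <= theta * u x.
Hypothesis theta0 : 0 <= theta.

Let path w := fun k : nat => X (k%:R * h) w.

(** Given the path up to [k], the factor at time [k] and the next transition act on [u] through the
    tilted kernel, for which [u] is a supersolution with factor [theta]. *)
Lemma tilt_step k :
  (\int[P]_w (tilt lambda h (path w) k.+1 * u (path w k.+1))%:E <=
   theta%:E * \int[P]_w (tilt lambda h (path w) k * u (path w k))%:E)%E.
Proof.
have kh0 i : 0 <= i%:R * h by rewrite mulr_ge0// ltW.
pose E := fun xi : {ffun 'I_k.+1 -> 'I_d} => [set w | finite_path X h k w = xi].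
have mE xi : measurable (E xi) by exact: measurable_path_event_finite.
have PE xi : P (E xi) = (fine (P (E xi)))%:E by rewrite fineK// fin_num_measure.
have -> : (\int[P]_w (tilt lambda h (path w) k * u (path w k))%:E =
    (\sum_xi (tilt lambda h (extend_path xi) k * u (extend_path xi k)) *
      fine (P (E xi)))%:E)%E.
  transitivity (\int[P]_w (tilt lambda h (extend_path (finite_path X h k w)) k *
      u (extend_path (finite_path X h k w) k))%:E)%E.
    apply: eq_integral => w _; rewrite extend_finite_path//.
    congr (_ * _)%:E; apply: eq_tilt => i ik.
    by rewrite extend_finite_path// ltnW.
  rewrite (integral_finite_valued _ (z := finite_path X h k)
    (g := fun xi => tilt lambda h (extend_path xi) k * u (extend_path xi k)))//.
    by rewrite -sumEFin; apply: eq_bigr => xi _; rewrite [RHS]EFinM -PE.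
  by move=> xi; rewrite mulr_ge0 ?tilt_ge0// ltW.
have -> : (\int[P]_w (tilt lambda h (path w) k.+1 * u (path w k.+1))%:E =
    (\sum_xi \sum_y (tilt lambda h (extend_path xi) k.+1 * u y) *
      (fine (P (E xi)) * Q h (extend_path xi k) y))%:E)%E.
  transitivity (\int[P]_w (tilt lambda h (extend_path (finite_path X h k w)) k.+1 *
      u (path w k.+1))%:E)%E.
    apply: eq_integral => w _; congr (_ * _)%:E; apply: eq_tilt => i ik.
    by rewrite extend_finite_path.
  have EyE xi y : [set w | (finite_path X h k w, path w k.+1) = (xi, y)] =
      E xi `&` [set w | X (k.+1%:R * h) w = y].
    by apply/seteqP; split => w /=; [case=> <- <-|case=> <- <-].
  rewrite (integral_finite_valued _
    (J := ({ffun 'I_k.+1 -> 'I_d} * 'I_d)%type)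
    (z := fun w => (finite_path X h k w, path w k.+1))
    (g := fun z => tilt lambda h (extend_path z.1) k.+1 * u z.2))//.
  - rewrite -sumEFin; under [RHS]eq_bigr do rewrite -sumEFin.
    rewrite pair_bigA; apply: eq_bigr => -[xi y] _ /=.
    rewrite [RHS]EFinM; congr (_ * _)%E; rewrite EyE EFinM -PE /E finite_path_event.
    exact: (path_law_step (ltW h0) _ _ _ markov).
  - by move=> [xi y]; rewrite EyE; apply: measurableI => //; exact: mX.
  - by move=> z; rewrite mulr_ge0 ?tilt_ge0// ltW.
rewrite -EFinM lee_fin mulr_sumr; apply: ler_sum => xi _.
have -> : \sum_y tilt lambda h (extend_path xi) k.+1 * u y *
      (fine (P (E xi)) * Q h (extend_path xi k) y) =
    tilt lambda h (extend_path xi) k * fine (P (E xi)) *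
    (expR (- (h * lambda (extend_path xi k))) *
     \sum_y Q h (extend_path xi k) y * u y).
  rewrite !mulr_sumr; apply: eq_bigr => y _.
  by rewrite /tilt big_ord_recr/=; ring.
rewrite (le_trans (ler_wpM2l _ (Qtheta _)))//.
  by rewrite mulr_ge0 ?tilt_ge0// fine_ge0.
by rewrite le_eqVlt; apply/orP; left; apply/eqP; ring.
Qed.

(** Inserting [u] at time [k] costs [1 / m] and removing it at time 0 costs [M], whatever the number
    of steps. *)
Lemma tilt_le k m M : 0 < m -> (forall x, m <= u x <= M) ->
  (\int[P]_w (tilt lambda h (path w) k)%:E <= (M / m * theta ^+ k)%:E)%E.
Proof.
move=> m0 umM.
have kh0 i : 0 <= i%:R * h by rewrite mulr_ge0// ltW.
have mt i : measurable_fun setT (fun w => tilt lambda h (path w) i).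
  apply: measurable_prod => j _.
  exact: (measurable_comp_state mX (fun x => expR (- (h * lambda x))) (kh0 j)).
have mu i : measurable_fun setT (fun w => u (path w i)).
  exact: (measurable_comp_state mX u (kh0 i)).
have bound i : (\int[P]_w (tilt lambda h (path w) i * u (path w i))%:E <=
    (theta ^+ i * M)%:E)%E.
  elim: i => [|i IH].
    rewrite expr0 mul1r -[leRHS](integral_prob_cst P); apply: ge0_le_integral => //.
    - by move=> w _; rewrite lee_fin mulr_ge0 ?tilt_ge0// ltW.
    - exact/measurable_EFinP/measurable_funM.
    - by move=> w _; rewrite lee_fin /tilt big_ord0 mul1r; case/andP: (umM (path w 0%N)).
  by rewrite (le_trans (tilt_step i))// exprS -mulrA EFinM lee_wpmul2l.
apply: (@le_trans _ _ (\int[P]_w ((m^-1)%:E * (tilt lambda h (path w) k * u (path w k))%:E))%E).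
  apply: ge0_le_integral => //.
  - by move=> w _; rewrite lee_fin tilt_ge0.
  - exact/measurable_EFinP.
  - by apply: measurable_funeM; exact/measurable_EFinP/measurable_funM.
  - move=> w _; rewrite -EFinM lee_fin mulrC -mulrA ler_peMr ?tilt_ge0//.
    by rewrite ler_pdivlMr// mul1r; case/andP: (umM (path w k)).
rewrite ge0_integralZl//.
- apply: (le_trans (lee_wpmul2l _ (bound k))); first by rewrite lee_fin invr_ge0 ltW.
  by rewrite -EFinM lee_fin le_eqVlt; apply/orP; left; apply/eqP; ring.
- exact/measurable_EFinP/measurable_funM.
- by move=> w _; rewrite lee_fin mulr_ge0 ?tilt_ge0// ltW.
- by rewrite lee_fin invr_ge0 ltW.
Qed.

End one.

(* Since [1 + x <= exp x], the first order expansion of [Q h] suffices. *)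
Lemma tilted_kernel_le (Q : R -> 'M[R]_d) (A : 'M[R]_d) (lambda u : 'I_d -> R) (r s : R) :
  infinitesimal_generator Q A -> (forall x, 0 < u x) ->
  (forall x, \sum_y A x y * u y - lambda x * u x = r * u x) -> r < s ->
  \forall h \near 0^'+, forall x,
    expR (- (h * lambda x)) * \sum_y Q h x y * u y <= expR (h * s) * u x.
Proof.
move=> gQ u0 Au rs; apply: filter_forall => x.
have cv : \sum_y (Q h x y - (x == y)%:R) / h * u y @[h --> 0^'+] -->
    \sum_y A x y * u y.
  by apply: cvg_bigsum => y; apply: cvgMr_tmp; exact: gQ.
have lt : \sum_y A x y * u y < (s + lambda x) * u x.
  have -> : \sum_y A x y * u y = (r + lambda x) * u x.
    by rewrite mulrDl -Au; ring.
  by rewrite ltr_pM2r// ltrD2r.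
have cvlt : \forall h \near 0^'+, \sum_y (Q h x y - (x == y)%:R) / h * u y <
  (s + lambda x) * u x by exact: cvgr_lt cv _ lt.
near=> h.
have lth : \sum_y (Q h x y - (x == y)%:R) / h * u y < (s + lambda x) * u x.
  by near: h.
have h0 : 0 < h by near: h; exact: nbhs_right_gt.
have Qu : \sum_y Q h x y * u y <= expR (h * (s + lambda x)) * u x.
  have {lth} : \sum_y Q h x y * u y - u x <= h * ((s + lambda x) * u x).
    have -> : \sum_y Q h x y * u y - u x =
        h * \sum_y (Q h x y - (x == y)%:R) / h * u y.
      have ue : u x = \sum_y (x == y)%:R * u y.
        by rewrite (bigD1 x)//= eqxx mul1r big1 ?addr0// => y; rewrite eq_sym => /negPf ->; rewrite mul0r.
      rewrite [X in _ - X]ue -sumrB mulr_sumr; apply: eq_bigr => y _.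
      by field; rewrite gt_eqF.
    by rewrite ler_pM2l// ltW//.
  rewrite lerBlDr => /le_trans; apply.
  rewrite -[X in _ + X]mul1r mulrA -mulrDl ler_pM2r// addrC.
  exact: expR_ge1Dx.
rewrite (le_trans (ler_wpM2l (expR_ge0 _) Qu))// mulrA -expRD ler_pM2r//.
by rewrite ler_expR; lra.
Unshelve. all: end_near. Qed.

(** [M ^ p] is almost surely the limit of the tilts for [p * lambda], whose expectations the Perron
    vector bounds by [C exp (s t)] once the mesh is small. [C] is chosen before the space and the
    time. *)
Lemma damping_moment (A : 'M[R]_d) (lambda : 'I_d -> R) (p : R) :
  (2 <= d)%N -> generator_matrix A -> irreducible_chain (embedded_chain A) ->
  exists2 C : R, 1 <= C & forall (disp : measure_display) (T : measurableType disp)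
    (P : probability T R) (X : R -> T -> 'I_d) (t : R) (M : {RV P >-> R}),
    markov_process P A X -> 0 < t ->
    {ae P, forall w, M w =
       expR (- \int[lebesgue_measure]_(u in `[0, t]) lambda (X u w))} ->
    (\int[P]_w (M w `^ p)%:E <= (C * expR (- eta A lambda p * t))%:E)%E.
Proof.
move=> d2 gA iA; have [r [u [u0 Au reta]]] := perron_generator lambda p d2 gA iA.
(* [1 / I] and [S] are crude lower and upper bounds of [u]; their ratio [S * I] is the constant. *)
pose S := \sum_x u x; pose I := \sum_x (u x)^-1.
have uS x : u x <= S.
  by rewrite /S (bigD1 x)//= lerDl sumr_ge0// => y _; exact: ltW.
have uI x : (u x)^-1 <= I.
  by rewrite /I (bigD1 x)//= lerDl sumr_ge0// => y _; rewrite invr_ge0 ltW.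
pose x0 : 'I_d := Ordinal (ltnW d2).
have I0 : 0 < I by rewrite (lt_le_trans _ (uI x0))// invr_gt0.
have umM x : I^-1 <= u x <= S.
  by rewrite uS andbT -[leRHS]invrK lef_pV2// posrE ?invr_gt0.
exists (S * I).
  have /andP[h1 h2] := umM x0.
  by rewrite -ler_pdivrMr// mul1r (le_trans h1).
move=> disp T P X t M [mX cadX [Q [_ gQ mQ]]] t0 ME.
have SI0 : 0 <= S * I.
  by rewrite mulr_ge0// ?ltW// (lt_le_trans _ (uS x0)).
(* A strict inequality absorbs the remainder of the expansion at 0; the prefactor is free of [s],
   which decreases to [r] at the end. *)
have step s : r < s -> (\int[P]_w (M w `^ p)%:E <= (S * I * expR (s * t))%:E)%E.
  move=> rs.
  have kh0 n i : 0 <= i%:R * mesh t n by rewrite mulr_ge0// ltW// mesh_gt0.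
  have hl : \forall n \near \oo, forall x,
      expR (- (mesh t n * (p * lambda x))) * \sum_y Q (mesh t n) x y * u y <=
      expR (mesh t n * s) * u x.
    have := @tilted_kernel_le Q A (fun x => p * lambda x) u r s gQ u0 Au rs.
    exact: (cvg_mesh_right t0).
  apply: (@fatou_ae _ _ _ P (fun n w =>
    tilt (fun x => p * lambda x) (mesh t n) (fun k => X (k%:R * mesh t n) w) n.+1)).
  - move=> n; apply: measurable_prod => j _.
    exact: (measurable_comp_state mX
      (fun x => expR (- (mesh t n * (p * lambda x)))) (kh0 n j)).
  - exact: (measurableT_comp (measurable_powR p)).
  - by move=> n w; exact: tilt_ge0.
  - by move=> w; exact: powR_ge0.
  - apply: filterS2 cadX ME => w cadw ->.
    rewrite -expRM mulNr.
    have -> : (fun n => tilt (fun x => p * lambda x) (mesh t n)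
        (fun k => X (k%:R * mesh t n) w) n.+1) =
      (fun n => expR (- (\sum_(k < n.+1) mesh t n * lambda (X (k%:R * mesh t n) w) * p))).
      apply/funext => n; rewrite /tilt -expR_sum; congr expR.
      by rewrite -sumrN; apply: eq_bigr => k _; ring.
    apply: continuous_cvg; first exact: continuous_expR.
    apply: cvgN; under eq_fun do rewrite -mulr_suml.
    by apply: cvgMr_tmp; exact: riemann_sum_cvg.
  apply: filterS hl => n hn.
  have := @tilt_le _ _ P X Q mX mQ (fun x => p * lambda x) u (mesh t n)
    (expR (mesh t n * s)) (mesh_gt0 n t0) u0 hn
    (expR_ge0 _) n.+1 I^-1 S (_ : 0 < I^-1) umM.
  rewrite invr_gt0 => /(_ I0) /le_trans; apply; rewrite invrK lee_fin.
  by rewrite -expRM_natl mulrA meshE [t * s]mulrC.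
apply/lee_addgt0Pr => e e0.
have cv : S * I * expR (s * t) @[s --> r^'+] --> S * I * expR (r * t).
  apply: cvgMl_tmp; apply: continuous_cvg; first exact: continuous_expR.
  by apply: cvgMr_tmp; exact: cvg_at_right_filter.
have [s rs sle] : exists2 s, r < s & S * I * expR (s * t) < S * I * expR (r * t) + e.
  have cve : \forall s \near r^'+, S * I * expR (s * t) < S * I * expR (r * t) + e.
    apply: (cvgr_lt _ cv (S * I * expR (r * t) + e)); by rewrite ltrDl.
  near r^'+ => s.
  exists s; near: s; first exact: nbhs_right_gt.
  exact: cve.
rewrite (le_trans (step s rs))// -EFinD lee_fin (le_trans (ltW sle))// lerD2r.
by rewrite ler_wpM2l// ler_expR ler_wpM2r// ltW.
Unshelve. all: end_near. Qed.

End tilt.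

(** * Affine representation of the laws *)

Section L1_limits.
Context {d} {T : measurableType d} {R : realType} (P : probability T R).

Lemma cvge0_sum (N : nat) (u : nat -> nat -> \bar R) :
  (forall i, (i < N)%N -> u i n @[n --> \oo] --> 0%E) ->
  (\sum_(i < N) u i n)%E @[n --> \oo] --> 0%E.
Proof.
elim: N => [|N IH] u0; first by under eq_fun do rewrite big_ord0; exact: cvg_cst.
rewrite (_ : (fun n => _) = (fun n => \sum_(i < N) u i n + u N n)%E); last first.
  by apply/funext => n; rewrite big_ord_recr.
rewrite -[X in _ --> X](adde0 0%E); apply: cvgeD => //; last exact: u0.
by apply: IH => i iN; apply: u0; exact: leqW.
Qed.

Lemma L2_L1_cvg (g : nat -> T -> R) : (forall n, measurable_fun setT (g n)) ->
  (\int[P]_w (g n w ^+ 2)%:E)%E @[n --> \oo] --> 0%E ->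
  (\int[P]_w (`|g n w|)%:E)%E @[n --> \oo] --> 0%E.
Proof.
move=> mg g2; apply: ge0_cvge0 => [n|e e0].
  by apply: integral_ge0 => w _; rewrite lee_fin.
have e4 : 0 < e ^+ 2 / 4 by rewrite divr_gt0 ?exprn_gt0.
have := cvge0_le e4 g2; apply: filterS => n gn.
(* Pointwise [|g| <= e / 2 + g^2 / e], by completing the square; with the second moment below
   [e^2 / 4] the total is at most [3 e / 4]. *)
apply: (@le_trans _ _ (\int[P]_w ((e / 2)%:E + (e^-1)%:E * (g n w ^+ 2)%:E))%E).
  apply: ge0_le_integral_nonmeasurable => w; first by rewrite lee_fin.
  rewrite -EFinM -EFinD lee_fin -[g n w ^+ 2]real_normK ?num_real//.
  have := sqr_ge0 (`|g n w| - e / 2); rewrite sqrrB => h.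
  have e1 : e / 2 + e^-1 * `|g n w| ^+ 2 - `|g n w| =
      e^-1 * (`|g n w| ^+ 2 - `|g n w| * (e / 2) *+ 2 + (e / 2) ^+ 2) + e / 4.
    by field; rewrite gt_eqF.
  rewrite -subr_ge0 e1 addr_ge0 ?mulr_ge0 ?invr_ge0 ?(ltW e0)//.
have mg2 : measurable_fun setT (fun w => (g n w ^+ 2)%:E).
  by apply/measurable_EFinP; exact: measurable_funX.
rewrite ge0_integralD//; last 3 first.
- by move=> w _; rewrite lee_fin divr_ge0// ltW.
- by move=> w _; rewrite mule_ge0// lee_fin ?sqr_ge0// invr_ge0 ltW.
- exact: measurable_funeM.
rewrite integral_prob_cst ge0_integralZl//; last 2 first.
- by move=> w _; rewrite lee_fin sqr_ge0.
- by rewrite lee_fin invr_ge0 ltW.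
have ei : (0 <= (e^-1)%:E)%E by rewrite lee_fin invr_ge0 ltW.
rewrite (le_trans (leeD2l _ (lee_wpmul2l ei gn)))// -EFinM -EFinD lee_fin.
rewrite (_ : e^-1 * (e ^+ 2 / 4) = e / 4); last by field; rewrite gt_eqF.
by lra.
Qed.

End L1_limits.

Section blocks.
Context {R : realType}.
Implicit Types rho D : nat -> R.

Lemma eq_scheme rho rho' D D' y q :
  (forall k, (k < q)%N -> rho k = rho' k) -> (forall k, (k < q)%N -> D k = D' k) ->
  scheme rho D y q = scheme rho' D' y q.
Proof.
elim: q => [//|q IH] e e' /=; rewrite IH ?e ?e'// => k kq.
  by apply: e; exact: leqW.
by apply: e'; exact: leqW.
Qed.

Lemma block_sum (m n q : nat) (b : nat -> R) : (q < n)%N ->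
  \sum_(k < n * m.+1) b k * ((k %/ m.+1)%N == q)%:R =
  \sum_(k < q.+1 * m.+1) b k - \sum_(k < q * m.+1) b k.
Proof.
move=> qn.
have widen j : (j <= n)%N -> \sum_(k < j * m.+1) b k =
    \sum_(k < n * m.+1) b k * (k < j * m.+1)%N%:R.
  move=> jn; rewrite (big_ord_widen (n * m.+1) b) ?leq_mul2r ?jn ?orbT//.
  rewrite big_mkcond; apply: eq_bigr => k _.
  by case: ifP => _; rewrite ?mulr1 ?mulr0.
rewrite !widen ?(ltnW qn)// -sumrB; apply: eq_bigr => k _; rewrite -mulrBr.
congr (_ * _); rewrite -!ltn_divLR// ltnS [(k %/ m.+1 <= q)%N]leq_eqVlt.
by case: ltngtP => //= _; rewrite ?subrr ?subr0.
Qed.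

(** Each of the [n.+1] coarse steps holds [m.+1] fine ones, so fine index [q * m.+1] is coarse time
    [q]. *)
Definition coarse_damping {d} (lambda : 'I_d -> R) (t : R) (n m : nat)
    (xi : nat -> 'I_d) (q : nat) : R :=
  expR (- (mesh t n * lambda (xi (q * m.+1)%N))).

Definition scheme_factor {d} (lambda : 'I_d -> R) (t : R) (n m : nat)
    (xi : nat -> 'I_d) : R :=
  \prod_(q < n.+1) coarse_damping lambda t n m xi q.

(** Weight of the fine increment [k] in the final value: [sigma] at its left end, damped over the
    coarse steps after the one containing it. Feeding the scheme with the indicator of that step
    produces this product. *)
Definition scheme_coef {d} (lambda sigma : 'I_d -> R) (t : R) (n m : nat)
    (xi : nat -> 'I_d) (k : nat) : R :=
  scheme (coarse_damping lambda t n m xi)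
    (fun q => sigma (xi k) * ((k %/ m.+1)%N == q)%:R) 0 n.+1.

(** By linearity of the scheme in its increments, the nested recursion is a plain weighted sum of
    Brownian increments, to which [path_expectation] applies. *)
Lemma scheme_coefE {d} (lambda sigma : 'I_d -> R) t n m xi (b : nat -> R) :
  \sum_(k < n.+1 * m.+1) scheme_coef lambda sigma t n m xi k * b k =
  scheme (coarse_damping lambda t n m xi)
    (fun q => \sum_(k < q.+1 * m.+1) sigma (xi k) * b k -
              \sum_(k < q * m.+1) sigma (xi k) * b k) 0 n.+1.
Proof.
under eq_bigr do rewrite mulrC.
rewrite -(scheme_sum _ _ (fun k : 'I_(n.+1 * m.+1) => b k)
  (fun k q => sigma (xi k) * ((k %/ m.+1)%N == q)%:R)).
apply: eq_scheme => // q qn; rewrite -(block_sum _ (fun k => sigma (xi k) * b k) qn).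
by apply: eq_bigr => k _; ring.
Qed.

Lemma mesh_mesh (t : R) n m q : (q * m.+1)%:R * mesh (mesh t n) m = q%:R * mesh t n.
Proof. by rewrite natrM -mulrA meshE. Qed.

End blocks.

Section approximation.
Context {R : realType} {disp : measure_display} {T : measurableType disp}.
Context {d : nat} (P : probability T R).
Variables (X : R -> T -> 'I_d) (B Y : R -> {RV P >-> R}).
Variables (A : 'M[R]_d) (lambda sigma : 'I_d -> R) (t : R).
Hypothesis t0 : 0 < t.

Let fine_path n m w := extend_path (finite_path X (mesh (mesh t n) m) (n.+1 * m.+1) w).

Lemma fine_pathE n m w k : (k <= n.+1 * m.+1)%N ->
  fine_path n m w k = X (k%:R * mesh (mesh t n) m) w.
Proof. exact: extend_finite_path. Qed.

Lemma coarse_dampingE n m w q : (q <= n.+1)%N ->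
  coarse_damping lambda t n m (fine_path n m w) q =
  expR (- (mesh t n * lambda (X (q%:R * mesh t n) w))).
Proof.
by move=> qn; rewrite /coarse_damping fine_pathE ?mesh_mesh// leq_mul2r qn orbT.
Qed.

(** The affine decomposition holds by the very choice of [S]. The content is that [M] and [S] are
    limits of functionals of [X] and [B]: exactly sampled products for [M], and for [S] an L1 limit
    in [m] followed by an almost sure limit in [n]. *)
Lemma affine_approximation : switched_model A lambda sigma X B Y ->
  exists (M S : {RV P >-> R}) (Mn Sn : nat -> {RV P >-> R}),
  [/\ {ae P, forall w, M w =
        expR (- \int[lebesgue_measure]_(u in `[0, t]) lambda (X u w))},
      forall w, Y t w = Y 0 w * M w + S w,
      {ae P, forall w, Mn n w @[n --> \oo] --> M w},
      {ae P, forall w, Sn n w @[n --> \oo] --> S w} &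
      forall n, (forall m w, scheme_factor lambda t n m (fine_path n m w) = Mn n w) /\
        (\int[P]_w (`|Sn n w - brownian_sum B (mesh (mesh t n) m)
          (scheme_coef lambda sigma t n m (fine_path n m w)) (n.+1 * m.+1) w|)%:E)%E
          @[m --> \oo] --> 0%E].
Proof.
move=> [[mX cadX _] BM indep [cY sdeY]].
have kh0 n k : 0 <= k%:R * mesh t n by rewrite mulr_ge0// ltW// mesh_gt0.
pose ito (s : R) (J : {RV P >-> R}) := 0 <= s ->
    is_ito_integral (driving_filtration X B (Y 0)) B (fun u w => sigma (X u w)) s J /\
    {ae P, forall w, Y s w =
       Y 0 w - (\int[lebesgue_measure]_(u in `[0, s]) (lambda (X u w) * Y u w)) + J w}.
(* One version of the Ito integral is fixed for every time; at negative times, which never occur,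
   [Y 0] is a placeholder. *)
have /boolp.choice[I HI] : forall s, exists J, ito s J.
  move=> s; have [s0|s0] := leP 0 s; first by have [J HJ] := sdeY s s0; exists J.
  by exists (Y 0); rewrite /ito leNgt s0.
pose rho n w q := expR (- (mesh t n * lambda (X (q%:R * mesh t n) w))).
pose dI n w q := I (q.+1%:R * mesh t n) w - I (q%:R * mesh t n) w.
have mrho n q : measurable_fun setT (fun w => rho n w q).
  exact: (measurable_comp_state mX (fun x => expR (- (mesh t n * lambda x))) (kh0 n q)).
have mMn n : measurable_fun setT (fun w => \prod_(q < n.+1) rho n w q).
  by apply: measurable_prod => q _; exact: mrho.
have mSn n : measurable_fun setT (fun w => scheme (rho n w) (dI n w) 0 n.+1).
  elim: n.+1 => [|q IH]; first exact: measurable_cst.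
  apply: measurable_funD; first exact: measurable_funM.
  exact: measurable_funB.
pose Mn n : {RV P >-> R} := HB.pack (fun w => \prod_(q < n.+1) rho n w q)
  (isMeasurableFun.Build _ _ _ _ _ (mMn n)).
pose Sn n : {RV P >-> R} := HB.pack (fun w => scheme (rho n w) (dI n w) 0 n.+1)
  (isMeasurableFun.Build _ _ _ _ _ (mSn n)).
have mM : measurable_fun setT (fun w => fine (limn_esup (fun n => (Mn n w)%:E))).
  apply: measurableT_comp => //; apply: measurable_fun_limn_esup => n.
  exact/measurable_EFinP.
(* The exponential of the integral need not be measurable off the cadlag paths,
   hence the upper limit. *)
pose M : {RV P >-> R} := HB.pack (fun w => fine (limn_esup (fun n => (Mn n w)%:E)))
  (isMeasurableFun.Build _ _ _ _ _ mM).
have mS : measurable_fun setT (fun w => Y t w - Y 0 w * M w).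
  by apply: measurable_funB => //; exact: measurable_funM.
pose S : {RV P >-> R} := HB.pack (fun w => Y t w - Y 0 w * M w)
  (isMeasurableFun.Build _ _ _ _ _ mS).
pose L w := \int[lebesgue_measure]_(u in `[0, t]) lambda (X u w).
have cvM : {ae P, forall w, Mn n w @[n --> \oo] --> expR (- L w)}.
  apply: filterS cadX => w cadw.
  have -> : (fun n => Mn n w) =
      (fun n => expR (- (\sum_(k < n.+1) mesh t n * lambda (X (k%:R * mesh t n) w)))).
    by apply/funext => n; rewrite /Mn/= /rho -expR_sum -sumrN.
  apply: continuous_cvg; first exact: continuous_expR.
  by apply: cvgN; exact: riemann_sum_cvg.
have ME : {ae P, forall w, M w = expR (- L w)}.
  apply: filterS cvM => w cvw.
  have cvw' : (Mn n w)%:E @[n --> \oo] --> (expR (- L w))%:E.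
    by apply: cvg_EFin => //; exact: nearW.
  by have [_ e] := cvg_limn_einf_sup cvw'; rewrite /M/= e.
have cvS : {ae P, forall w, Sn n w @[n --> \oo] --> S w}.
  (* The equation holds almost surely at each time; the grid times being countably many, one null
     set serves for all of them. *)
  have aeY : {ae P, forall w, forall n k, Y (k%:R * mesh t n) w =
       Y 0 w - (\int[lebesgue_measure]_(u in `[0, k%:R * mesh t n]) (lambda (X u w) * Y u w))
       + I (k%:R * mesh t n) w}.
    by apply: ae_foralln => n; apply: ae_foralln => k; have [] := HI _ (kh0 n k).
  apply: filterS3 (filterI cadX ME) (filterI cvM cY) aeY => w [cadw Mw] [cMw cYw] Yw.
  have := @scheme_cvg R d (X ^~ w) t t0 cadw lambda (Y ^~ w) (I ^~ w) cYw
    (fun n k _ => Yw n k).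
  move=> cv; have -> : S w = Y t w - Y 0 w * expR (- L w) by rewrite -Mw.
  have -> : (fun n => Sn n w) = (fun n => scheme (rho n w) (dI n w) (Y 0 w) n.+1 -
      Y 0 w * Mn n w).
    by apply/funext => n; rewrite [in RHS]schemeE addrAC subrr add0r.
  by apply: cvgB => //; apply: cvgMl_tmp.
exists M, S, Mn, Sn; split => //.
- by move=> w; rewrite /S/= addrC subrK.
- by apply: filterS2 cvM ME => w cvw ->.
move=> n; split=> [m w|].
  by apply: eq_bigr => q _; rewrite coarse_dampingE// ltnW.
(* [G] is the fine Riemann sum up to coarse time [q], and [D] its error; at fixed [n], finitely many
   of these errors control the scheme by linearity. *)
pose G m q w := \sum_(k < q * m.+1) sigma (fine_path n m w k) *
  increment B (k%:R * mesh (mesh t n) m) (k.+1%:R * mesh (mesh t n) m) w.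
pose D m q w := I (q%:R * mesh t n) w - G m q w.
have mD m q : (q <= n.+1)%N -> measurable_fun setT (D m q).
  move=> qn; apply: measurable_funB => //; apply: measurable_sum => k.
  have km : (k <= n.+1 * m.+1)%N.
    by rewrite (leq_trans (ltnW (ltn_ord k)))// leq_mul2r qn orbT.
  under eq_fun do rewrite fine_pathE//.
  apply: measurable_funM; last exact: measurable_increment.
  have dk : 0 <= k%:R * mesh (mesh t n) m.
    by rewrite mulr_ge0// ltW// mesh_gt0// mesh_gt0.
  exact: (measurable_comp_state mX sigma dk).
have Dcv q : (q <= n.+1)%N -> (\int[P]_w (`|D m q w|)%:E)%E @[m --> \oo] --> 0%E.
  case: q => [|q] qn.
    (* At time 0, outside the reach of [ito_grid_L2], the equation itself forces [I 0 = 0] almost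
       surely. *)
    rewrite (_ : (fun m => _) = cst 0%E); first exact: cvg_cst.
    apply/funext => m; rewrite -[RHS](integral_prob_cst P).
    apply: ae_eq_integral => //.
      by apply/measurable_EFinP; apply: measurableT_comp => //; exact: mD.
    have z : 0%:R * mesh t n = 0 by rewrite mul0r.
    have [_ +] := HI _ (kh0 n 0%N).
    apply: filterS => w; rewrite z set_itv1 Rintegral_set1 => Yw _.
    rewrite /D /G mul0n big_ord0 subr0 z (_ : I 0 w = 0) ?normr0//.
    by move: Yw; lra.
  apply: L2_L1_cvg => [m|]; first exact: mD.
  have s0 : 0 < q.+1%:R * mesh t n by rewrite mulr_gt0// mesh_gt0.
  have [Iito _] := HI _ (ltW s0).
  (* The fine grid cuts [[0, (q + 1) h]] into [q.+1 * m.+1] steps; the predecessor appears because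
     [mesh t n] divides by [n.+1]. *)
  have gE m w : grid_integral X B (q.+1%:R * mesh t n) sigma (q.+1 * m.+1).-1 w =
      G m q.+1 w.
    rewrite /grid_integral prednK ?muln_gt0//.
    have -> : mesh (q.+1%:R * mesh t n) (q.+1 * m.+1).-1 = mesh (mesh t n) m.
      rewrite /mesh prednK ?muln_gt0// natrM.
      by rewrite -mulf_div divff ?mul1r ?pnatr_eq0.
    apply: eq_bigr => k _; rewrite fine_pathE//.
    by rewrite (leq_trans (ltnW (ltn_ord k)))// leq_mul2r qn orbT.
  have cvN : (q.+1 * m.+1).-1 @[m --> \oo] --> \oo.
    apply/cvgnyPge => N; exists N => // m Nm.
    by rewrite mulSn addSn -pred_Sn (leq_trans Nm)// leq_addr.
  have := ito_grid_L2 mX cadX BM indep s0 Iito.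
  move=> /(cvg_comp _ _ cvN); apply: cvg_trans; apply: near_eq_cvg.
  by apply: nearW => m; apply: eq_integral => w _; rewrite /D -gE.
have [l l0 lL] := state_bound lambda.
pose K := expR (mesh t n * l).
have K1 : 1 <= K by rewrite -expR0 ler_expR mulr_ge0// ltW// mesh_gt0.
have K0 : 0 <= K by rewrite (le_trans ler01).
have rK w k : `|rho n w k| <= K.
  rewrite ger0_norm ?expR_ge0// ler_expR -mulrN ler_wpM2l//; first by rewrite ltW// mesh_gt0.
  by rewrite (le_trans _ (lL (X (k%:R * mesh t n) w)))// -normrN ler_norm.
have cvbound : ((K ^+ n.+1)%:E * \sum_(q < n.+1) (\int[P]_w (`|D m q.+1 w|)%:E +
    \int[P]_w (`|D m q w|)%:E))%E @[m --> \oo] --> 0%E.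
  rewrite -[X in _ --> X](mule0 (K ^+ n.+1)%:E); apply: cvgeZl => //.
  apply: (cvge0_sum (u := fun q m => (\int[P]_w (`|D m q.+1 w|)%:E +
    \int[P]_w (`|D m q w|)%:E))%E) => q qn.
  rewrite -[X in _ --> X](adde0 0%E); apply: cvgeD => //; apply: Dcv => //.
  exact: ltnW.
apply: (squeeze_cvge _ (cvg_cst 0%E) cvbound); apply: nearW => m.
rewrite integral_ge0/=; last by move=> w _; rewrite lee_fin.
have mN q : (q <= n.+1)%N -> measurable_fun setT (fun w => (`|D m q w|)%:E).
  by move=> qn; apply/measurable_EFinP; apply: measurableT_comp => //; exact: mD.
under eq_bigr => q _.
  rewrite -ge0_integralD//; last 2 first.
    + exact: mN.
    + by apply: mN; exact: ltnW.
  over.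
have mND (q : 'I_n.+1) : measurable_fun setT (fun w => (`|D m q.+1 w|)%:E + (`|D m q w|)%:E)%E.
  by apply: emeasurable_funD; apply: mN => //; exact: ltnW.
rewrite -ge0_integral_sum//; last by move=> q w _; rewrite adde_ge0// lee_fin.
rewrite -ge0_integralZl//; last 3 first.
- by apply: emeasurable_sum => q; exact: mND.
- by move=> w _; rewrite sume_ge0// => q _; rewrite adde_ge0// lee_fin.
- by rewrite lee_fin exprn_ge0.
apply: ge0_le_integral_nonmeasurable => w; first by rewrite lee_fin.
rewrite sumEFin -EFinM lee_fin.
rewrite -[X in `|X - _|]/(scheme (rho n w) (dI n w) 0 n.+1).
rewrite /brownian_sum (scheme_coefE lambda sigma t n m (fine_path n m w) (fun k =>
  increment B (k%:R * mesh (mesh t n) m) (k.+1%:R * mesh (mesh t n) m) w)).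
rewrite (_ : scheme (coarse_damping _ _ _ _ _) _ _ _ = scheme (rho n w)
   (fun q => G m q.+1 w - G m q w) 0 n.+1); last first.
  by apply: eq_scheme => // q qn; rewrite coarse_dampingE// ltnW.
rewrite scheme_diff (le_trans (scheme_bound _ _ K1 (rK w)))// ler_wpM2l ?exprn_ge0//.
apply: ler_sum => q _; rewrite (_ : _ - _ = D m q.+1 w - D m q w); last first.
  by rewrite /dI /D; ring.
exact: ler_normB.
Qed.

End approximation.

(** * Test functions and iterated limits *)

Section test_functions.
Context {R : realType}.

(** Bounded and Lipschitz, so that expectations pass both to the L1 limit in [m] and to the almost
    sure limit in [n]; nonnegative, so that Tonelli applies. *)
Definition test_function (f : R -> R) : Prop :=
  [/\ measurable_fun setT f, forall x, 0 <= f x <= 1 &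
      exists2 L, 0 <= L & forall x y, `|f x - f y| <= L * `|x - y|].

Definition ramp (x : R) (k : nat) (y : R) : R :=
  Num.max 0 (Num.min 1 (k%:R * (x - y))).

Lemma ramp_test x k : test_function (ramp x k).
Proof.
split.
- apply: measurable_maxr => //; apply: measurable_minr => //.
  by apply: measurable_funM => //; exact: measurable_funB.
- by move=> y; rewrite /ramp le_max lexx/= ge_max ler01 ge_min lexx.
exists k%:R => // y z.
have e : `|k%:R * (x - y) - k%:R * (x - z)| = k%:R * `|y - z|.
  by rewrite -mulrBr normrM ger0_norm// opprB addrC addrA subrK distrC.
rewrite -e /ramp; move: (k%:R * (x - y)) (k%:R * (x - z)) => a b.
have := ler_norm (a - b); have := ler_norm (b - a); rewrite distrC => h1 h2.
rewrite ler_norml.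
by case: (leP 1 a) => ?; case: (leP 1 b) => ?; rewrite ?(max_idPr ler01);
  case: (leP 0 a) => ?; case: (leP 0 b) => ?; apply/andP; split; lra.
Qed.

Lemma ramp_cvg x y : ramp x k y @[k --> \oo] --> (\1_`]-oo, x[ y : R).
Proof.
have [yx|xy] := ltP y x; last first.
  rewrite indicE memNset/=; last by rewrite in_itv/= ltNge xy.
  rewrite (_ : (fun k => _) = cst 0); first exact: cvg_cst.
  apply/funext => k; rewrite /ramp /=; apply/max_idPl.
  by rewrite ge_min mulr_ge0_le0 ?orbT// subr_le0.
rewrite indicE mem_set/=; last by rewrite in_itv.
apply: cvg_near_cst; have xy0 : 0 < x - y by rewrite subr_gt0.
have : \forall k \near \oo, (x - y)^-1 <= k%:R by exact: nbhs_infty_ger.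
apply: filterS => k kxy; rewrite /ramp (min_idPl _).
  exact/max_idPr.
by rewrite -ler_pdivrMr// mul1r.
Qed.

Lemma integral_test_fin {d} {T : measurableType d} (P : probability T R)
    (f : R -> R) (U : T -> R) : test_function f ->
  (\int[P]_w (f (U w))%:E)%E = (fine (\int[P]_w (f (U w))%:E))%:E.
Proof.
move=> [_ f01 _]; rewrite fineK// ge0_fin_numE; last first.
  by apply: integral_ge0 => w _; rewrite lee_fin; case/andP: (f01 (U w)).
apply: (@le_lt_trans _ _ (\int[P]__ 1)%E).
  apply: ge0_le_integral_nonmeasurable => w; rewrite lee_fin;
    by case/andP: (f01 (U w)).
by rewrite integral_prob_cst ltry.
Qed.

(** Ramps tend to the indicators of the open left rays, which with the whole line form a pi-system
    generating the Borel sets. *)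
Lemma eq_prob_test (m1 m2 : probability R R) :
  (forall f, test_function f -> (\int[m1]_y (f y)%:E = \int[m2]_y (f y)%:E)%E) ->
  forall U, measurable U -> m1 U = m2 U.
Proof.
move=> test.
pose G : set_system R := [set U | U = setT \/ exists x : R, U = `]-oo, x[%classic].
have ray (m : probability R R) x :
    (\int[m]_y (ramp x k y)%:E)%E @[k --> \oo] --> m `]-oo, x[%classic.
  have -> : m `]-oo, x[%classic = (\int[m]_y (\1_`]-oo, x[ y)%:E)%E.
    by rewrite integral_indic// setIT.
  have [|||||_ _] := @dominated_convergence _ _ R m setT measurableT
    (fun k y => (ramp x k y)%:E) (fun y => (\1_`]-oo, x[ y)%:E) (fun=> 1%E).
  - by move=> k; apply/measurable_EFinP; have [] := ramp_test x k.
  - by apply/measurable_EFinP; exact: measurable_indic.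
  - by apply: aeW => y _; apply: cvg_EFin; [exact: nearW|exact: ramp_cvg].
  - exact: finite_measure_integrable_cst.
  - apply: aeW => y k _; have [_ /(_ y)/andP[f0 f1] _] := ramp_test x k.
    by rewrite gee0_abs lee_fin.
  by [].
move=> U mU; apply: (@prob_unique _ _ R m1 m2 G).
- by move=> _ [->|[x ->]].
- move=> _ _ [->|[x ->]] [->|[y ->]].
  + by rewrite setTI; left.
  + by rewrite setTI; right; exists y.
  + by rewrite setIT; right; exists x.
  + right; exists (Num.min x y); apply/seteqP; split => z /=;
      rewrite !in_itv/= lt_min; first by move=> [-> ->].
    by move=> /andP[].
- by left.
- exact: (le_lt_trans (probability_le1 _ _) (ltry _)).
- move=> _ [->|[x ->]].
    by transitivity (1%E : \bar R); [|apply/esym]; exact: probability_setT.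
  have := ray m1 x; under eq_fun do rewrite (test _ (ramp_test x _)).
  by move=> c1; exact: cvg_unique c1 (ray m2 x).
- move: mU; rewrite [X in X -> _](_ : _ = <<s @RGenInftyO.G R >> U).
    by apply: sub_sigma_algebra2 => _ [x ->]; right; exists x.
  exact: (congr1 (fun F : set_system R => F U) (RGenInftyO.measurableE R)).
Qed.

End test_functions.

Section iterated_limits.
Context {R : realType}.

Section one.
Context {d} {T : measurableType d} (P : probability T R).
Variable f : R -> R.
Hypothesis hf : test_function f.

Lemma L1_test_cvg (Um : nat -> T -> R) (U : T -> R) :
  (forall m, measurable_fun setT (Um m)) -> measurable_fun setT U ->
  (\int[P]_w (`|U w - Um m w|)%:E)%E @[m --> \oo] --> 0%E ->
  (\int[P]_w (f (Um m w))%:E)%E @[m --> \oo] --> (\int[P]_w (f (U w))%:E)%E.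
Proof.
move=> mUm mU cU; have [mf f01 [L L0 fL]] := hf.
have step (V W : T -> R) : measurable_fun setT V -> measurable_fun setT W ->
    (\int[P]_w (f (V w))%:E <= \int[P]_w (f (W w))%:E +
      L%:E * \int[P]_w (`|V w - W w|)%:E)%E.
  move=> mV mW; have mVW : measurable_fun setT (fun w => (`|V w - W w|)%:E).
    by apply/measurable_EFinP; apply: measurableT_comp => //; exact: measurable_funB.
  have f0 w : (0 <= (f w)%:E)%E by rewrite lee_fin; case/andP: (f01 w).
  rewrite -ge0_integralZl// -ge0_integralD//.
  - apply: ge0_le_integral_nonmeasurable => // w.
    rewrite -EFinM -EFinD lee_fin -lerBlDl (le_trans (ler_norm _))//.
  - by apply/measurable_EFinP; exact: measurableT_comp.
  - by move=> w _; rewrite mule_ge0// lee_fin.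
  - exact: measurable_funeM.
rewrite (integral_test_fin P U hf).
under eq_fun do rewrite (integral_test_fin P (Um _) hf).
apply: cvg_EFin; first exact: nearW.
apply/cvgrPdist_le => e e0.
have e1 : 0 < e / (L + 1) by rewrite divr_gt0// ltr_wpDl.
have := cvge0_le e1 cU; apply: filterS => m le.
have Le : L * (e / (L + 1)) <= e.
  by rewrite mulrCA ler_piMr ?(ltW e0)// ler_pdivrMr ?mul1r ?lerDl// ltr_wpDl.
have leL : (L%:E * \int[P]_w (`|U w - Um m w|)%:E <= e%:E)%E.
  apply: (@le_trans _ _ (L * (e / (L + 1)))%:E); last by rewrite lee_fin.
  by rewrite EFinM lee_wpmul2l// lee_fin.
have leL' : (L%:E * \int[P]_w (`|Um m w - U w|)%:E <= e%:E)%E.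
  by under eq_integral do rewrite distrC.
have := step _ _ mU (mUm m); have := step _ _ (mUm m) mU.
move=> /le_trans/(_ (leeD2l _ leL')) + /le_trans/(_ (leeD2l _ leL)).
rewrite (integral_test_fin P U hf) (integral_test_fin P (Um m) hf).
by rewrite -!EFinD !lee_fin ler_norml /= => h1 h2; apply/andP; split; lra.
Qed.

Lemma ae_test_cvg (Un : nat -> T -> R) (U : T -> R) :
  (forall n, measurable_fun setT (Un n)) -> measurable_fun setT U ->
  {ae P, forall w, Un n w @[n --> \oo] --> U w} ->
  (\int[P]_w (f (Un n w))%:E)%E @[n --> \oo] --> (\int[P]_w (f (U w))%:E)%E.
Proof.
move=> mUn mU cU; have [mf f01 [L L0 fL]] := hf.
have [|||||_ _] := @dominated_convergence _ _ R P setT measurableT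
  (fun n w => (f (Un n w))%:E) (fun w => (f (U w))%:E) (fun=> 1%E).
- by move=> n; apply/measurable_EFinP; exact: measurableT_comp.
- by apply/measurable_EFinP; exact: measurableT_comp.
- apply: filterS cU => w cw _; apply: cvg_EFin; first exact: nearW.
  apply/cvgrPdist_le => e e0.
  have e1 : 0 < e / (L + 1) by rewrite divr_gt0// ltr_wpDl.
  have /cvgrPdist_le/(_ _ e1) := cw; apply: filterS => n le.
  rewrite (le_trans (fL _ _))// (le_trans (ler_wpM2l L0 le))//.
  by rewrite mulrCA ler_piMr ?(ltW e0)// ler_pdivrMr ?mul1r ?lerDl// ltr_wpDl.
- exact: finite_measure_integrable_cst.
- apply: aeW => w n _; case/andP: (f01 (Un n w)) => f0 f1.
  by rewrite gee0_abs lee_fin.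
by [].
Qed.

End one.

(** The two limits are taken one after the other: equality for every [(n, m)] gives equality for
    every [n], then for the limits. *)
Lemma iterated_test_limit {d d'} {T : measurableType d} {T' : measurableType d'}
    (P : probability T R) (P' : probability T' R) (f : R -> R)
    (Unm : nat -> nat -> T -> R) (Un : nat -> T -> R) (U : T -> R)
    (Unm' : nat -> nat -> T' -> R) (Un' : nat -> T' -> R) (U' : T' -> R) :
  test_function f ->
  (forall n m, measurable_fun setT (Unm n m)) -> (forall n, measurable_fun setT (Un n)) ->
  measurable_fun setT U ->
  (forall n m, measurable_fun setT (Unm' n m)) -> (forall n, measurable_fun setT (Un' n)) ->
  measurable_fun setT U' ->
  (forall n, (\int[P]_w (`|Un n w - Unm n m w|)%:E)%E @[m --> \oo] --> 0%E) ->
  {ae P, forall w, Un n w @[n --> \oo] --> U w} ->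
  (forall n, (\int[P']_w (`|Un' n w - Unm' n m w|)%:E)%E @[m --> \oo] --> 0%E) ->
  {ae P', forall w, Un' n w @[n --> \oo] --> U' w} ->
  (forall n m, (\int[P]_w (f (Unm n m w))%:E = \int[P']_w (f (Unm' n m w))%:E)%E) ->
  (\int[P]_w (f (U w))%:E = \int[P']_w (f (U' w))%:E)%E.
Proof.
move=> hf m1 m2 m3 m1' m2' m3' c1 c2 c1' c2' e.
have en n : (\int[P]_w (f (Un n w))%:E = \int[P']_w (f (Un' n w))%:E)%E.
  have := L1_test_cvg hf (m1 n) (m2 n) (c1 n).
  under eq_fun do rewrite e.
  by move=> cv; apply: (cvg_unique _ cv (L1_test_cvg hf (m1' n) (m2' n) (c1' n))).
have := ae_test_cvg hf m2 m3 c2; under eq_fun do rewrite en.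
by move=> cv; apply: (cvg_unique _ cv (ae_test_cvg hf m2' m3' c2')).
Qed.

Lemma ae_product_snd {d1 d2} {T1 : measurableType d1} {T2 : measurableType d2}
    (m1 : probability T1 R) (m2 : probability T2 R) (Q : T2 -> Prop) :
  {ae m2, forall w, Q w} -> {ae (m1 \x m2)%E, forall z, Q z.2}.
Proof.
move=> [N [mN N0 QN]]; exists (setT `*` N); split.
- exact: measurableX.
- rewrite product_measure1E//.
  exact: (etrans (congr1 (fun x => (m1 setT * x)%E) N0) (mule0 _)).
- by move=> z /= nQ; split => //; apply: QN.
Qed.

End iterated_limits.

Section affine_law.
Context {R : realType} {d : nat}.

Section measurability.
Context {disp} {T : measurableType disp} (P : probability T R).
Variables (X : R -> T -> 'I_d) (B : R -> {RV P >-> R}) (N : nat) (h : R).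
Hypothesis mX : forall t : R, 0 <= t -> forall x, measurable [set w | X t w = x].
Hypothesis h0 : 0 < h.

Lemma measurable_finite_path (g : {ffun 'I_N.+1 -> 'I_d} -> R) :
  measurable_fun setT (fun w => g (finite_path X h N w)).
Proof.
rewrite (_ : (fun w => _) = (fun w =>
    \sum_xi g xi * \1_[set w | finite_path X h N w = xi] w)).
  apply: measurable_sum => xi; apply: measurable_funM => //.
  by apply: measurable_indic; exact: measurable_path_event_finite.
apply/funext => w; rewrite (bigD1 (finite_path X h N w))//= indicE mem_set// mulr1.
rewrite big1 ?addr0// => xi xiw; rewrite indicE memNset ?mulr0//= => wxi.
by rewrite wxi eqxx in xiw.
Qed.

Lemma measurable_path_sum (c : {ffun 'I_N.+1 -> 'I_d} -> nat -> R) K :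
  measurable_fun setT (fun w => brownian_sum B h (c (finite_path X h N w)) K w).
Proof.
apply: measurable_sum => k; apply: measurable_funM; last exact: measurable_increment.
exact: (measurable_finite_path (fun xi => c xi k)).
Qed.

End measurability.

Lemma eq_finite_path_law {disp disp'} {T : measurableType disp}
    {T' : measurableType disp'} (P : probability T R) (P' : probability T' R)
    (A : 'M[R]_d) (X : R -> T -> 'I_d) (X' : R -> T' -> 'I_d) (h : R) N xi :
  markov_process P A X -> markov_process P' A X' -> 0 <= h ->
  (forall x, P [set w | X 0 w = x] = P' [set w | X' 0 w = x]) ->
  P [set w | finite_path X h N w = xi] = P' [set w | finite_path X' h N w = xi].
Proof.
by move=> mX mX' h0 X00; rewrite !finite_path_event; exact: (eq_path_law _ _ mX mX').
Qed.

Variables (A : 'M[R]_d) (lambda sigma : 'I_d -> R) (t : R).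
Hypothesis t0 : 0 < t.
Context {disp} {T : measurableType disp} (P : probability T R).
Variables (X : R -> T -> 'I_d) (B Y : R -> {RV P >-> R}).

(** One pair [(M, S)] serves every model with the same initial law of [X], in particular the one it
    was built from; this common noise is what the coupling needs. *)
Lemma affine_law : switched_model A lambda sigma X B Y ->
  exists M S : {RV P >-> R},
  [/\ {ae P, forall w, M w =
        expR (- \int[lebesgue_measure]_(u in `[0, t]) lambda (X u w))} &
      forall (disp' : measure_display) (T' : measurableType disp')
        (P' : probability T' R) (X' : R -> T' -> 'I_d) (B' Y' : R -> {RV P' >-> R}),
      switched_model A lambda sigma X' B' Y' ->
      (forall x, P [set w | X 0 w = x] = P' [set w | X' 0 w = x]) ->
      forall U, measurable U -> law (Y' t) U =
        (law (Y' 0%R) \x P)%E [set z | U (z.1 * M z.2 + S z.2)]].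
Proof.
move=> mod; have [M [S [Mn [Sn [ME _ cM cS cn]]]]] := affine_approximation t0 mod.
exists M, S; split => // disp' T' P' X' B' Y' mod' X00 U mU.
have [M' [S' [Mn' [Sn' [_ YE' cM' cS' cn']]]]] := affine_approximation t0 mod'.
have [mkX BM indep _] := mod; have [mkX' BM' indep' _] := mod'.
have [mX _ _] := mkX; have [mX' _ _] := mkX'.
have h0 n m : 0 < mesh (mesh t n) m by apply: mesh_gt0; exact: mesh_gt0.
have mphi (a b : {RV P >-> R}) :
    measurable_fun setT (fun z : R * T => z.1 * a z.2 + b z.2).
  apply: measurable_funD; last exact: measurableT_comp.
  by apply: measurable_funM => //; exact: measurableT_comp.
pose phi : {mfun (R * T)%type >-> R} := HB.pack (fun z : R * T => z.1 * M z.2 + S z.2)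
  (isMeasurableFun.Build _ _ _ _ _ (mphi M S)).
apply: (eq_prob_test (m2 := distribution (law (Y' 0%R) \x P)%E phi)) mU => f hf.
have [mf f01 _] := hf.
have f0 y : (0 <= (f y)%:E)%E by rewrite lee_fin; case/andP: (f01 y).
have mfE : measurable_fun setT (EFin \o f) by exact/measurable_EFinP.
rewrite !ge0_integral_distribution//.
pose fp n m w := finite_path X (mesh (mesh t n) m) (n.+1 * m.+1) w.
pose fp' n m w := finite_path X' (mesh (mesh t n) m) (n.+1 * m.+1) w.
pose a n m (xi : {ffun 'I_(n.+1 * m.+1).+1 -> 'I_d}) :=
  scheme_factor lambda t n m (extend_path xi).
pose c n m (xi : {ffun 'I_(n.+1 * m.+1).+1 -> 'I_d}) :=
  scheme_coef lambda sigma t n m (extend_path xi).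
pose bs n m w := brownian_sum B (mesh (mesh t n) m) (c n m (fp n m w)) (n.+1 * m.+1) w.
pose bs' n m w := brownian_sum B' (mesh (mesh t n) m) (c n m (fp' n m w)) (n.+1 * m.+1) w.
have mbs n m : measurable_fun setT (bs n m) by exact: measurable_path_sum.
have mbs' n m : measurable_fun setT (bs' n m) by exact: measurable_path_sum.
have mUnm n m : measurable_fun setT (fun z : R * T => z.1 * a n m (fp n m z.2) + bs n m z.2).
  apply: measurable_funD; last exact: measurableT_comp.
  apply: measurable_funM => //; apply: (measurableT_comp (f := fun w => a n m (fp n m w))) => //.
  exact: measurable_finite_path.
apply: (@iterated_test_limit _ _ _ _ _ P' (law (Y' 0%R) \x P)%E f
  (fun n m w => Y' 0 w * a n m (fp' n m w) + bs' n m w)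
  (fun n w => Y' 0 w * Mn' n w + Sn' n w) (Y' t)
  (fun n m z => z.1 * a n m (fp n m z.2) + bs n m z.2)
  (fun n z => z.1 * Mn n z.2 + Sn n z.2) (fun z => z.1 * M z.2 + S z.2)) => //.
- move=> n m; apply: measurable_funD => //; apply: measurable_funM => //.
  exact: measurable_finite_path.
- by move=> n; apply: measurable_funD => //; exact: measurable_funM.
- move=> n; have [aE cv] := cn' n; apply: cvg_trans cv; apply: near_eq_cvg.
  apply: nearW => m; apply: eq_integral => w _; congr (`|_|)%:E.
  have aw : a n m (fp' n m w) = Mn' n w := aE m w.
  by rewrite aw opprD addrACA subrr add0r.
- apply: filterS2 cM' cS' => w cMw cSw; rewrite YE'; apply: cvgD => //.
  exact: cvgMl_tmp.
- move=> n; have [aE cv] := cn n; apply: cvg_trans cv; apply: near_eq_cvg.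
  apply: nearW => m.
  transitivity (\int[law (Y' 0%R) \x P]_z (`|Sn n z.2 - bs n m z.2|)%:E)%E; last first.
    apply: eq_integral => z _; congr (`|_|)%:E.
    have az : a n m (fp n m z.2) = Mn n z.2 := aE m z.2.
    by rewrite az opprD addrACA subrr add0r.
  have mg : measurable_fun setT (fun z : R * T => (`|Sn n z.2 - bs n m z.2|)%:E).
    apply/measurable_EFinP; apply: measurableT_comp => //.
    by apply: measurable_funB; exact: measurableT_comp.
  rewrite fubini_tonelli1//.
  by rewrite /fubini_F/= integral_prob_cst.
- apply: filterS (ae_product_snd (law (Y' 0%R)) (filterI cM cS)) => -[y w] /= [cMw cSw].
  by apply: cvgD => //; exact: cvgMl_tmp.
- move=> n m.
  have := @eq_path_expectation R d (n.+1 * m.+1) (n.+1 * m.+1) (mesh (mesh t n) m)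
    (a n m) (c n m) _ _ _ _ P P' X X' B B' (Y 0) (Y' 0) mX mX' BM BM' (h0 n m)
    indep indep' (fun xi => eq_finite_path_law xi mkX mkX' (ltW (h0 n m)) X00)
    (EFin \o f) mfE f0.
  move=> ->; rewrite fubini_tonelli1//.
  by apply/measurable_EFinP; exact: (measurableT_comp mf (mUnm n m)).
Qed.

End affine_law.

(** * Coupling *)

Lemma product_marginal {R : realType} {d1 d2 d3} {T1 : measurableType d1}
    {T2 : measurableType d2} {T3 : measurableType d3} (pi : probability T1 R)
    (P : probability T2 R) (nu : probability T3 R) (g : T1 -> T3) (U : set (T3 * T2)) :
  measurable_fun setT g -> (forall V, measurable V -> pi (g @^-1` V) = nu V) ->
  measurable U -> (pi \x P)%E [set z | U (g z.1, z.2)] = (nu \x P)%E U.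
Proof.
move=> mg gnu mU.
have mphi : measurable_fun setT (fun z : T1 * T2 => (g z.1, z.2)).
  by apply: measurable_fun_pair => //; exact: measurableT_comp.
pose phi : {mfun (T1 * T2)%type >-> (T3 * T2)%type} :=
  HB.pack (fun z : T1 * T2 => (g z.1, z.2)) (isMeasurableFun.Build _ _ _ _ _ mphi).
apply/esym; apply: (product_measure_unique (m' := distribution (pi \x P)%E phi)) => // V W mV mW.
rewrite /= /distribution /pushforward (_ : _ @^-1` _ = (g @^-1` V) `*` W)//.
have mgV : measurable (g @^-1` V) by rewrite -[g @^-1` V]setTI; exact: mg.
by rewrite product_measure1E//; congr (_ * _)%E; exact: gnu.
Qed.

Lemma Wasserstein_pow {R : realType} (p : R) (rho rho' : probability R R) : 0 < p ->
  poweR (Wasserstein p rho rho') p =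
  ereal_inf [set (\int[pi]_z (`|z.1 - z.2| `^ p)%:E)%E | pi in [set pi | coupling rho rho' pi]].
Proof.
move=> p0; rewrite /Wasserstein -poweRrM mulVf ?gt_eqF// poweRe1//.
apply: le_ereal_inf_tmp => _ [pi _ <-]; apply: integral_ge0 => z _.
by rewrite lee_fin powR_ge0.
Qed.

Section affine_coupling.
Context {R : realType} {d} {T : measurableType d} (P : probability T R).
Variables M S : {RV P >-> R}.

(* Both coordinates are transported by the same random affine map. *)
Lemma Wasserstein_affine_le (p K : R) (rho rho' nu nu' : probability R R) :
  0 < p -> 0 < K -> (\int[P]_w (`|M w| `^ p)%:E <= K%:E)%E ->
  (forall U, measurable U -> nu U = (rho \x P)%E [set z | U (z.1 * M z.2 + S z.2)]) ->
  (forall U, measurable U -> nu' U = (rho' \x P)%E [set z | U (z.1 * M z.2 + S z.2)]) ->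
  (poweR (Wasserstein p nu nu') p <= K%:E * poweR (Wasserstein p rho rho') p)%E.
Proof.
move=> p0 K0 MK nuE nuE'; rewrite !Wasserstein_pow//.
(* With [K] divided out, the bound is tested against each coupling [pi] of the initial laws, optimal
   or not. *)
rewrite -lee_pdivrMl//; apply: le_ereal_inf_tmp => _ [pi [pi1 pi2] <-].
rewrite lee_pdivrMl//.
have maff (g : R * R -> R) : measurable_fun setT g ->
    measurable_fun setT (fun z : (R * R) * T => g z.1 * M z.2 + S z.2).
  move=> mg; apply: measurable_funD; last exact: measurableT_comp.
  by apply: measurable_funM; exact: measurableT_comp.
have mphi : measurable_fun setT
    (fun z : (R * R) * T => (z.1.1 * M z.2 + S z.2, z.1.2 * M z.2 + S z.2)).
  by apply: measurable_fun_pair; [apply: (maff fst)|apply: (maff snd)].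
pose phi : {mfun ((R * R) * T)%type >-> (R * R)%type} :=
  HB.pack (fun z : (R * R) * T => (z.1.1 * M z.2 + S z.2, z.1.2 * M z.2 + S z.2))
    (isMeasurableFun.Build _ _ _ _ _ mphi).
have msub : measurable_fun setT (fun z : R * T => z.1 * M z.2 + S z.2).
  apply: measurable_funD; last exact: measurableT_comp.
  by apply: measurable_funM => //; exact: measurableT_comp.
have mset (U : set R) : measurable U ->
    measurable [set z : R * T | U (z.1 * M z.2 + S z.2)].
  by move=> mU; rewrite -[X in measurable X]setTI; exact: msub.
pose pi' := distribution (pi \x P)%E phi.
have cpi : coupling nu nu' pi'.
  split=> U mU; rewrite ?(nuE U mU) ?(nuE' U mU).
    exact: (@product_marginal _ _ _ _ _ _ _ pi P rho fst _ measurable_fst pi1 (mset _ mU)).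
  exact: (@product_marginal _ _ _ _ _ _ _ pi P rho' snd _ measurable_snd pi2 (mset _ mU)).
apply: (@le_trans _ _ (\int[pi']_z (`|z.1 - z.2| `^ p)%:E)%E).
  by apply: ereal_inf_lbound; exists pi'.
have mcost : measurable_fun setT (fun z : R * R => (`|z.1 - z.2| `^ p)%:E).
  apply/measurable_EFinP; apply: (measurableT_comp (measurable_powR p)).
  by apply: measurableT_comp => //; exact: measurable_funB.
have mMp : measurable_fun setT (fun w => (`|M w| `^ p)%:E).
  apply/measurable_EFinP; apply: (measurableT_comp (measurable_powR p)).
  exact: measurableT_comp.
rewrite ge0_integral_distribution//.
(* [S] cancels in the difference of the coordinates and [M] factors out, so the cost is a
   product. *)
have -> : (\int[pi \x P]_z ((fun z : R * R => (`|z.1 - z.2| `^ p)%:E) \o phi) z =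
    \int[pi \x P]_z ((`|z.1.1 - z.1.2| `^ p)%:E * (`|M z.2| `^ p)%:E))%E.
  apply: eq_integral => z _; rewrite /phi/= -EFinM -powRM// -normrM.
  by congr (`|_| `^ _)%:E; ring.
rewrite fubini_tonelli1; last 2 first.
- by apply: emeasurable_funM; [exact: (measurableT_comp mcost)|exact: (measurableT_comp mMp)].
- by move=> z; rewrite mule_ge0// lee_fin powR_ge0.
rewrite /fubini_F/=.
under eq_integral => z _ do rewrite ge0_integralZl ?lee_fin ?powR_ge0//.
rewrite ge0_integralZr//; last first.
- by apply: integral_ge0 => w _; rewrite lee_fin powR_ge0.
rewrite muleC; apply: lee_wpmul2r => //.
by apply: integral_ge0 => z _; rewrite lee_fin powR_ge0.
Qed.

End affine_coupling.

Theorem theorem1p7 (R : realType) (d : nat) (hd : (2 <= d)%N)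
    (A : 'M[R]_d) (lambda sigma : 'I_d -> R) (p : R)
    (hA : generator_matrix A)
    (hirr : irreducible_chain (embedded_chain A))
    (hrec : recurrent_chain (embedded_chain A))
    (hsigma : forall x, 0 < sigma x)
    (hp : 1 <= p) (hpk : (p%:E < kappa A lambda)%E) :
  exists C : R,
    forall (disp disp' : measure_display)
      (T : measurableType disp) (T' : measurableType disp')
      (P : probability T R) (P' : probability T' R)
      (X : R -> T -> 'I_d) (X' : R -> T' -> 'I_d)
      (B Y : R -> {RV P >-> R}) (B' Y' : R -> {RV P' >-> R}),
    switched_model A lambda sigma X B Y ->
    switched_model A lambda sigma X' B' Y' ->
    (forall x, P [set w | X 0 w = x] = P' [set w | X' 0 w = x]) ->
    finite_moment p (law (Y 0)) ->
    finite_moment p (law (Y' 0)) ->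
    forall t : R, 0 <= t ->
      (poweR (Wasserstein p (law (Y t)) (law (Y' t))) p
       <= (C * expR (- eta A lambda p * t))%:E *
          poweR (Wasserstein p (law (Y 0%R)) (law (Y' 0%R))) p)%E.
Proof.
have [C C1 moment] := damping_moment lambda p hd hA hirr.
have p0 : 0 < p by rewrite (lt_le_trans ltr01).
exists C => disp disp' T T' P P' X X' B Y B' Y' mod mod' X00 _ _ t.
rewrite le_eqVlt => /predU1P[<-|t0].
  (* Grids need [t > 0]; at time 0 the claim is the bound [1 <= C]. *)
  rewrite mulr0 expR0 mulr1 -[leLHS]mul1e; apply: lee_wpmul2r.
    exact: poweR_ge0.
  by rewrite lee_fin.
have [M [S [ME lawE]]] := affine_law t0 mod.
have mabs : measurable_fun setT (fun w => `|M w|) by exact: measurableT_comp.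
(* [M] is an exponential only almost surely, so the moment bound is read on its absolute value. *)
pose aM : {RV P >-> R} := HB.pack (fun w => `|M w|)
  (isMeasurableFun.Build _ _ _ _ _ mabs).
apply: (@Wasserstein_affine_le _ _ _ P M S) => //.
- by rewrite mulr_gt0 ?expR_gt0// (lt_le_trans ltr01).
- have [mkX _ _ _] := mod; apply: (moment _ _ P X t aM mkX t0).
  by apply: filterS ME => w Mw; rewrite /aM/= Mw ger0_norm// expR_ge0.
(* The first model is one of those to which its own affine map applies. *)
- exact: (lawE _ _ _ _ _ _ mod).
- exact: (lawE _ _ _ _ _ _ mod').
Qed.
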